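(* Let $H$ be a semisimple Hopf algebra over $\mathbb{C}$. Then for any finite-dimensional left $H$-module $V$, $$\nu_n(H^{\ast\mathrm{cop}}\bowtie V)=\sum_{W\in\mathsf{Irr}(H)}\nu_n^H(V\otimes W)\,\nu_n^{H^{\mathrm{cop}}}(W)\qquad(\forall n\geq1),$$ where $\mathsf{Irr}(H)$ is the set of isoclasses of irreducible left $H$-modules and $H^{\ast\mathrm{cop}}\bowtie V$ is the vector space $H^\ast\otimes V$ regarded as a left module over the Drinfeld double $D(H)$ with structure $$(f\bowtie h)\otimes(g\bowtie v)\mapsto\sum\langle g_{(3)},h_{(1)}\rangle\,(fg_{(2)}\bowtie h_{(2)}v)\,\langle S^{-1}(g_{(1)}),h_{(3)}\rangle.$$
   Context: Semisimple Hopf algebras are finite-dimensional. $D(H)=H^{\ast\mathrm{cop}}\bowtie H$ is the Drinfeld double: the vector space $H^\ast\otimes H$ with tensor product coalgebra structure of $H^{\ast\mathrm{cop}}\otimes H$, unit $\varepsilon\bowtie 1$ and product $(f\bowtie h)(g\bowtie h')=\sum\langle g_{(3)},h_{(1)}\rangle(fg_{(2)}\bowtie h_{(2)}h')\langle S^{-1}(g_{(1)}),h_{(3)}\rangle$ (Sweedler indices and antipode for $g$ taken in $H^\ast$). $V\otimes W$ is the usual diagonal $H$-module $h\cdot(v\otimes w)=\sum h_{(1)}v\otimes h_{(2)}w$, and $W$ is also regarded as a left module over $H^{\mathrm{cop}}$ ($H$ with opposite comultiplication). For a finite-dimensional left module $V$ over a semisimple Hopf algebra $A$ over $\mathbb{C}$,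 $\nu_n(V)=\nu_n^A(V)=\langle\chi_V,\sum\Lambda_{(1)}\Lambda_{(2)}\cdots\Lambda_{(n)}\rangle$, where $\chi_V$ is the character of $V$ and $\Lambda$ is the integral of $A$ with $\varepsilon(\Lambda)=1$. *)

(* Defs.v *)
From HB Require Import structures.
From mathcomp Require Import all_boot all_order all_algebra all_field.
From mathcomp Require Import boolp classical_sets.

Set Implicit Arguments.
Unset Strict Implicit.
Unset Printing Implicit Defensive.

Import GRing.Theory.

Local Open Scope ring_scope.
Local Open Scope classical_set_scope.

(* V \otimes W is modelled by Hom(V^*, W), the pure tensor v \otimes w being   *)
(* the map f |-> f(v) w.  A bilinear map B : V x W -> U extends to V \otimes W *)
(* by contracting with the basis b of V and its dual basis b^*:                *)
(*   t |-> \sum_i B (b_i, t(b_i^* )).                                          *)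
Section Tensor.
Context (K : fieldType).
Implicit Types (V W : vectType K) (U : lmodType K).

Definition tensor V W : vectType K := 'Hom('Hom(V, K^o), W).

Definition tens V W (v : V) (w : W) : tensor V W :=
  linfun (fun f : 'Hom(V, K^o) => (f v : K) *: w).

Definition dual_basis V (i : 'I_(\dim {:V})) : 'Hom(V, K^o) :=
  linfun (coord (vbasis {:V}) i : V -> K^o).

Definition tlift V W U (B : V -> W -> U) (t : tensor V W) : U :=
  \sum_(i < \dim {:V}) B (vbasis {:V})`_i (t (dual_basis i)).

Definition bilinear_map V W U (B : V -> W -> U) : Prop :=
  (forall w, linear (B^~ w)) /\ (forall v, linear (B v)).

Lemma linfunE V W (f : V -> W) : linear f -> linfun f =1 f.
Proof.
by move=> lin; exact: (lfunE (HB.pack f (GRing.isLinear.Build K V W _ f lin))).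
Qed.

Lemma linear_sumZ (U U' : lmodType K) (f : U -> U') I (r : seq I) (c : I -> K)
    (v : I -> U) : linear f ->
  f (\sum_(i <- r) c i *: v i) = \sum_(i <- r) c i *: f (v i).
Proof.
move=> lin.
pose F : {linear U -> U'} := HB.pack f (GRing.isLinear.Build K U U' _ f lin).
have FE x : f x = F x by [].
rewrite FE linear_sum; apply: eq_bigr => i _; rewrite linearZ /=.
by rewrite FE.
Qed.

Lemma tensE V W (v : V) (w : W) (f : 'Hom(V, K^o)) :
  tens v w f = (f v : K) *: w.
Proof.
rewrite linfunE // => a f1 f2.
by rewrite add_lfunE scale_lfunE scalerDl scalerA.
Qed.

Lemma dual_basisE V (i : 'I_(\dim {:V})) (v : V) :
  dual_basis i v = coord (vbasis {:V}) i v.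
Proof. exact: lfunE. Qed.

Lemma tens_bilinear V W : bilinear_map (@tens V W).
Proof.
split=> [w a v1 v2 | v a w1 w2]; apply/lfunP=> f;
  rewrite add_lfunE scale_lfunE !tensE.
  by rewrite linearP scalerDl scalerA.
by rewrite scalerDr !scalerA mulrC.
Qed.

Lemma tlift_linear V W U (B : V -> W -> U) :
  bilinear_map B -> linear (tlift B).
Proof.
move=> [_ Br] a s t; rewrite /tlift scaler_sumr -big_split /=.
by apply: eq_bigr => i _; rewrite add_lfunE scale_lfunE Br.
Qed.

Lemma tlift_tens V W U (B : V -> W -> U) (v : V) (w : W) :
  bilinear_map B -> tlift B (tens v w) = B v w.
Proof.
move=> [Bl Br]; rewrite [v in RHS](coord_vbasis (memvf v)).
rewrite (linear_sumZ _ _ _ (Bl w)) /tlift; apply: eq_bigr => i _.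
rewrite tensE dual_basisE.
have := linear_sumZ [:: tt] (fun=> coord (vbasis {:V}) i v) (fun=> w)
  (Br (vbasis {:V})`_i).
by rewrite !big_seq1.
Qed.

Lemma tlift_param V W U U' (F : U' -> V -> W -> U) (t : tensor V W) :
  (forall v w, linear (fun p => F p v w)) -> linear (fun p => tlift (F p) t).
Proof.
move=> lin a p q; rewrite /tlift scaler_sumr -big_split /=.
by apply: eq_bigr => i _; rewrite lin.
Qed.

Lemma tens_decomp V W (t : tensor V W) : tlift (@tens V W) t = t.
Proof.
apply/lfunP=> f; rewrite /tlift sum_lfunE.
under eq_bigr do rewrite tensE -linearZ /=.
rewrite -linear_sum; congr (t _); apply/lfunP=> v; rewrite sum_lfunE.
rewrite [v in RHS](coord_vbasis (memvf v)) linear_sum.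
apply: eq_bigr => i _.
by rewrite scale_lfunE dual_basisE linearZ /= /GRing.scale /= mulrC.
Qed.

End Tensor.

(* Underlying data of a finite-dimensional bialgebra; used for H, H^cop, H^*   *)
(* and D(H).                                                                   *)
Record bialgData (K : fieldType) := BialgData {
  bcar :> vectType K;
  bmul : bcar -> bcar -> bcar;
  bone : bcar;
  bcomul : bcar -> tensor bcar bcar;
  bcounit : bcar -> K }.

Section Bialgebra.
Context (K : fieldType).
Implicit Types A B : bialgData K.

Definition sweedler2 A (U : lmodType K) (F : A -> A -> U) (a : A) : U :=
  tlift F (bcomul a).

Definition sweedler3 A (U : lmodType K) (F : A -> A -> A -> U) (a : A) : U :=
  sweedler2 (fun x a3 => sweedler2 (fun a1 a2 => F a1 a2 a3) x) a.

Lemma sweedler2_linear A (U : lmodType K) (F : A -> A -> U) :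
  linear (@bcomul K A) -> bilinear_map F -> linear (sweedler2 F).
Proof.
by move=> lin bF a x y; rewrite /sweedler2 lin; exact: (tlift_linear bF).
Qed.

Lemma sweedler3_linear A (U : lmodType K) (F : A -> A -> A -> U) :
  linear (@bcomul K A) ->
  (forall a1 a2, linear (F a1 a2)) ->
  (forall a1 a3, linear (fun a2 => F a1 a2 a3)) ->
  (forall a2 a3, linear (fun a1 => F a1 a2 a3)) ->
  linear (sweedler3 F).
Proof.
move=> lin F3 F2 F1; apply: sweedler2_linear => //; split=> [a3 | x].
  by apply: (sweedler2_linear lin); split=> [a2 | a1]; [exact: F1 | exact: F2].
apply: (tlift_param (F := fun a3 a1 a2 => F a1 a2 a3)) => a1 a2; exact: F3.
Qed.

Lemma sweedler3_param A (U U' : lmodType K) (F : U' -> A -> A -> A -> U)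
    (a : A) :
  (forall a1 a2 a3, linear (fun p => F p a1 a2 a3)) ->
  linear (fun p => sweedler3 (F p) a).
Proof.
move=> lin; apply: tlift_param => x a3; apply: tlift_param => a1 a2.
exact: lin.
Qed.

Definition cop A : bialgData K :=
  @BialgData K A (@bmul K A) (bone A)
    (fun a => sweedler2 (fun a1 a2 => tens a2 a1) a) (@bcounit K A).

Definition dual_mul A (f g : 'Hom(A, K^o)) : 'Hom(A, K^o) :=
  linfun (sweedler2 (fun a1 a2 => f a1 * g a2) : A -> K^o).

(* The transpose of the product, so that <f_(1), a> <f_(2), b> = <f, a b>. *)
Definition dual_comul A (f : 'Hom(A, K^o)) :
    tensor 'Hom(A, K^o) 'Hom(A, K^o) :=
  \sum_(i < \dim {:A}) \sum_(j < \dim {:A})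
    (f (bmul (vbasis {:A})`_i (vbasis {:A})`_j) : K) *:
      tens (dual_basis i) (dual_basis j).

Lemma dual_comul_linear A : linear (@dual_comul A).
Proof.
move=> c f g; rewrite /dual_comul scaler_sumr -big_split /=.
apply: eq_bigr => i _; rewrite scaler_sumr -big_split /=.
by apply: eq_bigr => j _; rewrite add_lfunE scale_lfunE scalerDl scalerA.
Qed.

Lemma dual_comulE A (f : 'Hom(A, K^o)) (a b : A) :
  bilinear_map (@bmul K A) ->
  tlift (fun f1 f2 : 'Hom(A, K^o) => f1 a * f2 b : K^o) (dual_comul f) =
  f (bmul a b).
Proof.
move=> [ml mr].
have bil : bilinear_map (fun f1 f2 : 'Hom(A, K^o) => f1 a * f2 b : K^o).
  split=> [f2 | f1] c x y; rewrite add_lfunE scale_lfunE.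
    by rewrite mulrDl /GRing.scale /= mulrA.
  by rewrite mulrDr /GRing.scale /= mulrCA.
rewrite /dual_comul pair_big /= (linear_sumZ _ _ _ (tlift_linear bil)).
rewrite [a in RHS](coord_vbasis (memvf a)) (linear_sumZ _ _ _ (ml b)).
rewrite [b in RHS](coord_vbasis (memvf b)) linear_sum /=.
under [RHS]eq_bigr do
  rewrite linearZ /= (linear_sumZ _ _ _ (mr _)) linear_sum /= scaler_sumr.
rewrite pair_big /=; apply: eq_bigr => -[i j] _ /=.
rewrite tlift_tens // !dual_basisE [f (_ *: _)]linearZ /GRing.scale /=.
by rewrite mulrCA; congr (_ * _); rewrite mulrC.
Qed.

Definition dual A : bialgData K :=
  @BialgData K 'Hom(A, K^o) (@dual_mul A) (linfun (@bcounit K A : A -> K^o))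
    (@dual_comul A) (fun f => f (bone A)).

Definition tensor_comul A B (t : tensor A B) :
    tensor (tensor A B) (tensor A B) :=
  tlift (fun a b =>
    sweedler2 (fun a1 a2 =>
      sweedler2 (fun b1 b2 => tens (tens a1 b1) (tens a2 b2)) b) a) t.

Definition tensor_counit A B (t : tensor A B) : K :=
  tlift (U := K^o) (fun a b => bcounit a * bcounit b) t.

Definition is_normalized_integral A (L : A) : Prop :=
  (forall a : A, bmul a L = bcounit a *: L /\ bmul L a = bcounit a *: L)
  /\ bcounit L = 1.

(* A two-sided integral L with counit 1 is unique, as L = L L' = L'. *)
Definition normalized_integral A : A :=
  xget 0 [set L | is_normalized_integral L].

(* a_(1) a_(2) ... a_(n); the unit composed with the counit when n = 0. *)
Fixpoint sweedler_power A (n : nat) (a : A) : A :=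
  match n with
  | 0 => bcounit a *: bone A
  | 1 => a
  | n'.+1 => sweedler2 (fun a1 a2 => bmul (sweedler_power n' a1) a2) a
  end.

End Bialgebra.

Record moduleData (K : fieldType) (A : vectType K) := ModuleData {
  mcar :> vectType K;
  act : A -> mcar -> mcar }.

Definition lftrace (K : fieldType) (V : vectType K) (f : 'End(V)) : K :=
  \sum_(i < \dim {:V}) coord (vbasis {:V}) i (f (vbasis {:V})`_i).

Definition mchar (K : fieldType) (A : vectType K) (V : moduleData A) (a : A) :
    K :=
  lftrace (linfun (act (m := V) a)).

Definition FSindicator (K : fieldType) (A : bialgData K) (V : moduleData A)
    (n : nat) : K :=
  mchar V (sweedler_power n (normalized_integral A)).

Section Modules.
Context (K : fieldType) (A : falgType K).

Definition is_module (V : moduleData A) : Prop :=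
  [/\ bilinear_map (act (m := V)),
      forall v : V, act 1 v = v
    & forall (a b : A) (v : V), act (a * b) v = act a (act b v)].

Record lmodule := Lmodule {
  lmdata :> moduleData A;
  lmP : is_module lmdata }.

Definition regular_data : moduleData A := @ModuleData K A A *%R.

Lemma regularP : is_module regular_data.
Proof.
split=> [|v|a b v]; [split=> v c x y| |]; rewrite /act /=.
- by rewrite mulrDl scalerAl.
- by rewrite mulrDr scalerAr.
- exact: mul1r.
- by rewrite mulrA.
Qed.

Definition regular : lmodule := Lmodule regularP.

Definition is_submodule (V : lmodule) (U : {vspace V}) : Prop :=
  forall (a : A) (v : V), v \in U -> act a v \in U.

Definition irreducible_module (V : lmodule) : Prop :=
  (fullv : {vspace V}) <> 0%VS /\
  forall U : {vspace V}, is_submodule U -> U = 0%VS \/ U = fullv.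

Definition semisimple_module (V : lmodule) : Prop :=
  forall U : {vspace V}, is_submodule U ->
  exists W : {vspace V},
    [/\ is_submodule W, (U + W = fullv)%VS & (U :&: W = 0)%VS].

Definition semisimple : Prop := semisimple_module regular.

Definition module_iso (V W : lmodule) : Prop :=
  exists f : 'Hom(V, W),
    bijective f /\ forall (a : A) (v : V), f (act a v) = act a (f v).

(* The modules carried by some K^d: they meet every isoclass of               *)
(* finite-dimensional modules, and unlike lmodule they form a type small       *)
(* enough for isoclasses to be sets.                                           *)
Record stdmodule := Stdmodule {
  stdim : nat;
  stdact : A -> 'cV[K]_stdim -> 'cV[K]_stdim;
  stdP : is_module (@ModuleData K A 'cV[K]_stdim stdact) }.

HB.instance Definition _ := gen_eqMixin stdmodule.
HB.instance Definition _ := gen_choiceMixin stdmodule.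

Coercion lmodule_of_std (W : stdmodule) : lmodule := Lmodule (stdP W).

Definition isoclass (V : lmodule) : set stdmodule :=
  [set W : stdmodule | module_iso V W].

Definition Irr : set (set stdmodule) :=
  [set c | exists V : lmodule, irreducible_module V /\ c = isoclass V].

Lemma isoclass_nonempty (V : lmodule) : exists W, isoclass V W.
Proof.
have [[al ar] a1 aM] := lmP V.
pose n := \dim {:V}; pose b := vbasis {:V}.
pose p (v : V) : 'cV[K]_n := \col_i coord b i v.
pose q (x : 'cV[K]_n) : V := \sum_i x i 0 *: b`_i.
have pq : cancel p q.
  move=> v; rewrite [RHS](coord_vbasis (memvf v)); apply: eq_bigr => i _.
  by rewrite mxE.
have freeb : free b by exact: (basis_free (vbasisP _)).
have qp : cancel q p.
  by move=> x; apply/colP => i; rewrite mxE coord_sum_free.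
have pl : linear p by move=> c x y; apply/colP => i; rewrite !mxE linearP.
have ql : linear q.
  move=> c x y; rewrite /q scaler_sumr -big_split /=.
  by apply: eq_bigr => i _; rewrite !mxE scalerDl scalerA.
have WP : is_module (@ModuleData K A 'cV[K]_n (fun a x => p (act a (q x)))).
  split=> [|x|a c x]; [split=> v c x y| |]; rewrite /= ?a1 ?pq ?aM //=.
  - by rewrite al pl.
  - by rewrite ql ar pl.
exists (Stdmodule WP); exists (linfun p : 'Hom(V, 'cV[K]_n)); split.
  by exists q => x; rewrite (linfunE pl).
by move=> a v; rewrite !(linfunE pl) /= pq.
Qed.

Lemma zero_stdP : is_module (@ModuleData K A 'cV[K]_0 (fun _ v => v)).
Proof. by split=> [|v|a b v]; [split=> v c x y| |]; rewrite // !flatmx0. Qed.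

(* A representative of an isoclass; the default value is never used.           *)
Definition repr_module (c : set stdmodule) : stdmodule :=
  xget (Stdmodule zero_stdP) c.

End Modules.

Record hopfAlgebra (K : fieldType) := HopfAlgebra {
  halg :> falgType K;
  hcomul : {linear halg -> tensor halg halg};
  hcounit : {linear halg -> K^o};
  antipode : 'End(halg);
  hcoassoc : forall h : halg,
    tlift (fun x h3 =>
      tlift (fun h1 h2 => tens h1 (tens h2 h3)) (hcomul x)) (hcomul h) =
    tlift (fun h1 x =>
      tlift (fun h2 h3 => tens h1 (tens h2 h3)) (hcomul x)) (hcomul h);
  hcounitl : forall h : halg,
    tlift (fun h1 h2 => (hcounit h1 : K) *: h2) (hcomul h) = h;
  hcounitr : forall h : halg,
    tlift (fun h1 h2 => (hcounit h2 : K) *: h1) (hcomul h) = h;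
  hcomul1 : hcomul 1 = tens 1 1;
  hcomulM : forall g h : halg, hcomul (g * h) =
    tlift (fun g1 g2 =>
      tlift (fun h1 h2 => tens (g1 * h1) (g2 * h2)) (hcomul h)) (hcomul g);
  hcounit1 : hcounit 1 = 1;
  hcounitM : forall g h : halg, hcounit (g * h) = hcounit g * hcounit h;
  antipodel : forall h : halg,
    tlift (fun h1 h2 => antipode h1 * h2) (hcomul h) = (hcounit h : K)%:A;
  antipoder : forall h : halg,
    tlift (fun h1 h2 => h1 * antipode h2) (hcomul h) = (hcounit h : K)%:A }.

Section DrinfeldDouble.
Context (K : fieldType) (H : hopfAlgebra K).

Definition hbialg : bialgData K :=
  @BialgData K H *%R 1 (hcomul H) (hcounit H).

Lemma dual_mulE (f g : 'Hom(H, K^o)) (h : H) :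
  dual_mul (A := hbialg) f g h =
  tlift (fun h1 h2 => f h1 * g h2 : K^o) (hcomul H h).
Proof.
rewrite /dual_mul linfunE //; apply: sweedler2_linear.
  by move=> a x y; exact: linearP.
split=> [h2 | h1] a x y; rewrite linearP /=.
  by rewrite mulrDl /GRing.scale /= mulrA.
by rewrite mulrDr /GRing.scale /= mulrCA.
Qed.

Definition tensor_module (V W : moduleData H) : moduleData H :=
  @ModuleData K H (tensor V W) (fun h t =>
    tlift (fun v w =>
      sweedler2 (A := hbialg) (fun h1 h2 => tens (act h1 v) (act h2 w)) h) t).

Definition dual_antipode : 'End('Hom(H, K^o)) :=
  linfun (fun f => (f \o antipode H)%VF).

(* (f \bowtie h) (g \bowtie v) =                                               *)
(*   \sum <g_(3), h_(1)> (f g_(2) \bowtie h_(2) v) <S^-1(g_(1)), h_(3)>,       *)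
(* for an H-module V.  This is both the product of D(H), when V is the regular *)
(* module, and the action of D(H) on H^{* cop} \bowtie V.  The linear inverse   *)
(* dual_antipode^-1 is meaningful because the antipode of a finite-dimensional *)
(* Hopf algebra is bijective.                                                  *)
Definition bowtie_act (V : moduleData H)
    (x : tensor 'Hom(H, K^o) H) (y : tensor 'Hom(H, K^o) V) :
    tensor 'Hom(H, K^o) V :=
  tlift (fun (f : 'Hom(H, K^o)) (h : H) =>
    tlift (fun (g : 'Hom(H, K^o)) (v : V) =>
      sweedler3 (A := dual hbialg) (fun g1 g2 g3 =>
        sweedler3 (A := hbialg) (fun h1 h2 h3 =>
          ((g3 : 'Hom(H, K^o)) h1 * (dual_antipode^-1)%VF g1 h3 : K) *:
            tens (dual_mul (A := hbialg) f g2) (act h2 v)) h) g) y) x.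

Definition drinfeld_double : bialgData K :=
  @BialgData K (tensor 'Hom(H, K^o) H)
    (@bowtie_act (regular_data H))
    (tens (bone (dual hbialg)) (1 : H))
    (@tensor_comul K (cop (dual hbialg)) hbialg)
    (@tensor_counit K (cop (dual hbialg)) hbialg).

Definition bowtie_module (V : moduleData H) : moduleData drinfeld_double :=
  @ModuleData K drinfeld_double (tensor 'Hom(H, K^o) V) (@bowtie_act V).

Lemma bowtie_actE (V : lmodule H) (f g : 'Hom(H, K^o)) (h : H) (v : V) :
  bowtie_act (V := V) (tens f h) (tens g v) =
  sweedler3 (A := dual hbialg) (fun g1 g2 g3 =>
    sweedler3 (A := hbialg) (fun h1 h2 h3 =>
      ((g3 : 'Hom(H, K^o)) h1 * (dual_antipode^-1)%VF g1 h3 : K) *: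
        tens (dual_mul (A := hbialg) f g2) (act h2 v)) h) g.
Proof.
have [[actl actr] _ _] := lmP V.
have [tl tr] := @tens_bilinear K 'Hom(H, K^o) V.
have dml g' : linear (fun f => dual_mul (A := hbialg) f g').
  move=> c f1 f2; apply/lfunP => x.
  rewrite add_lfunE scale_lfunE !dual_mulE.
  refine (@tlift_param K H H K^o 'Hom(H, K^o)
    (fun f a1 a2 => f a1 * g' a2 : K^o) (hcomul H x) _ c f1 f2) => a1 a2 d u w.
  by rewrite add_lfunE scale_lfunE mulrDl /GRing.scale /= mulrA.
have dmr f' : linear (dual_mul (A := hbialg) f').
  move=> c f1 f2; apply/lfunP => x.
  rewrite add_lfunE scale_lfunE !dual_mulE.
  refine (@tlift_param K H H K^o 'Hom(H, K^o)
    (fun f a1 a2 => f' a1 * f a2 : K^o) (hcomul H x) _ c f1 f2) => a1 a2 d u w.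
  by rewrite add_lfunE scale_lfunE mulrDr /GRing.scale /= mulrCA.
pose M f' u (g1 g2 g3 : 'Hom(H, K^o)) (h1 h2 h3 : H) : tensor 'Hom(H, K^o) V :=
  ((g3 : 'Hom(H, K^o)) h1 * (dual_antipode^-1)%VF g1 h3 : K) *:
    tens (dual_mul (A := hbialg) f' g2) (act h2 u).
pose N f' h' u g' := sweedler3 (A := dual hbialg) (fun g1 g2 g3 =>
  sweedler3 (A := hbialg) (M f' u g1 g2 g3) h') g'.
have N1 h' u g' : linear (fun f' => N f' h' u g').
  refine (@sweedler3_param K (dual hbialg) _ _ (fun f' g1 g2 g3 =>
    sweedler3 (A := hbialg) (M f' u g1 g2 g3) h') g' _) => g1 g2 g3.
  refine (@sweedler3_param K hbialg _ _ (fun f' => M f' u g1 g2 g3) h' _).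
  by move=> h1 h2 h3 c x y; rewrite /M dml tl scalerDr !scalerA [_ * c]mulrC.
have N2 f' u g' : linear (fun h' => N f' h' u g').
  refine (@sweedler3_param K (dual hbialg) _ _ (fun h' g1 g2 g3 =>
    sweedler3 (A := hbialg) (M f' u g1 g2 g3) h') g' _) => g1 g2 g3.
  apply: (@sweedler3_linear K hbialg _ (M f' u g1 g2 g3)).
  - by move=> c x y; exact: linearP.
  - by move=> h1 h2 c x y; rewrite /M linearP /= mulrDr scalerDl scalerA mulrCA.
  - by move=> h1 h3 c x y; rewrite /M actl tr scalerDr !scalerA [_ * c]mulrC.
  - by move=> h2 h3 c x y; rewrite /M linearP /= mulrDl scalerDl scalerA -mulrA.
have N3 f' h' g' : linear (fun u => N f' h' u g').
  refine (@sweedler3_param K (dual hbialg) _ _ (fun u g1 g2 g3 =>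
    sweedler3 (A := hbialg) (M f' u g1 g2 g3) h') g' _) => g1 g2 g3.
  refine (@sweedler3_param K hbialg _ _ (fun u => M f' u g1 g2 g3) h' _).
  by move=> h1 h2 h3 c x y; rewrite /M actr tr scalerDr !scalerA [_ * c]mulrC.
have N4 f' h' u : linear (N f' h' u).
  apply: (@sweedler3_linear K (dual hbialg) _ (fun g1 g2 g3 =>
    sweedler3 (A := hbialg) (M f' u g1 g2 g3) h')).
  - exact: dual_comul_linear.
  - move=> g1 g2.
    refine (@sweedler3_param K hbialg _ _ (M f' u g1 g2) h' _).
    move=> h1 h2 h3 c x y.
    by rewrite /M add_lfunE scale_lfunE mulrDl scalerDl scalerA -mulrA.
  - move=> g1 g3.
    refine (@sweedler3_param K hbialg _ _ (fun g2 => M f' u g1 g2 g3) h' _).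
    by move=> h1 h2 h3 c x y; rewrite /M dmr tl scalerDr !scalerA [_ * c]mulrC.
  - move=> g2 g3.
    refine (@sweedler3_param K hbialg _ _ (fun g1 => M f' u g1 g2 g3) h' _).
    move=> h1 h2 h3 c x y.
    by rewrite /M linearP add_lfunE scale_lfunE mulrDr scalerDl scalerA mulrCA.
rewrite -[RHS]/(N f h v g) -[LHS]/(tlift (fun f' h' =>
  tlift (fun g' u => N f' h' u g') (tens g v)) (tens f h)).
have E f' h' : tlift (fun g' u => N f' h' u g') (tens g v) = N f' h' v g.
  by rewrite tlift_tens.
rewrite tlift_tens ?E //.
by split=> [h' | f'] c x y; rewrite !E; [exact: N1 | exact: N2].
Qed.

End DrinfeldDouble.

Arguments FSindicator {K} A V n.
Arguments Irr {K} A.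

(* Main.v *)
(* Let Lam be the normalized integral of H and S its antipode.  Decomposing the
   regular representation gives
     \sum_W chi_W(a) chi_W(b) = tr (x |-> a x b : H -> H),
   so the right hand side is a trace on V \otimes H.  On the left, identify
   H^* \otimes V with the linear maps H -> V.  The integral of D(H) is the tensor
   product of those of H^* and H, and after telescoping cancellations its n-th
   Sweedler power acts by y |-> lam(S(X_2) y_n ... y_1) S(X_1) y_{n+1} X_3 on H and
   by q on V, where q \otimes X is the coproduct of the n-th Sweedler power of Lam.
   By the invariance of lam, both traces equal lam(X Lam_n ... Lam_1).

   This needs S^2 = 1 and the cosemisimplicity of H (Larson and Radford).  The map
   a |-> tr (y |-> S^2(y) a) is an integral on H whose value at 1 is tr S^2, and
   S^2 has finite order by Radford's formula for S^4.  The trace of an algebra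
   automorphism of finite order is a sum of terms |tr P|^2, one per simple module
   that it fixes up to isomorphism, and the trivial module contributes 1; hence
   tr S^2 > 0.  So S^4 = 1, and an integrality argument yields S^2 = 1. *)

From HB Require Import structures.
Require Import Defs.
From mathcomp Require Import all_boot all_order all_algebra all_field zify ring.
From mathcomp Require Import complex.
From mathcomp Require Import boolp classical_sets fsbigop reals.

Set Implicit Arguments.
Unset Strict Implicit.
Unset Printing Implicit Defensive.

Import GRing.Theory Num.Theory.

Local Open Scope ring_scope.

(** * Linear maps, tensors and traces *)

(** The traces [x |-> a x b] on the right are identified with [lam (a b)] because [b], the reversed
    Sweedler power [rev_power n L], is central. This centrality is itself a by-product of the left
    hand side. The operators that [D(H)] induces on [H] compose by adding the numbers of factors and
    multiplying the parameters [X], so cyclicity of the trace makes [conj_trace n] take the same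
    value at [X Y] and at [Y X]. As [conj_trace n X] also equals [d * lam (X * rev_power n L)], with
    [d] the dimension of [H], nondegeneracy of [lam] gives the centrality. The factor [d] comes from
    scaling [lam] by [lam L = 1], which together with [S^2 = 1] forces [lam 1 = d]; the normalized
    integral of the dual carries [d^-1], and the two cancel. In these computations [S^2 = 1] makes
    [lam (x y)] a symmetric form and lets the antipode cancel in the opposite order, as in
    [X_(2) S(X_(1))]; the telescoping rests on this second cancellation. Iterated coproducts of the
    dual are avoided by evaluating at a point of [H], which turns them into products in [H]. *)

Section LinearFunctions.
Context (K : fieldType).
Implicit Types (U V W : lmodType K) (A : algType K).

Lemma lin_id U : linear (fun x : U => x).
Proof. by []. Qed.

Lemma lin_comp U V W (f : V -> W) (g : U -> V) :
  linear f -> linear g -> linear (fun x => f (g x)).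
Proof. by move=> lf lg c x y; rewrite lg lf. Qed.

Lemma lin_fun U V W (f : {linear V -> W}) (g : U -> V) :
  linear g -> linear (fun x => f (g x)).
Proof. by move=> lg c x y; rewrite lg linearP. Qed.

Lemma lin_mull U A (a : A) (g : U -> A) :
  linear g -> linear (fun x => a * g x).
Proof. by move=> lg c x y; rewrite lg mulrDr scalerAr. Qed.

Lemma lin_mulr U A (a : A) (g : U -> A) :
  linear g -> linear (fun x => g x * a).
Proof. by move=> lg c x y; rewrite lg mulrDl scalerAl. Qed.

Lemma lin_mulkl U (a : K) (g : U -> K^o) :
  linear g -> linear (fun x => a * g x : K^o).
Proof. by move=> lg c x y; rewrite lg mulrDr /GRing.scale /= mulrCA. Qed.

Lemma lin_mulkr U (a : K) (g : U -> K^o) :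
  linear g -> linear (fun x => g x * a : K^o).
Proof. by move=> lg c x y; rewrite lg mulrDl /GRing.scale /= mulrA. Qed.

Lemma lin_scalel U V (v : V) (g : U -> K^o) :
  linear g -> linear (fun x => (g x : K) *: v).
Proof. by move=> lg c x y; rewrite lg scalerDl scalerA. Qed.

Lemma lin_scaler U V (a : K) (g : U -> V) :
  linear g -> linear (fun x => a *: g x).
Proof. by move=> lg c x y; rewrite lg scalerDr !scalerA mulrC. Qed.

Lemma lin_add U V (f g : U -> V) :
  linear f -> linear g -> linear (fun x => f x + g x).
Proof. by move=> lf lg c x y; rewrite lf lg scalerDr addrACA. Qed.

Lemma lin_sum U V I (r : seq I) (P : pred I) (F : I -> U -> V) :
  (forall i, linear (F i)) -> linear (fun x => \sum_(i <- r | P i) F i x).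
Proof.
move=> lF c x y; rewrite scaler_sumr -big_split /=.
by apply: eq_bigr => i _; rewrite lF.
Qed.

Lemma lin_hom U (V W : vectType K) (v : V) (g : U -> 'Hom(V, W)) :
  linear g -> linear (fun x => g x v).
Proof. by move=> lg c x y; rewrite lg add_lfunE scale_lfunE. Qed.

Lemma lin_tensl U (V W : vectType K) (w : W) (g : U -> V) :
  linear g -> linear (fun x => tens (g x) w).
Proof. exact: lin_comp (proj1 (@tens_bilinear K V W) w). Qed.

Lemma lin_tensr U (V W : vectType K) (v : V) (g : U -> W) :
  linear g -> linear (fun x => tens v (g x)).
Proof. exact: lin_comp (proj2 (@tens_bilinear K V W) v). Qed.

Lemma lin_tlift U U' (V W : vectType K) (F : V -> W -> U)
    (g : U' -> tensor V W) :
  bilinear_map F -> linear g -> linear (fun x => tlift F (g x)).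
Proof. by move=> bF; exact: lin_comp (tlift_linear bF). Qed.

Lemma lin_tlift_param U U' (V W : vectType K) (F : U' -> V -> W -> U)
    (t : tensor V W) :
  (forall v w, linear (fun p => F p v w)) -> linear (fun p => tlift (F p) t).
Proof. exact: tlift_param. Qed.

Lemma lin0 U V (f : U -> V) : linear f -> f 0 = 0.
Proof. by move=> lf; have := lf (-1) 0 0; rewrite scaler0 addr0 scaleN1r addNr. Qed.

Lemma linD U V (f : U -> V) : linear f -> {morph f : x y / x + y}.
Proof. by move=> lf x y; have := lf 1 x y; rewrite !scale1r. Qed.

Lemma linZ U V (f : U -> V) : linear f -> forall c x, f (c *: x) = c *: f x.
Proof. by move=> lf c x; have := lf c x 0; rewrite (lin0 lf) !addr0. Qed.

Lemma linS U V (f : U -> V) : linear f ->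
  forall I (r : seq I) P (F : I -> U),
  f (\sum_(i <- r | P i) F i) = \sum_(i <- r | P i) f (F i).
Proof.
move=> lf I r P F; apply: (big_morph f (linD lf) (lin0 lf)).
Qed.

Lemma eq_lin U V (f g : U -> V) : f =1 g -> linear f -> linear g.
Proof. by move=> /funext ->. Qed.

Lemma tensor_ext U (V W : vectType K) (f g : tensor V W -> U) :
  linear f -> linear g -> (forall v w, f (tens v w) = g (tens v w)) ->
  f =1 g.
Proof.
move=> lf lg e t; rewrite -(tens_decomp t) /tlift (linS lf) (linS lg).
by apply: eq_bigr => i _.
Qed.

Lemma lin_tlift_comm U U' (V W : vectType K) (G : U -> U') (F : V -> W -> U)
    (t : tensor V W) :
  linear G -> G (tlift F t) = tlift (fun v w => G (F v w)) t.
Proof. by move=> lG; rewrite /tlift (linS lG). Qed.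

Lemma eq_tlift U (V W : vectType K) (F G : V -> W -> U) (t : tensor V W) :
  (forall v w, F v w = G v w) -> tlift F t = tlift G t.
Proof. by move=> e; apply: eq_bigr => i _; rewrite e. Qed.

Lemma tlift_exchange U (V W V' W' : vectType K) (F : V -> W -> V' -> W' -> U)
    (t : tensor V W) (t' : tensor V' W') :
  tlift (fun v w => tlift (F v w) t') t =
  tlift (fun v' w' => tlift (fun v w => F v w v' w') t) t'.
Proof. by rewrite /tlift exchange_big. Qed.

Lemma tlift_sum U (V W : vectType K) I (r : seq I) (F : I -> V -> W -> U)
    (t : tensor V W) :
  \sum_(i <- r) tlift (F i) t = tlift (fun v w => \sum_(i <- r) F i v w) t.
Proof. by rewrite /tlift exchange_big. Qed.

Lemma coord_linear (V : vectType K) (i : 'I_(\dim {:V})) :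
  linear (coord (vbasis {:V}) i : V -> K^o).
Proof. by move=> c x y; rewrite linearP. Qed.

(** Only the reconstruction formula is required, not independence of the [e s]; this allows the
    Frobenius dual bases and products of bases to serve for computing traces. *)
Lemma lftrace_frame (V : vectType K) (I : Type) (r : seq I) (f : V -> V)
    (c : I -> V -> K^o) (e : I -> V) :
  linear f -> (forall s, linear (c s)) ->
  (forall x, x = \sum_(s <- r) c s x *: e s) ->
  lftrace (linfun f) = \sum_(s <- r) c s (f (e s)).
Proof.
move=> lf lc dec; rewrite /lftrace.
under eq_bigr => i _.
  rewrite linfunE // {1}[f _]dec linear_sum /=.
  under eq_bigr do rewrite linearZ /=.
  over.
rewrite exchange_big; apply: eq_bigr => s _.
rewrite [e s in RHS](coord_vbasis (memvf _)) (linS lf) (linS (lc s)).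
by apply: eq_bigr => i _; rewrite (linZ lf) (linZ (lc s)) /GRing.scale /= mulrC.
Qed.

Lemma lftrace_sum_frame (V : vectType K) (I : finType) (f : V -> V)
    (c : I -> V -> K^o) (e : I -> V) :
  linear f -> (forall s, linear (c s)) ->
  (forall x, x = \sum_s c s x *: e s) ->
  lftrace (linfun f) = \sum_s c s (f (e s)).
Proof. by move=> *; apply: lftrace_frame. Qed.

Lemma vbasis_frame (V : vectType K) (x : V) :
  x = \sum_i coord (vbasis {:V}) i x *: (vbasis {:V})`_i.
Proof. exact: (coord_vbasis (memvf x)). Qed.

(** Taken of a bare function, so that operators can be written as Sweedler sums; linearity stays a
    side condition for the tactic [lin]. *)
Definition trace (V : vectType K) (f : V -> V) : K := lftrace (linfun f).

Lemma eq_trace (V : vectType K) (f g : V -> V) : f =1 g -> trace f = trace g.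
Proof. by move=> /funext ->. Qed.

Lemma traceE (V : vectType K) (f : V -> V) : linear f ->
  trace f = \sum_i coord (vbasis {:V}) i (f (vbasis {:V})`_i).
Proof. by move=> lf; apply: eq_bigr => i _; rewrite linfunE. Qed.

Lemma traceC (V W : vectType K) (f : V -> W) (g : W -> V) :
  linear f -> linear g -> trace (fun x => f (g x)) = trace (fun x => g (f x)).
Proof.
move=> lf lg; rewrite !traceE; last 2 first.
- exact: lin_comp.
- exact: lin_comp.
under eq_bigr => i _.
  rewrite {1}[g _]vbasis_frame (linS lf) (linear_sum (coord _ _)).
  under eq_bigr do rewrite (linZ lf) linearZ /=.
  over.
under [RHS]eq_bigr => i _.
  rewrite {1}[f _]vbasis_frame (linS lg) (linear_sum (coord _ _)).
  under eq_bigr do rewrite (linZ lg) linearZ /=.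
  over.
rewrite exchange_big /=; apply: eq_bigr => i _; apply: eq_bigr => j _.
by rewrite mulrC.
Qed.

Lemma trace_linear (V : vectType K) (U : lmodType K) (F : U -> V -> V) :
  (forall u, linear (F u)) -> (forall v, linear (F^~ v)) ->
  linear (fun u => trace (F u) : K^o).
Proof.
move=> l1 l2 c x y; rewrite !traceE // scaler_sumr -big_split.
by apply: eq_bigr => i _; rewrite l2 linearP.
Qed.

End LinearFunctions.

(* [lin] proves that a map [fun x => E x] is linear by recursion on [E], using *)
(* the linearity hypotheses of the context.                                   *)
Ltac linear_hyp :=
  match goal with
  | Hyp : _ |- _ =>
    first [ exact: Hyp
          | progress refine (lin_comp Hyp _)
          | progress refine (lin_comp (Hyp _) _)
          | progress refine (lin_comp (Hyp _ _) _)
          | progress refine (lin_comp (Hyp _ _ _) _)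
          | progress refine (lin_comp (Hyp _ _ _ _) _) ]
  end.

Ltac linear_step :=
  cbv beta; lazymatch goal with
  | |- bilinear_map _ => split
  | |- forall x, @?P x => let x := fresh "x" in move=> x
  | |- GRing.linear_for _ (fun x => x) => exact: lin_id
  | |- GRing.linear_for _ (fun x => @?a x * _) =>
      lazymatch a with
      | fun _ => ?c => first [refine (lin_mull c _) | refine (lin_mulkl c _)]
      | _ => first [refine (lin_mulr _ _) | refine (lin_mulkr _ _)]
      end
  | |- GRing.linear_for _ (fun x => @?a x *: _) =>
      lazymatch a with
      | fun _ => ?c => refine (lin_scaler c _)
      | _ => refine (lin_scalel _ _)
      end
  | |- GRing.linear_for _ (fun x => tens (@?a x) _) =>
      lazymatch a with
      | fun _ => ?c => refine (lin_tensr c _)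
      | _ => refine (lin_tensl _ _)
      end
  | |- GRing.linear_for _ (fun x => tlift _ (@?t x)) =>
      lazymatch t with
      | fun _ => ?c => refine (lin_tlift_param c _)
      | _ => refine (lin_tlift _ _)
      end
  | |- GRing.linear_for _ (fun x => _ + _) => refine (lin_add _ _)
  | |- GRing.linear_for _ (fun x => bigop _ _ _) => refine (lin_sum _ _ _)
  | |- GRing.linear_for _ (fun x => _) =>
      first [ linear_hyp | refine (lin_fun _ _) | refine (lin_hom _ _)]
  | |- GRing.linear_for ?s ?f =>
      first [ assumption | change (GRing.linear_for s (fun x => f x))]
  end.

Ltac lin := repeat match goal with M := _ |- _ => subst M end; repeat linear_step.

(* Sweedler's notation: [a] and [b] stand for [h_(1)] and [h_(2)]. *)
Local Notation "\sw_ ( a , b <- h ) E" := (@tlift _ (halg _) (halg _) _ (fun a b => E) (hcomul _ h))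
  (at level 41, E at level 41, a name, b name,
   format "\sw_ ( a ,  b  <-  h )  E").

(** * Sweedler calculus in a Hopf algebra *)

Section HopfAssoc.
Context (K : fieldType) (H : hopfAlgebra K).
Implicit Types (U : lmodType K) (h g : H).


Lemma sw_assoc U (F : H -> H -> H -> U) h :
  (forall b c, linear (fun a => F a b c)) ->
  (forall a c, linear (fun b => F a b c)) -> (forall a b, linear (F a b)) ->
  \sw_(x, c <- h) \sw_(a, b <- x) F a b c =
  \sw_(a, x <- h) \sw_(b, c <- x) F a b c.
Proof.
move=> F1 F2 F3.
(* The trilinear [F] becomes a linear map on the triple tensor product, through which the
   coassociativity axiom can be pushed. *)
pose G (t : tensor H (tensor H H)) := tlift (fun a u => tlift (F a) u) t.
have lG : linear G by rewrite /G; lin.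
have GE a b c : G (tens a (tens b c)) = F a b c.
  by rewrite /G !tlift_tens //; lin.
have := congr1 G (hcoassoc h); rewrite !(lin_tlift_comm _ _ lG).
under eq_tlift do rewrite (lin_tlift_comm _ _ lG).
under [RHS]eq_tlift do rewrite (lin_tlift_comm _ _ lG).
under eq_tlift do under eq_tlift do rewrite GE.
by under [RHS]eq_tlift do under eq_tlift do rewrite GE.
Qed.

End HopfAssoc.

Ltac reassoc := rewrite sw_assoc; [|by lin ..].
Ltac unassoc := rewrite -sw_assoc; [|by lin ..].
(* [swap_at n] exchanges the nested Sweedler sums at depths [n] and [n + 1],   *)
(* and [pull_at m n] moves the one at depth [m] out to depth [n].              *)
Ltac swap_at n :=
  lazymatch n with
  | O => rewrite tlift_exchange
  | S ?m => under eq_tlift do swap_at m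
  end.
Ltac pull_at m n :=
  lazymatch constr:((m, n)) with
  | (?p, ?p) => idtac
  | (S ?p, _) => swap_at p; pull_at p n
  end.
Ltac reassoc_at n :=
  lazymatch n with
  | O => reassoc
  | S ?m => under eq_tlift do reassoc_at m
  end.
Ltac tlift_pure := rewrite tlift_tens; [|by lin].

Section Hopf.
Context (K : fieldType) (H : hopfAlgebra K).
Implicit Types (U : lmodType K) (h g : H).

Local Notation eps := (hcounit H).
Local Notation S := (antipode H).

Lemma sw_mul U (F : H -> H -> U) g h : bilinear_map F ->
  \sw_(a, b <- g * h) F a b =
  \sw_(a, b <- g) \sw_(c, d <- h) F (a * c) (b * d).
Proof.
move=> bF; have lF := tlift_linear bF.
rewrite hcomulM (lin_tlift_comm _ _ lF); apply: eq_tlift => a b.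
by rewrite (lin_tlift_comm _ _ lF); apply: eq_tlift => c d; rewrite tlift_tens.
Qed.

Lemma sw1 U (F : H -> H -> U) : bilinear_map F -> \sw_(a, b <- 1) F a b = F 1 1.
Proof. by move=> bF; rewrite hcomul1 tlift_tens. Qed.

Lemma sw_counitl U (F : H -> U) h : linear F ->
  \sw_(a, b <- h) (eps a : K) *: F b = F h.
Proof.
move=> lF; rewrite -[in RHS](hcounitl h) (lin_tlift_comm _ _ lF).
by apply: eq_tlift => a b; rewrite (linZ lF).
Qed.

Lemma sw_counitr U (F : H -> U) h : linear F ->
  \sw_(a, b <- h) (eps b : K) *: F a = F h.
Proof.
move=> lF; rewrite -[in RHS](hcounitr h) (lin_tlift_comm _ _ lF).
by apply: eq_tlift => a b; rewrite (linZ lF).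
Qed.

Lemma sw_Sl U (F : H -> U) h : linear F ->
  \sw_(a, b <- h) F (S a * b) = (eps h : K) *: F 1.
Proof. by move=> lF; rewrite -(linZ lF) -antipodel (lin_tlift_comm _ _ lF). Qed.

Lemma sw_Sr U (F : H -> U) h : linear F ->
  \sw_(a, b <- h) F (a * S b) = (eps h : K) *: F 1.
Proof. by move=> lF; rewrite -(linZ lF) -antipoder (lin_tlift_comm _ _ lF). Qed.

Lemma antipode1 : S 1 = 1.
Proof.
have := sw_Sl 1 (@lin_id _ H); rewrite hcounit1 scale1r sw1 ?mulr1 //.
by lin.
Qed.

(** Both sides are convolution inverses of the product: [S(g_(1) h_(1)) g_(2) h_(2) S(h_(3))
    S(g_(3))] collapses from the right to one side and from the left to the other. *)
Lemma antipodeM g h : S (g * h) = S h * S g.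
Proof.
pose M (a c d b e f : H) : H := S (a * b) * (c * (e * S f)) * S d.
transitivity (\sw_(x, d <- g) \sw_(a, c <- x)
  \sw_(y, f <- h) \sw_(b, e <- y) M a c d b e f).
  under eq_tlift => x d do under eq_tlift => a c do reassoc.
  rewrite sw_assoc; [|lin ..].
  rewrite -[LHS](@sw_counitr _ (fun a => S (a * h))); last by lin.
  apply: eq_tlift => a x.
  transitivity (\sw_(c, d <- x) S (a * h) * (c * S d) * 1).
    by rewrite (@sw_Sr _ (fun u => S (a * h) * u * 1)) ?mulr1 //; lin.
  apply: eq_tlift => c d.
  rewrite -[LHS](@sw_counitr _ (fun b => S (a * b) * (c * S d) * 1)); last by lin.
  apply: eq_tlift => b y.
  rewrite (@sw_Sr _ (fun u => S (a * b) * (c * u) * S d)) ?mulr1 ?mulrA //; lin.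
rewrite -[RHS](@sw_counitl _ (fun d => S h * S d)); last by lin.
apply: eq_tlift => x d.
rewrite -[in RHS](@sw_counitl _ (fun f => S f * S d) h); last by lin.
rewrite [RHS](@lin_tlift_comm _ _ _ _ _ (fun u => _ *: u)); last by lin.
rewrite tlift_exchange; apply: eq_tlift => y f.
transitivity (\sw_(u, v <- x * y) S u * v * (S f * S d)).
  by rewrite sw_mul; [rewrite /M; do 2!apply: eq_tlift => * ; rewrite !mulrA|lin].
rewrite (@sw_Sl _ (fun u => u * (S f * S d))); last by lin.
by rewrite mul1r hcounitM scalerA.
Qed.

Lemma counit_antipode h : eps (S h) = eps h.
Proof.
rewrite -[RHS]mulr1 -(@hcounit1 _ H) -[RHS](@sw_Sl _ (fun u => eps u)); last by lin.
rewrite -[in LHS](hcounitr h) (@lin_tlift_comm _ _ _ _ _ (fun u => eps (S u))); last by lin.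
by apply: eq_tlift => a b; rewrite hcounitM !linearZ /= mulrC.
Qed.

(** Again uniqueness of convolution inverses, now of the coproduct: [M] spells out the coproduct of
    [S h_(1)], times that of [h_(2)], times the flipped antipodes of the legs of [h_(3)]. *)
Lemma sw_antipode U (F : H -> H -> U) h : bilinear_map F ->
  \sw_(a, b <- S h) F a b = \sw_(a, b <- h) F (S b) (S a).
Proof.
move=> [F1 F2].
pose M (p q r s c d : H) : U := F (p * (r * S d)) (q * (s * S c)).
transitivity (\sw_(a, x <- h) \sw_(y, z <- x) \sw_(p, q <- S a)
   \sw_(r, s <- y) \sw_(c, d <- z) M p q r s c d).
  rewrite -[LHS](@sw_counitr _ (fun a => \sw_(p, q <- S a) F p q)); last by lin.
  apply: eq_tlift => a x; rewrite [RHS]tlift_exchange.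
  rewrite [LHS](@lin_tlift_comm _ _ _ _ _ (fun u => _ *: u)); last by lin.
  apply: eq_tlift => p q.
  rewrite sw_assoc; [|lin ..].
  rewrite -[RHS](@eq_tlift _ _ _ _ (fun r t => F (p * (r * S t)) q)); last first.
    move=> r t; rewrite -sw_assoc; [|lin ..].
    rewrite -[LHS](@sw_counitl _ (fun t => F (p * (r * S t)) q)); last by lin.
    apply: eq_tlift => u d.
    by rewrite (@sw_Sr _ (fun k => F (p * (r * S d)) (q * k))) ?mulr1 //; lin.
  by rewrite (@sw_Sr _ (fun k => F (p * k) q)) ?mulr1 //; lin.
rewrite -[RHS](@sw_counitl _ (fun z => \sw_(c, d <- z) F (S d) (S c))); last by lin.
rewrite -sw_assoc; [|lin ..].
apply: eq_tlift => w z.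
rewrite (@eq_tlift _ _ _ _ _ (fun a y => \sw_(p, q <- S a * y)
  \sw_(c, d <- z) F (p * S d) (q * S c))).
  rewrite (@sw_Sl _ (fun k => \sw_(p, q <- k) \sw_(c, d <- z) F (p * S d) (q * S c))); last by lin.
  rewrite sw1; last by lin.
  by congr (_ *: _); apply: eq_tlift => c d; rewrite !mul1r.
move=> a y; rewrite sw_mul; last by lin.
by do 3!apply: eq_tlift => * ; rewrite /M !mulrA.
Qed.
End Hopf.

(** * Integrals and the Frobenius structure *)

Section LeftIntegral.
Context (K : fieldType) (H : hopfAlgebra K) (L : H).
Implicit Types (U : lmodType K) (h y : H).

Local Notation eps := (hcounit H).
Local Notation S := (antipode H).

Context (Ll : forall h, h * L = (eps h : K) *: L) (L1 : eps L = 1).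

(** The element [y_(1) L_(1) \otimes S(y_(2) L_(2)) y_(3)] gives the left side by cancelling
    [S(y_(2)) y_(3)], and the right side because [L] absorbs [y_(1) \otimes y_(2)]. *)
Lemma casimir_l U (F : H -> H -> U) y : bilinear_map F ->
  \sw_(a, b <- L) F (y * a) (S b) = \sw_(a, b <- L) F a (S b * y).
Proof.
move=> [F1 F2].
transitivity (\sw_(y1, x <- y) \sw_(y2, y3 <- x) \sw_(a, b <- L)
  F (y1 * a) (S (y2 * b) * y3)).
  rewrite -[LHS](@sw_counitr _ _ _ (fun y => \sw_(a, b <- L) F (y * a) (S b))); last by lin.
  apply: eq_tlift => y1 x; rewrite tlift_exchange.
  rewrite [LHS](@lin_tlift_comm _ _ _ _ _ (fun u => _ *: u)); last by lin.
  apply: eq_tlift => a b; under eq_tlift do rewrite antipodeM -mulrA.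
  by rewrite (@sw_Sl _ _ _ (fun u => F (y1 * a) (S b * u))) ?mulr1 //; lin.
unassoc.
rewrite -[RHS](@sw_counitl _ _ _ (fun y => \sw_(a, b <- L) F a (S b * y))); last by lin.
apply: eq_tlift => w y3.
transitivity (\sw_(a, b <- w * L) F a (S b * y3)).
  by rewrite sw_mul //; lin.
rewrite Ll linearZ; apply: (@linZ _ _ _ (fun t => tlift (fun a b => F a (S b * y3)) t)).
by lin.
Qed.

(* Applying the counit to the Casimir identity shows that [S L] is a right     *)
(* integral; no bijectivity of [S] is needed.                                  *)
Lemma integral_two_sided : S L = L /\ forall h, L * h = (eps h : K) *: L.
Proof.
have SLr h : S L * h = (eps h : K) *: S L.
  rewrite -(@sw_counitl _ _ _ (fun b => S b * h)); last by lin.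
  rewrite -(casimir_l (F := fun a b => (eps a : K) *: b)); last by lin.
  rewrite -(@sw_counitl _ _ _ (fun b => S b) L); last by lin.
  rewrite [RHS](@lin_tlift_comm _ _ _ _ _ (fun u => _ *: u)); last by lin.
  by apply: eq_tlift => a b; rewrite hcounitM scalerA.
have E : S L = L.
  have := Ll (S L); rewrite SLr counit_antipode L1 !scale1r => ->.
  by [].
by split=> // h; rewrite -[in LHS]E SLr E.
Qed.

End LeftIntegral.

Section DualFrame.
Context (K : fieldType) (V : vectType K).

(** A spanning family of as many vectors as the dimension is a basis, which forces its coefficients.
    This is what turns one Frobenius reconstruction formula into the other. *)
Lemma dual_frame (f : 'I_(\dim {:V}) -> V) (c : 'I_(\dim {:V}) -> V -> K) :
  (forall x, x = \sum_i c i x *: f i) -> forall i j, c i (f j) = (i == j)%:R.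
Proof.
move=> dec i j; pose X := [tuple f i | i < \dim {:V}].
have fE (k : 'I_(\dim {:V})) : X`_k = f k by rewrite -tnth_nth tnth_mktuple.
have bX : basis_of {:V} X.
  rewrite basisEdim size_tuple leqnn andbT; apply/subvP => x _.
  rewrite (dec x); apply: memv_suml => k _; apply: memvZ; apply: memv_span.
  by rewrite -fE mem_nth // size_tuple.
have fX := basis_free bX.
have e (k : 'I_(\dim {:V})) : X`_k = \sum_i c i (f k) *: X`_i.
  by rewrite fE {1}[f k]dec; apply: eq_bigr => l _; rewrite fE.
have := congr1 (coord X i) (e j).
by rewrite coord_sum_free // coord_free // eq_sym => ->.
Qed.

End DualFrame.

Section TwistedTrace.
Context (K : fieldType) (H : hopfAlgebra K) (L : H).
Implicit Types (U : lmodType K) (h y : H).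

Local Notation eps := (hcounit H).
Local Notation S := (antipode H).

(* This form of the trace is a right integral on [H] even before one knows     *)
(* that [S] is invertible.                                                     *)
Definition antipode_sq_trace (a : H) : K^o := trace (fun y => S (S y) * a).

Lemma antipode_sq_trace_linear : linear antipode_sq_trace.
Proof. by apply: trace_linear; lin. Qed.

(** Cyclicity of a partial trace: the coproduct and [z] followed by the coproduct are composed in
    either order through their first legs, while [q] and [v] are spectators. *)
Lemma partial_traceC U (B : H -> H -> U) (z : H -> H) :
  bilinear_map B -> linear z ->
  let e i := (vbasis {:H})`_i in let c i : H -> K^o := coord (vbasis {:H}) i in
  \sum_i \sw_(p, q <- e i) \sw_(u, v <- z p) (c i u : K) *: B q v =
  \sum_i \sw_(u, v <- z (e i)) \sw_(p, q <- u) (c i p : K) *: B q v.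
Proof.
move=> [B1 B2] lz e c.
have lc i : linear (c i) by exact: coord_linear.
transitivity (\sum_i \sum_j \sw_(p, q <- e i) \sw_(u, v <- z (e j))
    (c j p : K) *: ((c i u : K) *: B q v)).
  apply: eq_bigr => i _.
  rewrite -(lin_tlift_comm _ (G := fun x => x)) //.
  transitivity (\sw_(p, q <- e i) \sum_j \sw_(u, v <- z (e j))
    (c j p : K) *: ((c i u : K) *: B q v)); last first.
    by rewrite /tlift exchange_big.
  apply: eq_tlift => p q.
  rewrite [p in LHS]vbasis_frame (linS (f := fun p => \sw_(u, v <- z p) (c i u : K) *: B q v)); last by lin.
  apply: eq_bigr => j _.
  rewrite (linZ (f := fun p => \sw_(u, v <- z p) (c i u : K) *: B q v)); last by lin.
  by rewrite [LHS](@lin_tlift_comm _ _ _ _ _ (fun u => _ *: u)) //; lin.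
rewrite exchange_big; apply: eq_bigr => j _.
transitivity (\sw_(u, v <- z (e j)) \sum_i \sw_(p, q <- e i)
    (c j p : K) *: ((c i u : K) *: B q v)).
  by under eq_bigr do rewrite tlift_exchange; rewrite /tlift exchange_big.
apply: eq_tlift => u v.
rewrite [u in RHS]vbasis_frame (linS (f := fun u => \sw_(p, q <- u) (c j p : K) *: B q v)); last by lin.
apply: eq_bigr => i _.
rewrite (linZ (f := fun u => \sw_(p, q <- u) (c j p : K) *: B q v)); last by lin.
rewrite [RHS](@lin_tlift_comm _ _ _ _ _ (fun u => _ *: u)); last by lin.
by apply: eq_tlift => p q; rewrite !scalerA mulrC.
Qed.

(** The twist by [S^2] is what makes [S(e_(3)) S^2(e_(2))] collapse, so that [a_(2)] can be replaced
    by [S(q) v] with [u \otimes v] the coproduct of [S^2(p) a]. After [partial_traceC], [q] and [v]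
    are consecutive legs of one element and [S(q) v] collapses to the counit. *)
Lemma antipode_sq_trace_integral (a : H) :
  \sw_(b, c <- a) (antipode_sq_trace b : K) *: c =
  (antipode_sq_trace a : K) *: 1.
Proof.
set c := fun i => (coord (vbasis {:H}) i : H -> K^o).
set e := fun i : 'I_(\dim {:H}) => (vbasis {:H})`_i.
have lc i : linear (c i) by exact: coord_linear.
have E b : antipode_sq_trace b = \sum_i c i (S (S (e i)) * b).
  by rewrite /antipode_sq_trace traceE //; lin.
transitivity (\sum_i \sw_(p, q <- e i) \sw_(u, v <- S (S p) * a)
   (c i u : K) *: (S q * v)).
  transitivity (\sum_i \sw_(x, y <- a) (c i (S (S (e i)) * x) : K) *: y).
    rewrite /tlift exchange_big; apply: eq_bigr => j _.
    by rewrite E scaler_suml.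
  apply: eq_bigr => i _.
  transitivity (\sw_(p, q <- e i) \sw_(r, s <- p) \sw_(x, y <- a)
     (c i (S (S r) * x) : K) *: (S (S s * q) * y)).
    reassoc.
    rewrite -[LHS](@sw_counitr _ _ _ (fun k => \sw_(x, y <- a) (c i (S (S k) * x) : K) *: y)); last by lin.
    apply: eq_tlift => r t.
    rewrite (@sw_Sl _ _ _ (fun k => \sw_(x, y <- a) (c i (S (S r) * x) : K) *: (S k * y))); last by lin.
    by rewrite antipode1; congr (_ *: _); apply: eq_tlift => x y; rewrite mul1r.
  apply: eq_tlift => p q; rewrite sw_mul; last by lin.
  rewrite (sw_antipode (F := fun r s => \sw_(x, y <- a) (c i (r * x) : K) *: (S q * (s * y)))); last by lin.
  rewrite (sw_antipode (F := fun r s => \sw_(x, y <- a) (c i (S s * x) : K) *: (S q * (S r * y)))); last by lin.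
  by do 2!apply: eq_tlift => ? ?; rewrite antipodeM mulrA.
rewrite (partial_traceC (B := fun q v => S q * v) (z := fun p => S (S p) * a)); [|by lin ..].
rewrite E scaler_suml; apply: eq_bigr => i _.
reassoc.
transitivity (\sw_(p, x <- S (S (e i)) * a) (eps x : K) *: ((c i p : K) *: (1 : H))).
  apply: eq_tlift => p x.
  by rewrite (@sw_Sl _ _ _ (fun k => (c i p : K) *: k)) //; lin.
by rewrite (@sw_counitr _ _ _ (fun p => (c i p : K) *: (1 : H))) //; lin.
Qed.

Context (Ll : forall h, h * L = (eps h : K) *: L) (L1 : eps L = 1).

Lemma antipode_sq_trace_at_integral : antipode_sq_trace L = 1.
Proof.
rewrite /antipode_sq_trace traceE; last by lin.
under eq_bigr do rewrite Ll !counit_antipode linearZ /=.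
rewrite -[RHS]L1 [in RHS](vbasis_frame L) linear_sum /=.
by apply: eq_bigr => i _; rewrite linearZ /= mulrC.
Qed.

End TwistedTrace.

Section Frobenius.
Context (K : fieldType) (H : hopfAlgebra K) (L : H) (lam : H -> K^o).
Implicit Types (U : lmodType K) (h y : H).

Local Notation eps := (hcounit H).
Local Notation S := (antipode H).

(* [L] is the normalized integral of [H]; the integral [lam] on [H] is scaled   *)
(* by [lam L = 1], so that [lam 1] will turn out to be [\dim H].               *)
Record integral_pair : Prop := IntegralPair {
  int_l : forall h, h * L = (eps h : K) *: L;
  int_r : forall h, L * h = (eps h : K) *: L;
  int_counit : eps L = 1;
  int_antipode : S L = L;
  dint_linear : linear lam;
  dint_l : forall h, \sw_(a, b <- h) (lam a : K) *: b = (lam h : K) *: 1;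
  dint_int : lam L = 1 }.

Context (ip : integral_pair).

Let Ll h : h * L = (eps h : K) *: L. Proof. exact: int_l. Qed.
Let Lr h : L * h = (eps h : K) *: L. Proof. exact: int_r. Qed.
Let L1 : eps L = 1. Proof. exact: int_counit. Qed.
Let SL : S L = L. Proof. exact: int_antipode. Qed.
Let lam_lin : linear lam. Proof. exact: dint_linear. Qed.
Let lamR h : \sw_(a, b <- h) (lam a : K) *: b = (lam h : K) *: 1.
Proof. exact: dint_l. Qed.
Let lamL : lam L = 1. Proof. exact: dint_int. Qed.

Lemma casimir_r U (F : H -> H -> U) y : bilinear_map F ->
  \sw_(a, b <- L) F (a * y) b = \sw_(a, b <- L) F a (b * S y).
Proof.
move=> [F1 F2].
transitivity (\sw_(y1, x <- y) \sw_(y2, y3 <- x) \sw_(a, b <- L)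
  F (a * y1) (b * (y2 * S y3))).
  rewrite -[LHS](@sw_counitr _ _ _ (fun y => \sw_(a, b <- L) F (a * y) b)); last by lin.
  apply: eq_tlift => y1 x.
  rewrite (@sw_Sr _ _ _ (fun k => \sw_(a, b <- L) F (a * y1) (b * k))); last by lin.
  by congr (_ *: _); apply: eq_tlift => a b; rewrite mulr1.
unassoc.
rewrite -[RHS](@sw_counitl _ _ _ (fun y => \sw_(a, b <- L) F a (b * S y))); last by lin.
apply: eq_tlift => w y3.
transitivity (\sw_(a, b <- L * w) F a (b * S y3)).
  rewrite sw_mul; last by lin.
  by rewrite tlift_exchange; do 2!apply: eq_tlift => * ; rewrite mulrA.
rewrite Lr linearZ; apply: (@linZ _ _ _ (fun t => tlift (fun a b => F a (b * S y3)) t)).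
by lin.
Qed.

Lemma casimir_Sr U (F : H -> H -> U) y : bilinear_map F ->
  \sw_(a, b <- L) F (S a) (b * y) = \sw_(a, b <- L) F (y * S a) b.
Proof.
move=> [F1 F2].
transitivity (\sw_(y1, x <- y) \sw_(y2, y3 <- x) \sw_(a, b <- L)
  F (y1 * (S (a * y2))) (b * y3)).
  unassoc.
  rewrite -[LHS](@sw_counitl _ _ _ (fun y => \sw_(a, b <- L) F (S a) (b * y))); last by lin.
  apply: eq_tlift => w y3.
  transitivity (\sw_(y1, y2 <- w) \sw_(a, b <- L) F (y1 * S y2 * S a) (b * y3)).
    rewrite (@sw_Sr _ _ _ (fun k => \sw_(a, b <- L) F (k * S a) (b * y3))); last by lin.
    by congr (_ *: _); apply: eq_tlift => a b; rewrite mul1r.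
  by do 2!apply: eq_tlift => * ; rewrite antipodeM mulrA.
rewrite -[RHS](@sw_counitr _ _ _ (fun y => \sw_(a, b <- L) F (y * S a) b)); last by lin.
apply: eq_tlift => y1 w.
transitivity (\sw_(a, b <- L * w) F (y1 * S a) b).
  by rewrite sw_mul; [rewrite tlift_exchange|lin].
rewrite Lr linearZ; apply: (@linZ _ _ _ (fun t => tlift (fun a b => F (y1 * S a) b) t)).
by lin.
Qed.

Lemma lam_int U (F : H -> U) h : linear F ->
  \sw_(a, b <- h) (lam a : K) *: F b = (lam h : K) *: F 1.
Proof.
move=> lF; rewrite -(linZ lF) -lamR (lin_tlift_comm _ _ lF).
by apply: eq_tlift => a b; rewrite (linZ lF).
Qed.

(** The Casimir identity moves [y] to the second leg; invariance then reduces the first leg to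
    [lam L = 1]. Thus [L_(1)] and [S L_(2)] are dual bases for the form [lam (x y)]. *)
Lemma frobenius_l y : \sw_(a, b <- L) (lam (y * a) : K) *: S b = y.
Proof.
rewrite (casimir_l Ll (F := fun a b => (lam a : K) *: b)); last by lin.
rewrite (lam_int (F := fun b => S b * y)); last by lin.
by rewrite antipode1 mul1r lamL scale1r.
Qed.

Lemma lam_nondegenerate y : (forall a, lam (y * a) = 0) -> y = 0.
Proof.
move=> y0; rewrite -(frobenius_l y) /tlift big1 // => i _.
by rewrite y0 scale0r.
Qed.

Lemma frobenius_r y : \sw_(a, b <- L) (lam (S b * y) : K) *: a = y.
Proof.
set e := fun i : 'I_(\dim {:H}) => (vbasis {:H})`_i.
(* [tlift] expands the coproduct of [L] along the basis [e] of the first factor; [f i] is the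
   antipode of the matching second factor. *)
pose f i := S (hcomul H L (dual_basis i)).
have dec x : x = \sum_i (lam (x * e i) : K) *: f i.
  by rewrite -[LHS]frobenius_l.
have dual := dual_frame dec.
rewrite -[LHS]/(\sum_i (lam (f i * y) : K) *: e i).
rewrite [y in LHS]vbasis_frame.
under eq_bigr => i _.
  rewrite mulr_sumr (linS lam_lin) scaler_suml.
  under eq_bigr do rewrite -scalerAr (linZ lam_lin) dual.
  rewrite (bigD1 i) //= eqxx big1 ?addr0; last first.
    by move=> j /negPf ji; rewrite ji [_ *: 0]mulr0 scale0r.
  rewrite [_ *: 1%R]mulr1.
  over.
by rewrite -vbasis_frame.
Qed.

(** [S^2] is the Nakayama automorphism of the Frobenius form: by [casimir_r], the coordinates of
    [S (S y)] in the basis [S L_(2)] are [lam (L_(1) y)]. *)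
Lemma nakayama y z : lam (S (S y) * z) = lam (z * y).
Proof.
have -> : S (S y) = \sw_(a, b <- L) (lam (a * y) : K) *: S b.
  rewrite (casimir_r (F := fun a b => (lam a : K) *: S b)); last by lin.
  rewrite (lam_int (F := fun b => S (b * S y))); last by lin.
  by rewrite mul1r lamL scale1r.
rewrite -[z in RHS]frobenius_r.
rewrite (@lin_tlift_comm _ _ _ _ _ (fun u => lam (u * z))); last by lin.
rewrite [RHS](@lin_tlift_comm _ _ _ _ _ (fun u => lam (u * y))); last by lin.
by apply: eq_tlift => a b; rewrite -!scalerAl !(linZ lam_lin) /GRing.scale /= mulrC.
Qed.

(** Uniqueness of the integral, with vector values and with invariance asked at [L] only. The vector
    values are what produces the modular element. *)
Lemma lam_unique (U : vectType K) (p : H -> U) h : linear p ->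
  (forall B : U -> H -> U, bilinear_map B ->
    \sw_(a, b <- L) B (p a) b = B (p L) 1) ->
  p h = (lam h : K) *: p L.
Proof.
move=> lp pint.
transitivity (\sw_(a, b <- L) (lam (S b) : K) *: p (h * a)).
  rewrite -{1}[h]mulr1 -{1}[1]frobenius_r.
  rewrite (@lin_tlift_comm _ _ _ _ _ (fun u => p (h * u))); last by lin.
  by apply: eq_tlift => a b; rewrite mulr1 -scalerAr (linZ lp).
rewrite (casimir_l Ll (F := fun a b => (lam b : K) *: p a)); last by lin.
rewrite (pint (fun u b => (lam (S b * h) : K) *: u)); last by lin.
by rewrite antipode1 mul1r.
Qed.

(** The distinguished grouplike element: by [lam_modular] it measures how far [lam] is from being a
    two-sided integral. *)
Definition modular_grouplike : H := \sw_(a, b <- L) (lam b : K) *: a.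
Local Notation g := modular_grouplike.

Lemma lam_modular h : \sw_(a, b <- h) (lam b : K) *: a = (lam h : K) *: g.
Proof.
apply: (lam_unique (p := fun h => \sw_(a, b <- h) (lam b : K) *: a)); first by lin.
move=> B [B1 B2].
transitivity (\sw_(x, c <- L) \sw_(a, b <- x) (lam b : K) *: B a c).
  apply: eq_tlift => x c.
  rewrite (@lin_tlift_comm _ _ _ _ _ (fun u => B u c)); last by lin.
  by apply: eq_tlift => a b; rewrite (linZ (B1 c)).
reassoc.
rewrite [RHS](@lin_tlift_comm _ _ _ _ _ (fun u => B u 1)); last by lin.
apply: eq_tlift => a x; rewrite (linZ (B1 1)).
by rewrite (lam_int (F := fun b => B a b)).
Qed.

Lemma sw_modular U (F : H -> H -> U) : bilinear_map F ->
  \sw_(a, b <- g) F a b = F g g.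
Proof.
move=> [F1 F2].
rewrite [LHS](@lin_tlift_comm _ _ _ _ _ (fun u => \sw_(a, b <- u) F a b)); last by lin.
rewrite [in RHS]/g (@lin_tlift_comm _ _ _ _ _ (fun u => F u g)); last by lin.
transitivity (\sw_(x, c <- L) \sw_(a, b <- x) (lam c : K) *: F a b).
  apply: eq_tlift => x c.
  rewrite (linZ (f := fun u => \sw_(a, b <- u) F a b)); last by lin.
  by rewrite (@lin_tlift_comm _ _ _ _ _ (fun u => _ *: u)) //; lin.
reassoc; apply: eq_tlift => a x; rewrite (linZ (F1 g)) -(linZ (F2 a)) -lam_modular.
rewrite (@lin_tlift_comm _ _ _ _ _ (fun u => F a u)); last by lin.
by apply: eq_tlift => b c; rewrite (linZ (F2 a)).
Qed.

Lemma counit_modular : eps g = 1.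
Proof.
rewrite (@lin_tlift_comm _ _ _ _ _ (fun u => eps u)); last by lin.
rewrite -[RHS]lamL -[RHS](@sw_counitl _ _ _ (fun u => lam u)); last by lin.
by apply: eq_tlift => a b; rewrite linearZ /= [RHS]mulrC.
Qed.

Lemma antipode_modularl : S g * g = 1.
Proof.
rewrite -(sw_modular (F := fun a b => S a * b)); last by lin.
by rewrite antipodel counit_modular scale1r.
Qed.

Lemma lam_antipode h : lam (S h) = lam (g * h).
Proof.
have lamS2 y : lam (S (S y)) = lam y by have := nakayama y 1; rewrite mulr1 mul1r.
suff E y : lam y = lam (S (S g * y)).
  by rewrite [RHS]E mulrA antipode_modularl mul1r.
have E2 : y = \sw_(a, b <- L) (lam (S (b * y)) : K) *: S a.
  rewrite (casimir_Sr (F := fun u v => (lam (S v) : K) *: u)); last by lin.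
  transitivity (y * S (\sw_(a, b <- L) (lam (S b * 1) : K) *: a)).
    by rewrite frobenius_r antipode1 mulr1.
  rewrite (@lin_tlift_comm _ _ _ _ _ (fun u => y * S u)); last by lin.
  by apply: eq_tlift => a b; rewrite mulr1 linearZ scalerAr.
(* Writing [L] as [S L] exchanges the legs, so the coefficient [lam (S a)] becomes [lam b], the one
   that defines [g]. *)
rewrite {1}E2 -SL sw_antipode; last by lin.
rewrite (@lin_tlift_comm _ _ _ _ _ lam) //.
rewrite [in RHS]/g (@lin_tlift_comm _ _ _ _ _ (fun u => lam (S (S u * y)))); last by lin.
apply: eq_tlift => a b; rewrite !linearZ /= -scalerAl !linearZ /= !(linZ lam_lin).
by rewrite lamS2 /GRing.scale /= mulrC.
Qed.

(* Radford's formula for [S^4], in the unimodular case. *)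
Lemma antipode4 y : S (S (S (S y))) * g = g * y.
Proof.
apply/eqP; rewrite -subr_eq0; apply/eqP; apply: lam_nondegenerate => b.
rewrite mulrBl (linD lam_lin) -scaleN1r (linZ lam_lin) scaleN1r.
have -> : lam (S (S (S (S y))) * g * b) = lam (g * y * b).
  rewrite -mulrA nakayama -mulrA -lam_antipode antipodeM nakayama.
  by rewrite -antipodeM lam_antipode mulrA.
by rewrite subrr.
Qed.

Lemma trace_frobenius (f : H -> H) : linear f ->
  trace f = \sw_(a, b <- L) (lam (f (S b) * a) : K^o).
Proof.
move=> lf; set e := fun i : 'I_(\dim {:H}) => (vbasis {:H})`_i.
pose f' i := S (hcomul H L (dual_basis i)).
rewrite /trace (@lftrace_sum_frame _ _ _ _ (fun i x => lam (x * e i)) f') //.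
- by lin.
- by move=> x; rewrite -[LHS]frobenius_l.
Qed.

Lemma trace_antipode2 : trace (fun y => S (S y)) = lam 1.
Proof.
rewrite trace_frobenius; last by lin.
under eq_tlift do rewrite nakayama.
by rewrite (@sw_Sr _ _ _ lam) // L1 scale1r.
Qed.

End Frobenius.

(** * The integral of a semisimple Hopf algebra, and orders of grouplike elements *)

Section Grouplike.
Context (K : fieldType) (H : hopfAlgebra K).
Local Notation eps := (hcounit H).

(** The integral is the component [w] of 1 in an invariant complement of the augmentation ideal:
    [h w - eps(h) w] lies in the complement and in the ideal. *)
Lemma semisimple_left_integral : semisimple H ->
  exists2 L : H, (forall h, h * L = (eps h : K) *: L) & eps L = 1.
Proof.
move=> ss; pose e : 'Hom(H, K^o) := linfun eps.
have eE h : e h = eps h by rewrite lfunE.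
have [] := ss (lker e).
  by move=> a v; rewrite !memv_ker !eE hcounitM => /eqP ->; rewrite mulr0.
move=> W [subW UW disj].
have /memv_addP[u uU [w wW uw]] : (1 : H) \in (lker e + W)%VS by rewrite UW memvf.
have ew : eps w = 1.
  move: uU; rewrite memv_ker eE => /eqP u0.
  by rewrite -(hcounit1 H) uw linearD u0 /= add0r.
exists w => // h; apply/eqP; rewrite -subr_eq0 -memv0 -disj memv_cap.
rewrite memv_ker eE linearB linearZ /= hcounitM ew subrr eqxx.
by rewrite memvB ?memvZ ?subW.
Qed.

Definition grouplike (g : H) := hcomul H g = tens g g /\ eps g = 1.

Lemma grouplikeX g k : grouplike g -> grouplike (g ^+ k).
Proof.
move=> [gg g1]; elim: k => [|k [IHg IH1]].
  by split; [rewrite hcomul1 | rewrite hcounit1].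
split; last by rewrite exprS hcounitM g1 IH1 mulr1.
rewrite exprS hcomulM gg tlift_tens; last by lin.
by rewrite IHg tlift_tens //; lin.
Qed.

(** Distinct grouplike elements are linearly independent, so infinite order would exceed the
    dimension. *)
Lemma grouplike_order g : grouplike g -> (forall x : H, g * x = 0 -> x = 0) ->
  exists2 m, (0 < m)%N & g ^+ m = 1.
Proof.
move=> glg ginj; apply/not_exists2P => nord.
have inj i j : (i < j)%N -> g ^+ i != g ^+ j.
  move=> ij; apply/eqP => e.
  have [] := nord (j - i)%N; first by rewrite subn_gt0 ij.
  apply; apply/eqP; rewrite -subr_eq0; apply/eqP.
  have cancel k x : g ^+ k * x = 0 -> x = 0.
    elim: k x => [|k IH] x; first by rewrite mul1r.
    by rewrite exprS -mulrA => /ginj /IH.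
  by apply: (cancel i); rewrite mulrBr -exprD subnKC ?mulr1 ?e ?subrr // ltnW.
(* Decreasing exponents put the newest power at the head, as [free_cons] expects. *)
pose X k := [seq g ^+ i | i <- rev (iota 0 k)].
have XS k : X k.+1 = g ^+ k :: X k by rewrite /X -addn1 iotaD rev_cat.
have freeX k : free (X k).
  elim: k => [|k IH]; first exact: nil_free.
  rewrite XS free_cons IH andbT; apply/negP => gk.
  have [gkg gk1] := grouplikeX k glg.
  have [i ci] : exists i, coord (in_tuple (X k)) i (g ^+ k) != 0.
    apply: contrapT => /forallNP c0.
    have e0 : g ^+ k = 0.
      rewrite (coord_span (X := in_tuple (X k)) gk) big1 // => i _.
      by have /negP := c0 i; rewrite negbK => /eqP ->; rewrite scale0r.
    by move: gk1; rewrite e0 linear0 => /eqP; rewrite eq_sym oner_eq0.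
  set c := coord _ _ in ci.
  (* Each power of [g] is an eigenvector of [G], with eigenvalue its [c]-coordinate. Applied to
     [g ^+ k] expanded in the smaller powers, [G] keeps the [i]-th term only, so [g ^+ k] equals a
     smaller power. *)
  pose G x := \sw_(a, b <- x) (c a : K) *: b.
  have lc : linear (c : H -> K^o) by move=> a x y; rewrite /c linearP.
  have lG : linear G by rewrite /G; lin.
  have GE j : G (g ^+ j) = c (g ^+ j) *: g ^+ j.
    have [gj _] := grouplikeX j glg.
    by rewrite /G gj tlift_tens //; lin.
  have XE (j : 'I_(size (X k))) : exists2 l, (l < k)%N & (X k)`_j = g ^+ l.
    have : (X k)`_j \in X k by rewrite mem_nth.
    by move=> /mapP[l]; rewrite mem_rev mem_iota => /andP[_ lk] ->; exists l.
  have cX (j : 'I_(size (X k))) : c (X k)`_j = (i == j)%:R.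
    by rewrite /c (coord_free (X := in_tuple (X k))) // eq_sym.
  have E : c (g ^+ k) *: g ^+ k = c (g ^+ k) *: (X k)`_i.
    rewrite -GE [in LHS](coord_span (X := in_tuple (X k)) gk) (linS lG).
    rewrite (bigD1 i) //= big1 ?addr0; last first.
      move=> j ji; rewrite (linZ lG); have [l _ Xl] := XE j.
      by rewrite Xl GE -Xl cX eq_sym (negPf ji) scale0r scaler0.
    have [l _ Xl] := XE i.
    by rewrite (linZ lG) Xl GE -Xl cX eqxx scale1r.
  have [j jk Xj] := XE i.
  move/eqP: E; rewrite -subr_eq0 -scalerBr scaler_eq0 (negPf ci) /= subr_eq0 Xj.
  by rewrite eq_sym => /eqP e; have := inj _ _ jk; rewrite e eqxx.
have := freeX (\dim {:H}).+1; rewrite /free => /eqP e.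
have := dimvS (subvf (span (X (\dim {:H}).+1))).
by rewrite e /X size_map size_rev size_iota ltnn.
Qed.

End Grouplike.

(** * Simple modules and traces on a semisimple algebra *)

Section ModuleBasics.
Context (K : fieldType) (A : falgType K).
Implicit Types (V : lmodule A).

Lemma act_linl V (v : V) : linear (fun a : A => act a v).
Proof. by have [[l _] _ _] := lmP V. Qed.

Lemma act_linr V (a : A) : linear (fun v : V => act a v).
Proof. by have [[_ r] _ _] := lmP V. Qed.

Lemma actM V (a b : A) (v : V) : act (a * b) v = act a (act b v).
Proof. by have [_ _] := lmP V. Qed.

Lemma act1 V (v : V) : act (1 : A) v = v.
Proof. by have [_ -> _] := lmP V. Qed.

End ModuleBasics.

Section Schur.
Context (K : closedFieldType) (A : falgType K).
Implicit Types (V W : lmodule A).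

Definition module_hom V W (f : V -> W) :=
  linear f /\ forall (a : A) v, f (act a v) = act a (f v).

Lemma schur_bij V W (f : V -> W) : irreducible_module V -> irreducible_module W ->
  module_hom f -> (forall v, f v = 0) \/ bijective f.
Proof.
move=> [V0 irrV] [W0 irrW] [lf homf]; pose F := linfun f : 'Hom(V, W).
have FE v : F v = f v by rewrite linfunE.
have subK : is_submodule (lker F).
  move=> a v; rewrite !memv_ker !FE homf => /eqP ->.
  by rewrite (lin0 (act_linr a)).
have subI : is_submodule (limg F).
  move=> a w /memv_imgP[v _ ->]; rewrite FE -homf -FE.
  by apply: memv_img; rewrite memvf.
have [K0|Kf] := irrV _ subK; last first.
  by left=> v; rewrite -FE; apply/eqP; rewrite -memv_ker Kf memvf.
have injF : lker F == 0%VS by rewrite K0.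
have [I0|If] := irrW _ subI.
  left=> v; rewrite -FE; apply/eqP; rewrite -memv0 -I0.
  by apply: memv_img; rewrite memvf.
right; exists (F^-1)%VF => v; first by rewrite -FE lker0_lfunK.
have : v \in limg F by rewrite If memvf.
by move=> /memv_imgP[u _ ->]; rewrite lker0_lfunK // FE.
Qed.

Lemma eigenvector_exists (V : vectType K) (f : V -> V) : linear f ->
  (fullv : {vspace V}) <> 0%VS -> exists a, exists2 v, v != 0 & f v = a *: v.
Proof.
move=> lf V0; pose b := vbasis {:V}.
pose M := \matrix_(i, j < \dim {:V}) coord b j (f b`_i).
have [a ra] : exists a, root (char_poly M) a.
  by apply/closed_rootP; rewrite size_char_poly eqSS dimv_eq0; apply/eqP.
have /eigenvalueP[u uM u0] : eigenvalue M a by rewrite eigenvalue_root_char.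
exists a, (\sum_i u 0 i *: b`_i).
  apply: contraNneq u0 => v0; apply/eqP/rowP => i.
  have := congr1 (coord b i) v0.
  by rewrite coord_sum_free ?linear0 ?mxE ?(basis_free (vbasisP _)).
rewrite (linS lf) scaler_sumr.
under eq_bigr => i _.
  rewrite (linZ lf) [f _]vbasis_frame scaler_sumr.
  under eq_bigr do rewrite scalerA.
  over.
rewrite exchange_big /=; apply: eq_bigr => j _.
rewrite -scaler_suml scalerA; congr (_ *: _).
by have := congr1 (fun r : 'rV_ _ => r 0 j) uM; rewrite !mxE => <-; apply: eq_bigr => i _; rewrite mxE.
Qed.

Lemma schur_scalar V (f : V -> V) : irreducible_module V -> module_hom f ->
  exists c, forall v, f v = c *: v.
Proof.
move=> irrV [lf homf]; have [V0 _] := irrV.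
have [c [v v0 fv]] := eigenvector_exists lf V0.
exists c => w; pose h v := f v + - c *: v.
have hh : module_hom h.
  split; first by rewrite /h; lin.
  by move=> a u; rewrite /h homf (linD (act_linr a)) (linZ (act_linr a)).
have [h0|[k hk _]] := schur_bij irrV irrV hh.
  by apply/eqP; rewrite -subr_eq0 -scaleNr; apply/eqP; exact: h0.
have : v = 0 by rewrite -(hk v) -(hk 0) /h fv scaler0 (lin0 lf) addr0 scaleNr subrr.
by move/eqP; rewrite (negPf v0).
Qed.

Lemma module_hom_iso V W (f : V -> W) : module_hom f -> bijective f ->
  module_iso V W.
Proof.
move=> [lf homf] [g fK gK]; exists (linfun f); split.
  by exists g => v; rewrite linfunE ?fK ?gK.
by move=> a v; rewrite !linfunE.
Qed.

Lemma module_iso_sym V W : module_iso V W -> module_iso W V.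
Proof.
move=> [f [[g fK gK] homf]]; apply: (@module_hom_iso _ _ g); last by exists f.
split=> [c x y|a v].
  by apply: (can_inj fK); rewrite gK linearP /= !gK.
by apply: (can_inj fK); rewrite gK homf gK.
Qed.

Lemma module_iso_trans V W X : module_iso V W -> module_iso W X -> module_iso V X.
Proof.
move=> [f [bf homf]] [g [bg homg]]; apply: (@module_hom_iso _ _ (g \o f)).
  by split=> [|a v]; [rewrite /=; lin|rewrite /= homf homg].
exact: bij_comp.
Qed.

Lemma isoclass_eq V W : module_iso V W -> isoclass V = isoclass W.
Proof.
move=> VW; apply/seteqP; split=> X /= h.
  exact: module_iso_trans (module_iso_sym VW) h.
exact: module_iso_trans VW h.
Qed.

Lemma irreducible_iso V W : module_iso V W -> irreducible_module V ->
  irreducible_module W.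
Proof.
move=> [f [bf homf]] [V0 irrV].
have kf : lker f == 0%VS by apply/lker0P; apply: bij_inj.
have If : limg f = fullv.
  case: bf => g _ gK; apply/eqP; rewrite eqEsubv subvf; apply/subvP => w _.
  by rewrite -(gK w) memv_img ?memvf.
split=> [W0|U subU].
  apply: V0; apply/eqP; rewrite -dimv_eq0 -(limg_dim_eq (f := f)) ?If ?W0 ?dimv0 //.
  by rewrite (eqP kf) capv0.
have [|e|e] := irrV (f @^-1: U)%VS.
- by move=> a v; rewrite -!memv_preim homf; exact: subU.
- left; apply/eqP; rewrite -subv0; apply/subvP => w wU.
  have : w \in limg f by rewrite If memvf.
  move=> /memv_imgP[v _ wv]; have : v \in (f @^-1: U)%VS by rewrite -memv_preim -wv.
  by rewrite e memv0 wv => /eqP ->; rewrite linear0 mem0v.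
- right; apply/eqP; rewrite eqEsubv subvf; apply/subvP => w _.
  have : w \in limg f by rewrite If memvf.
  by move=> /memv_imgP[v _ ->]; rewrite memv_preim e memvf.
Qed.

Lemma repr_module_iso V : module_iso V (repr_module (isoclass V)).
Proof. by have := xgetPex (Stdmodule (@zero_stdP _ A)) (isoclass_nonempty V). Qed.

Lemma Irr_irreducible c : Irr A c -> irreducible_module (repr_module c).
Proof. by move=> [V [irrV ->]]; exact: irreducible_iso (repr_module_iso V) irrV. Qed.

Lemma Irr_eq c d : Irr A c -> Irr A d ->
  module_iso (repr_module c) (repr_module d) -> c = d.
Proof.
move=> [V [_ ->]] [W [_ ->]] h; apply: isoclass_eq.
apply: module_iso_trans (repr_module_iso V) (module_iso_trans h _).
exact: module_iso_sym (repr_module_iso W).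
Qed.

End Schur.

(** * Writing elements of a semisimple algebra through simple left ideals *)

Section Decomposition.
Context (K : closedFieldType) (A : falgType K).

(* A simple module [W] with [selt : W] and a module map [shom : W -> A].  That  *)
(* [1] is a sum of elements [shom selt] is all that is used of the Wedderburn  *)
(* decomposition of [A].                                                       *)
Record simple_summand := SimpleSummand {
  sclass : set (stdmodule A);
  selt : repr_module sclass;
  shom : repr_module sclass -> A;
  sIrr : Irr A sclass;
  shomP : module_hom (W := regular A) shom }.

HB.instance Definition _ := gen_eqMixin simple_summand.

Definition summand_val (t : simple_summand) : A := shom (selt t).

Lemma simple_submodule_sum (U : {vspace A}) (v : A) :
  is_submodule (V := regular A) U -> U != 0%VS ->
  (forall U' : {vspace A}, is_submodule (V := regular A) U' ->
     (U' <= U)%VS -> U' = 0%VS \/ U' = U) ->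
  v \in U -> exists t, v = summand_val t.
Proof.
move=> subU U0 minU vU.
pose a_ (a : A) (u : subvs_of U) : subvs_of U := vsproj U (a * vsval u).
have aE a u : vsval (a_ a u) = a * vsval u.
  by rewrite vsprojK //; apply: (subU a); exact: subvsP.
have sP : is_module (@ModuleData K A (subvs_of U) a_).
  split=> [|u|a b u]; [split=> u c x y| |]; apply: val_inj => /=;
    rewrite ?linearP /= ?aE /=.
  - by rewrite mulrDl scalerAl.
  - by rewrite mulrDr scalerAr.
  - by rewrite mul1r.
  - by rewrite mulrA.
pose Us := Lmodule sP.
have irrU : irreducible_module Us.
  split=> [e|X subX].
    move: U0; rewrite -subv0 => /negP; apply; apply/subvP => x xU.
    have : vsproj U x \in (fullv : {vspace Us}) by rewrite memvf.
    by rewrite e !memv0 -{2}(vsprojK xU) => /eqP ->; rewrite linear0.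
  pose i : 'Hom(Us, A) := linfun (vsval : subvs_of U -> A).
  have iE (x : Us) : i x = vsval x by rewrite lfunE.
  have [|| e | e] := minU (i @: X)%VS.
  - move=> a w /memv_imgP[x xX ->]; rewrite iE; apply/memv_imgP.
    by exists (a_ a x); rewrite ?iE ?aE //; apply: (subX a).
  - by apply/subvP => w /memv_imgP[x _ ->]; rewrite iE subvsP.
  - left; apply/eqP; rewrite -subv0; apply/subvP => x xX.
    have : i x \in (i @: X)%VS by rewrite memv_img.
    by rewrite e !memv0 iE => /eqP x0; apply/eqP/val_inj; rewrite /= x0.
  - right; apply/eqP; rewrite eqEsubv subvf; apply/subvP => x _.
    have : i x \in (i @: X)%VS by rewrite e iE subvsP.
    by move=> /memv_imgP[y yX]; rewrite !iE => /val_inj ->.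
have [f [[g fK gK] homf]] := repr_module_iso Us.
have homg (a : A) w : g (act a w) = act a (g w).
  by apply: (can_inj fK); rewrite gK homf gK.
have ling : linear g by move=> c x y; apply: (can_inj fK); rewrite gK linearP /= !gK.
have cI : Irr A (isoclass Us) by exists Us.
have hP : module_hom (W := regular A) (fun w => vsval (g w)).
  split=> [|a w]; first by move=> c x y; rewrite ling linearP.
  by rewrite homg aE.
exists (SimpleSummand (f (vsproj U v)) cI hP); rewrite /summand_val /= fK vsprojK //.
Qed.

Lemma minimal_submodule (U : {vspace A}) :
  is_submodule (V := regular A) U -> U != 0%VS ->
  exists U0 : {vspace A}, [/\ is_submodule (V := regular A) U0, U0 != 0%VS,
    (U0 <= U)%VS & forall U' : {vspace A}, is_submodule (V := regular A) U' ->
     (U' <= U0)%VS -> U' = 0%VS \/ U' = U0].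
Proof.
have [n] := ubnP (\dim U); elim: n U => // n IH U ltUn subU U0.
have [mU|nmU] := pselect (forall U' : {vspace A}, is_submodule (V := regular A) U' ->
     (U' <= U)%VS -> U' = 0%VS \/ U' = U); first by exists U.
move/existsNP: nmU => [U' /not_implyP[sU' /not_implyP[U'U]]].
move=> /not_orP[/eqP U'0 /eqP U'nU].
have [|||W [sW W0 WU' mW]] := IH U' => //.
  rewrite (leq_trans _ (ltUn : (\dim U <= n)%N)) // ltnNge.
  by apply: contra U'nU => le; rewrite eqEdim U'U.
by exists W; split=> //; apply: subv_trans U'U.
Qed.

(** Induction on the codimension of a submodule [U] whose elements all decompose: a minimal
    submodule of a complement enlarges [U]. *)
Lemma regular_sum_simple (x : A) : semisimple A ->
  exists r : seq simple_summand, x = \sum_(t <- r) summand_val t.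
Proof.
move=> ss.
suff claim n (U : {vspace A}) : (\dim {:A} - \dim U <= n)%N ->
    is_submodule (V := regular A) U ->
    (forall v, v \in U -> exists r, v = \sum_(t <- r) summand_val t) ->
    exists r, x = \sum_(t <- r) summand_val t.
  apply: (claim _ 0%VS (leqnn _)) => [a v|v].
    by rewrite !memv0 => /eqP ->; rewrite /act /= mulr0.
  by rewrite memv0 => /eqP ->; exists [::]; rewrite big_nil.
elim: n U => [|n IH] U leU subU decU.
  apply: decU; have -> : U = fullv; last exact: memvf.
  by apply/eqP; rewrite eqEdim subvf /= -subn_eq0 -leqn0.
have [Uf|Unf] := eqVneq U fullv; first by apply: decU; rewrite Uf memvf.
have [C [subC UC disj]] := ss U subU.
have C0 : C != 0%VS.
  by apply: contraNneq Unf => e; rewrite -UC e addv0.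
have [U0 [sU0 U0n0 U0C mU0]] := minimal_submodule subC C0.
apply: (IH (U + U0)%VS) => [|a v /memv_addP[u uU [w wU0 ->]]|v /memv_addP[u uU [w wU0 ->]]].
- have disj0 : (U :&: U0 = 0)%VS.
    by apply/eqP; rewrite -subv0 -disj capvS.
  have := dimv_disjoint_sum disj0; have : (0 < \dim U0)%N by rewrite lt0n dimv_eq0.
  have := dimvS (subvf (U + U0)%VS); move: leU; lia.
- rewrite (linD (act_linr (V := regular A) a)); apply: memv_add; first exact: (subU a).
  exact: (sU0 a).
have [r ->] := decU u uU; have [t ->] := simple_submodule_sum sU0 U0n0 mU0 wU0.
by exists (rcons r t); rewrite big_rcons.
Qed.

End Decomposition.

Section TraceMore.
Context (K : fieldType) (V : vectType K).

Lemma trace_sum I (r : seq I) (F : I -> V -> V) : (forall i, linear (F i)) ->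
  trace (fun x => \sum_(i <- r) F i x) = \sum_(i <- r) trace (F i).
Proof.
move=> lF; rewrite traceE; last by lin.
under [RHS]eq_bigr do rewrite traceE //.
rewrite exchange_big; apply: eq_bigr => j _.
by rewrite (linear_sum (coord _ _)).
Qed.

Lemma traceD (f g : V -> V) : linear f -> linear g ->
  trace (fun x => f x + g x) = trace f + trace g.
Proof.
move=> lf lg; rewrite !traceE //; last by lin.
by rewrite -big_split; apply: eq_bigr => i _; rewrite linearD.
Qed.

Lemma trace_rank1 (k : V -> K^o) (w : V) : linear k ->
  trace (fun u => (k u : K) *: w) = k w.
Proof.
move=> lk; rewrite traceE; last by lin.
rewrite [in RHS](vbasis_frame w) (linS lk); apply: eq_bigr => i _.
by rewrite linearZ (linZ lk) /= [RHS]mulrC.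
Qed.

Lemma trace0 : trace (fun=> 0 : V) = 0.
Proof.
rewrite traceE ?big1 // => [i _|c x y]; first exact: linear0.
by rewrite scaler0 addr0.
Qed.

Lemma trace_id : trace (fun v : V => v) = (\dim {:V})%:R.
Proof.
rewrite traceE // -[X in _ = X%:R]card_ord -sumr_const; apply: eq_bigr => i _.
by rewrite coord_free ?eqxx ?(basis_free (vbasisP _)).
Qed.

Lemma trace_scale (f : V -> V) c : linear f ->
  trace (fun x => c *: f x) = c * trace f.
Proof.
move=> lf; rewrite !traceE //; last by lin.
by rewrite mulr_sumr; apply: eq_bigr => i _; rewrite linearZ.
Qed.

End TraceMore.

(** * Traces on a semisimple algebra as sums over simple classes *)

Section TraceFormula.
Context (K : closedFieldType) (A : falgType K).
Context (r : seq (simple_summand A)) (sum1 : (1 : A) = \sum_(t <- r) summand_val t).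
Implicit Types (t : simple_summand A) (c : set (stdmodule A)).

(** Multiplying [phi x] by the decomposition of 1 makes each term factor through a simple module,
    and cyclicity moves the trace there. *)
Lemma trace_regular (phi : A -> A) : linear phi ->
  trace phi = \sum_(t <- r)
    trace (fun w => act (phi (shom (s := t) w)) (selt t)).
Proof.
move=> lphi.
have hl t : linear (shom (s := t)) by case: (shomP t).
have hM t (a : A) w : shom (s := t) (act a w) = a * shom (s := t) w.
  by case: (shomP t) => _ ->.
transitivity (trace (fun x => \sum_(t <- r) shom (act (phi x) (selt t)))).
  apply: eq_trace => x; rewrite -{1}[phi x]mulr1 sum1 mulr_sumr.
  by apply: eq_bigr => t _; rewrite hM.
have al t := act_linl (V := repr_module (sclass t)).
have ar t := act_linr (V := repr_module (sclass t)).
rewrite trace_sum; last by lin.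
by apply: eq_bigr => t _; rewrite traceC //; lin.
Qed.

(** For fixed [u] the map [w |-> shom w . u] is a module endomorphism, hence a scalar by Schur;
    [k u] reads this scalar off one coordinate. *)
Lemma summand_scalar t : exists k : repr_module (sclass t) -> K^o,
  linear k /\ forall w u, act (shom (s := t) w) u = (k u : K) *: w.
Proof.
have irr := Irr_irreducible (sIrr t); have [W0 _] := irr.
have [hl hM] := shomP t.
set W := repr_module (sclass t) in irr W0 hl hM *.
have al := act_linl (V := W); have ar := act_linr (V := W).
have sc u : exists c0 : K, forall w, act (m := W) (shom (s := t) w) u = c0 *: w.
  apply: (schur_scalar irr); split=> [|a v]; first by lin.
  by rewrite hM (actM (V := W)).
pose b := vbasis (fullv : {vspace W}).
have d0 : (0 < \dim (fullv : {vspace W}))%N by rewrite lt0n dimv_eq0; apply/eqP.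
pose i := Ordinal d0.
have lc : linear (coord b i : W -> K^o) by exact: coord_linear.
exists (fun u => coord b i (act (m := W) (shom (s := t) b`_i) u)); split; first by lin.
move=> w u; have [c0 cE] := sc u; rewrite !cE (linZ lc) (coord_free i i) ?eqxx ?[_ *: 1%R]mulr1 //.
exact: (basis_free (vbasisP _)).
Qed.

Lemma summand_other t c : Irr A c -> sclass t <> c ->
  forall w (u : repr_module c), act (shom (s := t) w) u = 0.
Proof.
move=> cI ne w u; have [hl hM] := shomP t.
have al := act_linl (V := repr_module c).
have hom : @module_hom _ _ (repr_module (sclass t)) (repr_module c)
    (fun w => act (shom (s := t) w) u).
  by split=> [|a v]; [lin | rewrite hM (actM (V := repr_module c))].
have [->//|bij] := schur_bij (Irr_irreducible (sIrr t)) (Irr_irreducible cI) hom.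
by case: ne; apply: (Irr_eq (sIrr t) cI); apply: module_hom_iso hom bij.
Qed.

Definition simple_classes := undup [seq sclass t | t <- r].

(** A simple module of a class that does not occur is killed by every summand of 1, hence by 1. *)
Lemma simple_classesP c : c \in simple_classes <-> Irr A c.
Proof.
rewrite mem_undup; split=> [/mapP[t _ ->]|cI]; first exact: sIrr.
apply/negPn/negP => cr; have [W0 _] := Irr_irreducible cI.
case: W0; apply/eqP; rewrite -subv0; apply/subvP => u _.
rewrite memv0 -(act1 (V := repr_module c) u) sum1.
rewrite (linS (act_linl (V := repr_module c) u)) big1_seq // => t /andP[_ tr].
apply: summand_other => // e; move/negP: cr; apply.
by rewrite -e map_f.
Qed.

(** Summands of other classes act by zero, so for each class the sum may be extended to all [t],
    where the summands add up to 1. The bimultiplication formula and the trace of an automorphism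
    are both instances. *)
Lemma trace_by_class (phi : A -> A) (p : set (stdmodule A) -> K)
    (R : forall c, repr_module c -> repr_module c) :
  linear phi -> (forall c, linear (R c)) ->
  (forall t, trace (fun w => act (phi (shom (s := t) w)) (selt t)) =
     p (sclass t) * trace (fun u : repr_module (sclass t) => R _ (act (summand_val t) u))) ->
  trace phi = \sum_(c <- simple_classes) p c * trace (R c).
Proof.
move=> lphi lR E; rewrite trace_regular //.
pose th t c := p c * trace (fun u : repr_module c => R c (act (summand_val t) u)).
have ar c := act_linr (V := repr_module c).
transitivity (\sum_(t <- r) \sum_(c <- simple_classes) th t c).
  apply: eq_big_seq => t tr; rewrite E.
  rewrite (bigD1_seq (sclass t)) ?undup_uniq ?mem_undup ?map_f //=.
  rewrite [X in _ + X]big1_seq ?addr0 // => c /andP[/eqP ct /simple_classesP cI].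
  rewrite /th traceE; last by lin.
  rewrite big1 ?mulr0 // => i _; rewrite summand_other //; last by move=> e; apply: ct.
  by rewrite (lin0 (lR c)) linear0.
rewrite exchange_big; apply: eq_big_seq => c /simple_classesP cI /=.
rewrite -mulr_sumr -trace_sum; last by lin.
congr (_ * _); apply: eq_trace => u; rewrite -[in RHS](act1 (V := repr_module c) u) sum1.
by rewrite (linS (act_linl (V := repr_module c) u)) (linS (lR c)).
Qed.

Lemma trace_bimult (a b : A) :
  trace (fun x => a * x * b) =
  \sum_(c <- simple_classes) mchar (repr_module c) a * mchar (repr_module c) b.
Proof.
apply: (@trace_by_class _ (fun c => mchar (repr_module c) a) (fun c u => act b u)).
- by lin.
- by move=> c; exact: (act_linr (V := repr_module c)).
move=> t; set W := repr_module (sclass t).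
have ar := act_linr (V := W).
have [k [lk kE]] := summand_scalar t.
transitivity (trace (fun w : W => act a ((k (act b (selt t)) : K) *: w))).
  by apply: eq_trace => w; rewrite !(actM (V := W)) kE.
transitivity (mchar W a * trace (fun u : W => (k u : K) *: act b (selt t))); last first.
  by congr (_ * _); apply: eq_trace => u; rewrite /summand_val kE (linZ (ar b)).
rewrite mulrC.
rewrite trace_rank1 // traceE; last by lin.
rewrite /mchar -/(trace _) [in RHS]traceE // mulr_sumr; apply: eq_bigr => i _.
by rewrite (linZ (ar a)) linearZ.
Qed.

End TraceFormula.

(** * Traces of automorphisms of finite order *)

Section FiniteOrder.
Context (K : numClosedFieldType).

Local Notation "M ^h" := (map_mx Num.conj M^T) (at level 8, format "M ^h").

(* Averaging over the powers of [M] gives an invertible [G] with *)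
(* [M G M^h = G], so that [N] is conjugate to [M^h]. *)
Lemma mxtrace_finite_order n (M N : 'M[K]_n) m :
  (0 < m)%N -> M *m N = 1%:M -> iter m (mulmx M) 1%:M = 1%:M ->
  \tr N = (\tr M)^*.
Proof.
move=> m0 MN Mm; pose pw k := iter k (mulmx M) 1%:M : 'M[K]_n.
have hM p q s (X : 'M[K]_(p, q)) (Y : 'M[K]_(q, s)) : (X *m Y)^h = Y^h *m X^h.
  by rewrite trmx_mul map_mxM.
pose G := \sum_(k < m) pw k *m (pw k)^h.
have MG : M *m G *m M^h = G.
  rewrite /G mulmx_sumr mulmx_suml.
  under eq_bigr do rewrite mulmxA -mulmxA -hM -[M *m _]/(pw _.+1).
  case: m m0 Mm @G => // m _ Mm.
  have Em : pw m.+1 = pw 0 by [].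
  rewrite [LHS]big_ord_recr [RHS]big_ord_recl [RHS]addrC; congr (_ + _).
  by rewrite -[pw ord0]Em.
have Gu : G \in unitmx.
  rewrite -row_free_unit -kermx_eq0; apply/eqP/row_matrixP => i; rewrite row0.
  set u := row i _; have uG : u *m G = 0 by apply/sub_kermxP; exact: row_sub.
  have nneg (v : 'rV[K]_n) : (v *m v^h) 0 0 = \sum_j `|v 0 j| ^+ 2.
    by rewrite mxE; apply: eq_bigr => j _; rewrite !mxE normCK.
  have : (u *m G *m u^h) 0 0 = 0 by rewrite uG mul0mx mxE.
  rewrite /G mulmx_sumr mulmx_suml summxE.
  under eq_bigr do rewrite mulmxA -mulmxA -hM nneg.
  move/eqP; rewrite psumr_eq0; last first.
    by move=> k _; apply: sumr_ge0 => j _; rewrite exprn_ge0 ?normr_ge0.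
  move=> /allP /(_ (Ordinal m0)); rewrite mem_index_enum => /(_ isT) /=.
  rewrite /pw /= mulmx1 psumr_eq0; last by move=> j _; rewrite exprn_ge0 ?normr_ge0.
  move=> /allP u0; apply/rowP => j; rewrite [RHS]mxE.
  by have := u0 j; rewrite mem_index_enum => /(_ isT) /=; rewrite expf_eq0 normr_eq0 => /eqP.
have NM : N *m M = 1%:M by exact: mulmx1C.
have -> : N = G *m M^h *m invmx G.
  have : N *m (M *m G *m M^h) = N *m G by rewrite MG.
  rewrite !mulmxA NM mul1mx => ->.
  by rewrite -mulmxA mulmxV // mulmx1.
rewrite mxtrace_mulC mulmxA mulVmx // mul1mx -map_trmx mxtrace_tr.
by rewrite /mxtrace rmorph_sum; apply: eq_bigr => i _; rewrite mxE.
Qed.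

Lemma trace_finite_order (V : vectType K) (P Q : V -> V) m :
  linear P -> linear Q -> cancel Q P -> (0 < m)%N ->
  (forall v, iter m P v = v) -> trace Q = (trace P)^*.
Proof.
move=> lP lQ QP m0 Pm; pose b := vbasis {:V}.
pose mx (f : V -> V) := \matrix_(i, j < \dim {:V}) coord b j (f b`_i).
have mxM f g : linear f -> linear g -> mx (fun v => g (f v)) = mx f *m mx g.
  move=> lf lg; apply/matrixP => i j; rewrite !mxE [f _]vbasis_frame (linS lg).
  by rewrite linear_sum; apply: eq_bigr => l _; rewrite (linZ lg) linearZ !mxE.
have mx1 f : f =1 id -> mx f = 1%:M.
  move=> f1; apply/matrixP => i j; rewrite !mxE f1 coord_free //.
  exact: (basis_free (vbasisP _)).
have tr f : linear f -> \tr (mx f) = trace f.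
  by move=> lf; rewrite traceE //; apply: eq_bigr => i _; rewrite mxE.
have lPk k : linear (iter k P) by elim: k => [|k IH] //=; lin.
have pw k : mx (iter k P) = iter k (mulmx (mx P)) 1%:M.
  elim: k => [|k IH]; first exact: mx1.
  by rewrite iterS -IH -mxM //; congr mx; apply: funext => v; rewrite iterSr.
rewrite -!tr //; apply: (@mxtrace_finite_order _ _ _ m) => //.
  by apply: mulmx1C; rewrite -mxM //; apply: mx1 => v; rewrite QP.
by rewrite -pw; apply: mx1.
Qed.

(** Dividing [P] by an [m]-th root of [c] gives finite order and does not change
    [trace P * trace Q], which becomes a squared absolute value. *)
Lemma trace_projective_order (V : vectType K) (P Q : V -> V) m c :
  linear P -> linear Q -> cancel Q P -> (0 < m)%N -> c != 0 ->
  (forall v, iter m P v = c *: v) -> 0 <= trace P * trace Q.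
Proof.
move=> lP lQ QP m0 c0 Pm; pose z := m.-root c.
have zm : z ^+ m = c by rewrite rootCK.
have z0 : z != 0 by apply: contraNneq c0 => z0; rewrite -zm z0 expr0n eqn0Ngt m0.
pose P' v := z^-1 *: P v; pose Q' v := z *: Q v.
have lP' : linear P' by rewrite /P'; lin.
have lQ' : linear Q' by rewrite /Q'; lin.
have P'k k v : iter k P' v = z^-1 ^+ k *: iter k P v.
  elim: k => [|k IH] /=; first by rewrite scale1r.
  by rewrite IH /P' (linZ lP) scalerA exprS.
have E : trace Q' = (trace P')^*.
  apply: (@trace_finite_order _ _ _ m) => // v.
    by rewrite /P' /Q' (linZ lP) scalerA mulVf // scale1r QP.
  by rewrite P'k Pm scalerA exprVn zm mulVf // scale1r.
have -> : trace P * trace Q = trace P' * trace Q'.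
  by rewrite !trace_scale // mulrACA mulVf // mul1r.
by rewrite E mul_conjC_ge0.
Qed.

Context (A : falgType K) (T : A -> A) (m : nat) (e : A -> K^o).
Context (ss : semisimple A) (lT : linear T) (TM : {morph T : x y / x * y})
  (T1 : T 1 = 1) (m0 : (0 < m)%N) (Tm : forall x, iter m T x = x).
Context (le : linear e) (eM : {morph e : x y / x * y}) (e1 : e 1 = 1)
  (eT : forall x, e (T x) = e x).

Lemma trivial_module : is_module (@ModuleData K A K^o (fun a x => (e a : K) * x)).
Proof.
split=> [|v|a b v]; [split=> v c x y| |]; rewrite /=.
- by rewrite le mulrDl /GRing.scale /= mulrA.
- by rewrite mulrDr /GRing.scale /= mulrCA.
- by rewrite e1 mul1r.
- by rewrite eM mulrA.
Qed.

Lemma twisted_module (W : lmodule A) :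
  is_module (@ModuleData K A W (fun a x => act (T a) x)).
Proof.
have [[al ar] a1 aM] := lmP W.
split=> [|v|a b v]; [split=> v c x y| |]; rewrite /= ?T1 ?TM ?lT //.
- exact: al.
- exact: ar.
Qed.

Definition twist (W : lmodule A) := Lmodule (twisted_module W).

Lemma twist_irreducible (W : lmodule A) : irreducible_module W ->
  irreducible_module (twist W).
Proof.
move=> [W0 irrW]; split=> // U subU; apply: irrW => a v vU.
have -> : a = T (iter m.-1 T a) by rewrite -iterS prednK ?Tm.
exact: subU.
Qed.

(* The automorphism [T] permutes the isoclasses of simple modules; only those   *)
(* fixed by [T], through some intertwiner [P], contribute to its trace, by     *)
(* [tr P * tr P^-1].                                                           *)
Definition twist_iso c (PQ : (repr_module (A := A) c -> repr_module c) *
    (repr_module c -> repr_module c)) : Prop :=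
  [/\ linear PQ.1, linear PQ.2, cancel PQ.2 PQ.1, cancel PQ.1 PQ.2 &
    forall a w, PQ.1 (act a w) = act (T a) (PQ.1 w)].

(** As [T^m = 1], the [m]-th power of the intertwiner is a module endomorphism, so a scalar, and
    nonzero by injectivity. *)
Lemma twist_iso_ge0 c PQ : Irr A c -> @twist_iso c PQ ->
  0 <= trace PQ.1 * trace PQ.2.
Proof.
move=> cI [lP lQ QP PQ' hom]; have irr := Irr_irreducible cI.
set W := repr_module c in PQ lP lQ QP PQ' hom irr *.
have lPk k : linear (iter k PQ.1) by elim: k => [|k IH] //=; lin.
have homk k a w : iter k PQ.1 (act (m := W) a w) = act (iter k T a) (iter k PQ.1 w).
  by elim: k => //= k ->; rewrite hom.
have [c' c'E] : exists c', forall w : W, iter m PQ.1 w = c' *: w.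
  apply: (schur_scalar irr); split=> [|a v]; first exact: lPk.
  by rewrite homk Tm.
apply: (trace_projective_order lP lQ QP m0 _ c'E).
have [W0 _] := irr; apply: contra_notN W0 => /eqP c0.
apply/eqP; rewrite -subv0; apply/subvP => w _; rewrite memv0.
have inj : injective (iter m PQ.1).
  by elim: (m) => [|k IH] //= x y /(can_inj PQ') /IH.
by apply/eqP/inj; rewrite !c'E c0 !scale0r.
Qed.

Lemma trace_automorphism_gt0 : 0 < trace T.
Proof.
have [r sum1] := regular_sum_simple 1 ss.
(* The default covers the classes not fixed by [T]: zero maps, which contribute nothing. *)
pose dflt c : (repr_module (A := A) c -> repr_module c) *
  (repr_module c -> repr_module c) := (fun=> 0, fun=> 0).
pose PQ c := xget (dflt c) [set PQ | @twist_iso c PQ].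
have PQP c : @twist_iso c (PQ c) \/
    (PQ c = dflt c /\ forall X, ~ @twist_iso c X).
  by rewrite /PQ; case: xgetP => [X _|]; [left|right].
have lin0fun c : linear (fun _ : repr_module (A := A) c => 0 : repr_module c).
  by move=> k x y; rewrite scaler0 addr0.
have lR c : linear (PQ c).2 by case: (PQP c) => [[]|[-> _]].
have -> : trace T = \sum_(c <- simple_classes r) trace (PQ c).1 * trace (PQ c).2.
  apply: (@trace_by_class _ _ _ sum1 T (fun c => trace (PQ c).1) (fun c => (PQ c).2)) => //.
  move=> t; set W := repr_module (sclass t).
  have [k [lk kE]] := summand_scalar t.
  have [hl hM] := shomP t.
  have al := act_linl (V := W).
  have irr := Irr_irreducible (sIrr t).
  transitivity (trace (PQ (sclass t)).1 * k ((PQ (sclass t)).2 (selt t))); last first.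
    congr (_ * _); rewrite -trace_rank1 //; apply: eq_trace => u.
    by rewrite /summand_val kE (linZ (lR _)).
  case: (PQP (sclass t)) => [[lP lQ QP PQ' hom]|[-> none]].
    have {1}-> : selt t = (PQ (sclass t)).1 ((PQ (sclass t)).2 (selt t)) by rewrite QP.
    set u := (PQ _).2 _ in kE *; rewrite mulrC -trace_scale //.
    by apply: eq_trace => w; rewrite -hom kE (linZ lP).
  have homT : @module_hom _ _ W (twist W) (fun w => act (T (shom w)) (selt t)).
    split; first by lin.
    by move=> a v; rewrite hM TM (actM (V := W)).
  (* If bijective, this map and its inverse would be an intertwiner, which [none] excludes; so it is
     zero. *)
  have [f0|[g fK gK]] := schur_bij irr (twist_irreducible irr) homT.
    by rewrite (eq_trace (g := fun=> 0) f0) /= !trace0 mul0r.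
  case: (none (fun w => act (T (shom w)) (selt t), g)); case: homT => lf homf.
  split=> //=; move=> c x y; apply: (can_inj fK); rewrite gK lf !gK //.
pose triv := Lmodule trivial_module.
have irr0 : irreducible_module triv.
  split=> [V0|U subU].
    have : (1 : K^o) \in (fullv : {vspace triv}) by rewrite memvf.
    by rewrite V0 memv0 oner_eq0.
  have [->|U0] := eqVneq U 0%VS; [by left|right].
  have vU := memv_pick U; have := U0; rewrite -vpick0 => v0.
  apply/eqP; rewrite eqEsubv subvf; apply/subvP => x _.
  have -> : x = ((x : K) / (vpick U : K)) *: vpick U by rewrite /GRing.scale /= divfK.
  exact: memvZ.
have c0I : Irr A (isoclass triv) by exists triv.
have [f [[g fK gK] homf]] := repr_module_iso triv.
set c0 := isoclass triv in c0I f fK gK homf.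
have actE a (w : repr_module c0) : act a w = (e a : K) *: w.
  by rewrite -[w]gK -homf -linearZ.
have tw0 : @twist_iso c0 (id, id).
  split=> // a w; transitivity ((e a : K) *: w); first exact: actE.
  by rewrite -eT; exact/esym/actE.
have ge0 c : c \in simple_classes r -> 0 <= trace (PQ c).1 * trace (PQ c).2.
  move=> /(simple_classesP sum1) cI; have [tw|[-> _]] := PQP c; first exact: twist_iso_ge0.
  by rewrite /= trace0 mul0r.
have c0s : c0 \in simple_classes r by exact: (simple_classesP sum1 c0).2 c0I.
rewrite (bigD1_seq c0) ?undup_uniq //=.
rewrite ltr_pwDl //; last first.
  by rewrite big_seq_cond; apply: sumr_ge0 => c /andP[cs _]; apply: ge0.
case: (PQP c0) => [[lP lQ QP PQ' hom]|[_ /(_ (id, id))]] //.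
(* On the trivial class the chosen intertwiner is a scalar [p] and its partner the inverse scalar,
   so whatever [p] is, the term is the square of the dimension. *)
have [|p pE] := schur_scalar (f := (PQ c0).1) (Irr_irreducible c0I).
  by split=> // a w; rewrite hom !actE eT.
have -> : trace (PQ c0).1 = p * (\dim {:repr_module c0})%:R.
  by rewrite -trace_id -trace_scale //; apply: eq_trace.
rewrite mulrAC -trace_scale //.
have -> : trace (fun w => p *: (PQ c0).2 w) = (\dim {:repr_module c0})%:R.
  by rewrite -trace_id; apply: eq_trace => w; rewrite -pE QP.
rewrite -expr2 exprn_gt0 // ltr0n lt0n dimv_eq0.
by have [W0 _] := Irr_irreducible c0I; apply/eqP.
Qed.

End FiniteOrder.

(** * The square of the antipode is the identity *)

Section TensorTrace.
Context (K : fieldType).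

Lemma trace_tensor (V W : vectType K) (F : V -> V) (G : W -> W) :
  linear F -> linear G ->
  trace (tlift (fun v w => tens (F v) (G w))) = trace F * trace G.
Proof.
move=> lF lG.
pose c (s : 'I_(\dim {:V}) * 'I_(\dim {:W})) (t : tensor V W) : K^o :=
  coord (vbasis {:W}) s.2 (t (dual_basis s.1)).
pose e (s : 'I_(\dim {:V}) * 'I_(\dim {:W})) : tensor V W :=
  tens (vbasis {:V})`_s.1 (vbasis {:W})`_s.2.
have lc s : linear (c s).
  by move=> a x y; rewrite /c add_lfunE scale_lfunE linearP.
have dec t : t = \sum_s c s t *: e s.
  rewrite -{1}(tens_decomp t) /tlift.
  rewrite -(pair_bigA _ (fun i j => c (i, j) t *: e (i, j))) /=.
  apply: eq_bigr => i _.
  rewrite [t (dual_basis i) in LHS]vbasis_frame (linS (f := tens _)); last by lin.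
  by apply: eq_bigr => j _; rewrite (linZ (f := tens _)) //; lin.
rewrite /trace (lftrace_sum_frame _ lc dec); last by lin.
rewrite -(pair_bigA _ (fun i j => c (i, j) (tlift (fun v w => tens (F v) (G w)) (e (i, j))))).
rewrite -!/(trace _) !traceE // mulr_suml; apply: eq_bigr => i _.
rewrite mulr_sumr; apply: eq_bigr => j _.
rewrite tlift_tens; last by lin.
by rewrite /c tensE dual_basisE linearZ.
Qed.

Lemma trace_idempotent (V : vectType K) (f : V -> V) : linear f ->
  (forall x, f (f x) = f x) -> exists2 n, trace f = n%:R & n = 0%N -> forall x, f x = 0.
Proof.
move=> lf ff; pose F := linfun f; pose U := limg F.
have fU x : f x \in U by rewrite -[f x](linfunE lf) memv_img ?memvf.
exists (\dim U) => [|/eqP]; last first.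
  rewrite dimv_eq0 => /eqP U0 x; apply/eqP; rewrite -memv0 -U0; exact: fU.
have -> : trace f = trace (fun x => vsval (vsproj U (f x))).
  by apply: eq_trace => x; rewrite vsprojK.
rewrite (traceC (f := vsval) (g := fun x => vsproj U (f x))); last 2 first.
- by move=> c x y; rewrite linearP.
- by lin.
transitivity (trace (fun u : subvs_of U => u)).
  apply: eq_trace => u; have /memv_imgP[x _ ux] := subvsP u.
  by apply: val_inj; rewrite /= vsprojK ?fU // ux linfunE // ff.
rewrite traceE // -[X in X%:R]card_ord -sumr_const.
have <- : \dim {:subvs_of U} = \dim U by rewrite dimvf.
by apply: eq_bigr => i _; rewrite coord_free ?eqxx ?(basis_free (vbasisP _)).
Qed.

End TensorTrace.

Section RegularCharacter.
Context (K : fieldType) (H : hopfAlgebra K).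
Implicit Types (U : lmodType K) (h y : H).

Local Notation S := (antipode H).

Definition regular_char (a : H) : K^o := trace (fun y => a * y).
Local Notation chi := regular_char.

Lemma regular_char_linear : linear chi.
Proof. by apply: trace_linear; lin. Qed.

(* Conjugating by the Galois map [x \otimes z |-> x_(1) \otimes x_(2) z] turns  *)
(* the diagonal action on [H \otimes H] into the action on the first factor.   *)
Lemma regular_charM y :
  \sw_(a, b <- y) (chi a * chi b : K^o) = chi y *+ \dim {:H}.
Proof.
have lchi := regular_char_linear.
pose D t := \sw_(a, b <- y) tlift (fun x z => tens (a * x) (b * z)) t.
pose B := tlift (fun x z : H => \sw_(a, b <- x) tens a (b * z)).
pose C := tlift (fun x z : H => \sw_(a, b <- x) tens a (S b * z)).
pose E := tlift (fun x z : H => tens (y * x) z).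
have lB : linear B by rewrite /B; lin.
have lC : linear C by rewrite /C; lin.
have lE : linear E by rewrite /E; lin.
have CB t : C (B t) = t.
  apply: (tensor_ext (f := fun t => C (B t)) (g := id)); [by lin|by []|] => x z.
  rewrite {1}/B tlift_tens; last by lin.
  rewrite (lin_tlift_comm _ _ lC).
  transitivity (\sw_(w, b <- x) \sw_(p, q <- w) tens p (S q * (b * z))).
    by apply: eq_tlift => w b; rewrite /C tlift_tens //; lin.
  reassoc; rewrite -[RHS](@sw_counitr _ _ _ (fun p => tens p z)); last by lin.
  apply: eq_tlift => p w; under eq_tlift do rewrite mulrA.
  by rewrite (@sw_Sl _ _ _ (fun q => tens p (q * z))) ?mul1r //; lin.
have DE t : D t = B (E (C t)).
  apply: (tensor_ext (g := fun t => B (E (C t)))); [by rewrite /D; lin|by lin|] => x z.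
  rewrite [in RHS]/C tlift_tens; last by lin.
  rewrite (@lin_tlift_comm _ _ _ _ _ (fun t => B (E t))); last by lin.
  transitivity (\sw_(w, c <- x) \sw_(p, q <- w) \sw_(a, b <- y)
     tens (a * p) (b * (q * (S c * z)))); last first.
    apply: eq_tlift => w c; rewrite [in RHS]/E tlift_tens; last by lin.
    rewrite /B tlift_tens; last by lin.
    rewrite sw_mul; last by lin.
    by rewrite tlift_exchange; do 2!apply: eq_tlift => * ; rewrite !mulrA.
  reassoc.
  rewrite /D; under eq_tlift do tlift_pure.
  rewrite -[LHS](@sw_counitr _ _ _ (fun x => \sw_(a, b <- y) tens (a * x) (b * z))); last by lin.
  apply: eq_tlift => p w; rewrite tlift_exchange.
  rewrite [LHS](@lin_tlift_comm _ _ _ _ _ (fun u => _ *: u)); last by lin.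
  apply: eq_tlift => a b; under eq_tlift do rewrite [_ * (S _ * z)]mulrA.
  by rewrite (@sw_Sr _ _ _ (fun q => tens (a * p) (b * (q * z)))) ?mul1r //; lin.
have tD : trace D = \sw_(a, b <- y) (chi a * chi b : K^o).
  rewrite /D /tlift trace_sum; last by lin.
  by apply: eq_bigr => i _; rewrite trace_tensor //; lin.
rewrite -tD (eq_trace DE) (traceC (f := B) (g := fun t => E (C t))); [|by lin ..].
rewrite (eq_trace (g := E)); last by move=> t; rewrite CB.
rewrite trace_tensor; [|by lin ..].
by rewrite trace_id mulr_natr.
Qed.

End RegularCharacter.

Section LarsonRadford.
Context (K : numClosedFieldType) (H : hopfAlgebra K).
Implicit Types (U : lmodType K) (h y : H).

Local Notation eps := (hcounit H).
Local Notation S := (antipode H).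

Context (L : H).
Local Notation lam := (@antipode_sq_trace K H).
Local Notation g := (modular_grouplike L lam).
Local Notation chi := (@regular_char K H).
Local Notation d := (\dim {:H}).

Context (ip : integral_pair L lam).

Let Ll h : h * L = (eps h : K) *: L. Proof. exact: (int_l ip). Qed.
Let Lr h : L * h = (eps h : K) *: L. Proof. exact: (int_r ip). Qed.
Let L1 : eps L = 1. Proof. exact: (int_counit ip). Qed.
Let SL : S L = L. Proof. exact: (int_antipode ip). Qed.
Let lam_lin : linear lam. Proof. exact: (dint_linear ip). Qed.

Lemma antipode_sq_finite_order : exists2 m, (0 < m)%N &
  forall y, iter m (fun y => S (S y)) y = y.
Proof.
have gg := sw_modular ip.
have eg := counit_modular ip.
have glg : grouplike g.
  split=> //; rewrite -gg; last by lin.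
  by rewrite tens_decomp.
have [|m m0 gm] := grouplike_order glg.
  move=> x gx0; rewrite -[x]mul1r -(antipode_modularl ip).
  by rewrite -mulrA gx0 mulr0.
have S4 k y : iter (k.*2) (fun y => S (S y)) y * g ^+ k = g ^+ k * y.
  elim: k y => [|k IH] y; first by rewrite mul1r mulr1.
  rewrite doubleS !iterS exprS mulrA (antipode4 ip).
  by rewrite -!mulrA IH.
(* Two iterations of [S^2] make one of [S^4], which is conjugation by [g]. *)
exists m.*2; first by rewrite double_gt0.
by move=> y; have := S4 m y; rewrite gm mul1r mulr1.
Qed.

Lemma trace_antipode_sq_gt0 : semisimple H -> 0 < lam 1.
Proof.
move=> ss; have [m m0 Tm] := antipode_sq_finite_order.
rewrite -(trace_antipode2 ip).
apply: (trace_automorphism_gt0 (e := eps) ss _ _ _ m0 Tm).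
- by lin.
- by move=> x y; rewrite !antipodeM.
- by rewrite !antipode1.
- by lin.
- exact: hcounitM.
- exact: hcounit1.
- by move=> x; rewrite !counit_antipode.
Qed.

Context (ss : semisimple H).

(** At 1, [lam_modular] reads [lam 1 *: 1 = lam 1 *: g], and positivity allows cancelling. *)
Lemma modular_trivial : g = 1.
Proof.
have := lam_modular ip 1.
rewrite sw1; last by lin.
by move/(scalerI (lt0r_neq0 (trace_antipode_sq_gt0 ss))).
Qed.

Lemma regular_char_antipode_sq y : chi (S (S y)) = chi y.
Proof.
(* The exponent is now [m.+1], so the [m]-th iterate is the inverse of [S^2]. *)
have [[//|m] _ Tm] := antipode_sq_finite_order.
have lTm : linear (iter m (fun y => S (S y))).
  by elim: (m) => [|k IH] //=; lin.
rewrite /regular_char.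
rewrite (eq_trace (g := fun x => S (S (y * iter m (fun y => S (S y)) x)))); last first.
  move=> x; rewrite !antipodeM; congr (_ * _); exact/esym/(Tm x).
rewrite (traceC (f := fun x => S (S x)) (g := fun x => y * iter m (fun y => S (S y)) x)).
- by apply: eq_trace => x; congr (_ * _); rewrite -[RHS]Tm iterSr.
- by lin.
- by lin.
Qed.

Lemma regular_char_haar : chi L = 1.
Proof.
rewrite /regular_char (eq_trace (g := fun y => (eps y : K) *: L)) => [|y]; last exact: Lr.
by rewrite trace_rank1 //; lin.
Qed.

Let T y := S (S y).
Let E y := \sw_(a, b <- y) (chi a : K) *: b.

Lemma antipode_sq_involutive y : S (S (S (S y))) = y.
Proof.
have := antipode4 ip y.
by rewrite modular_trivial mulr1 mul1r.
Qed.

Lemma trace_antipode_sq_char : trace (fun y => S (S (E y))) = lam 1.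
Proof.
have lchi : linear chi := @regular_char_linear _ H.
rewrite (trace_frobenius ip); last by rewrite /E; lin.
transitivity (\sw_(x, e <- L) \sw_(a, c <- x) ((chi (S e) : K) * lam (T (S c) * a) : K^o)).
  reassoc; apply: (@eq_tlift _ K^o) => a b; rewrite /E sw_antipode; last by lin.
  rewrite (@lin_tlift_comm _ _ _ _ _ (fun u => lam (S (S u) * a))); last by lin.
  apply: (@eq_tlift _ K^o) => c e.
  by rewrite !linearZ /= -scalerAl (linZ lam_lin).
transitivity (\sw_(x, e <- L) ((eps x : K) *: (chi (S e) * lam 1 : K^o))).
  apply: (@eq_tlift _ K^o) => x e.
  under eq_tlift do rewrite /T (nakayama ip).
  by rewrite (@sw_Sr _ _ _ (fun u => (chi (S e) : K) * lam u : K^o)) //; lin.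
rewrite (@sw_counitl _ _ _ (fun e => chi (S e) * lam 1 : K^o)); last by lin.
by rewrite SL regular_char_haar mul1r.
Qed.

(* [E / d] is an idempotent commuting with [T = S^2], so [tr (T E) / d] is an   *)
(* integer, while [tr (T E) = tr T].  Hence [d] divides [tr T], which is        *)
(* positive and at most [d] since [T^2 = 1].                                   *)
Lemma antipode_sq_id y : S (S y) = y.
Proof.
have lchi : linear chi := @regular_char_linear _ H.
have d0 : d%:R != 0 :> K.
  rewrite pnatr_eq0 dimv_eq0; apply/eqP => V0.
  have : (1 : H) \in {:H}%VS by rewrite memvf.
  by rewrite V0 memv0 oner_eq0.
have n2 : 2%:R != 0 :> K by rewrite pnatr_eq0.
have lE : linear E by rewrite /E; lin.
have TE x : T (E x) = E (T x).
  rewrite /T /E (@lin_tlift_comm _ _ _ _ _ (fun u => S (S u))); last by lin.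
  rewrite sw_antipode; last by lin.
  rewrite sw_antipode; last by lin.
  by apply: eq_tlift => a b; rewrite !linearZ /= regular_char_antipode_sq.
have EE x : E (E x) = d%:R *: E x.
  rewrite {2}/E (lin_tlift_comm _ _ lE).
  transitivity (\sw_(w, c <- x) \sw_(a, b <- w) ((chi a * chi b : K) *: c)).
    reassoc; apply: eq_tlift => a w; rewrite (linZ lE) /E.
    rewrite [LHS](@lin_tlift_comm _ _ _ _ _ (fun u => _ *: u)); last by lin.
    by apply: eq_tlift => b c; rewrite scalerA.
  rewrite [in RHS]/E [RHS](@lin_tlift_comm _ _ _ _ _ (fun u => _ *: u)); last by lin.
  apply: eq_tlift => w c.
  rewrite -[LHS](@lin_tlift_comm _ _ _ _ _ (fun u : K^o => (u : K) *: c)); last by lin.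
  by rewrite regular_charM scalerA mulr_natl.
have TT x : T (T x) = x by exact: antipode_sq_involutive.
have lT : linear T by rewrite /T; lin.
pose E' x := d%:R^-1 *: E x.
have lE' : linear E' by rewrite /E'; lin.
have E'E' x : E' (E' x) = E' x.
  by rewrite /E' (linZ lE) EE [d%:R^-1 *: (d%:R *: _)]scalerA mulVf // scale1r.
have TE' x : T (E' x) = E' (T x) by rewrite /E' (linZ lT) TE.
(* For [s] equal to 1 or -1 and [F] an idempotent commuting with [T], this projects onto the
   [s]-eigenspace of [T] in the image of [F]; its trace is a natural number. *)
pose F_ (s : K) (F : H -> H) x := 2^-1 *: (F x + s *: T (F x)).
have idem s F : s * s = 1 -> linear F -> (forall x, F (F x) = F x) ->
    (forall x, T (F x) = F (T x)) -> forall x, F_ s F (F_ s F x) = F_ s F x.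
  move=> s1 lF FF TF x.
  have FG z : F (F_ s F z) = F_ s F z.
    by rewrite /F_ (linZ lF) (linD lF) (linZ lF) -TF FF.
  have sT : s *: T (F_ s F x) = F_ s F x.
    rewrite /F_ (linZ lT) (linD lT) (linZ lT) TT scalerA mulrC -scalerA.
    by rewrite scalerDr scalerA s1 scale1r addrC.
  rewrite {1}/F_ FG sT -mulr2n -scaler_nat scalerA mulVf // scale1r //.
have lF s F : linear F -> linear (F_ s F) by move=> lF; rewrite /F_; lin.
have trF s F : linear F -> trace (F_ s F) = 2^-1 * (trace F + s * trace (fun x => T (F x))).
  move=> lF1; rewrite /F_ trace_scale; last by lin.
  rewrite traceD ?trace_scale //; by lin.
have s1 : 1 * 1 = 1 :> K by rewrite mulr1.
have sN : -1 * -1 = 1 :> K by rewrite mulrNN mulr1.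
have lid : linear (fun x : H => x) by [].
have [p pE _] := trace_idempotent (lF 1 E' lE') (idem 1 E' s1 lE' E'E' TE').
have [q qE _] := trace_idempotent (lF (-1) E' lE') (idem (-1) E' sN lE' E'E' TE').
have [P PE _] := trace_idempotent (lF 1 id lid) (idem 1 id s1 lid (fun _ => erefl) (fun _ => erefl)).
have [Q QE Q0] := trace_idempotent (lF (-1) id lid) (idem (-1) id sN lid (fun _ => erefl) (fun _ => erefl)).
rewrite !trF // in pE qE PE QE.
have tE : trace (fun x => T (E' x)) = d%:R^-1 * lam 1.
  rewrite -trace_antipode_sq_char -trace_scale; last by lin.
  by apply: eq_trace => x; rewrite /E' (linZ lT).
have tT : trace (fun x : H => T x) = lam 1 by exact: (trace_antipode2 ip).
have t0 := trace_antipode_sq_gt0 ss.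
rewrite trace_id tT mulN1r in QE; rewrite trace_id tT mul1r in PE.
rewrite tE mulN1r in qE; rewrite tE mul1r in pE.
have half u v z : 2^-1 * (u + v) = z%:R -> u + v = (z%:R : K) + z%:R.
  by move=> <-; rewrite -[RHS]mulr2n -[RHS]mulr_natl mulrA divff // mul1r.
move/half: pE => pE; move/half: qE => qE; move/half: PE => PE; move/half: QE => QE.
have dE : d%:R = (P + Q)%:R :> K.
  apply: (mulfI n2); rewrite natrD.
  transitivity ((d%:R + lam 1) + (d%:R - lam 1) : K); first by ring.
  by rewrite PE QE; ring.
have lE1 : lam 1 = P%:R - Q%:R.
  apply: (mulfI n2).
  transitivity ((d%:R + lam 1) - (d%:R - lam 1) : K); first by ring.
  by rewrite PE QE; ring.
have pq : d%:R^-1 * lam 1 = p%:R - q%:R.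
  apply: (mulfI n2); set x := _ * lam 1 in pE qE *.
  transitivity ((trace E' + x) - (trace E' - x) : K); first by ring.
  by rewrite pE qE; ring.
(* [P], [Q] are the dimensions of the eigenspaces of [T] for 1 and -1 on [H], and [p], [q] those on
   the image of [E']. This is [P - Q = (P + Q)(p - q)] without subtraction: [P > Q] forces [p > q],
   hence [P - Q >= P + Q] and [Q = 0]. *)
have natE : (P + (P + Q) * q = Q + (P + Q) * p)%N.
  apply/eqP; rewrite -(eqr_nat K) !natrD !natrM -dE; apply/eqP.
  have e : P%:R - Q%:R = d%:R * (p%:R - q%:R) :> K by rewrite -pq mulVKf // lE1.
  by apply/eqP; rewrite -subr_eq0 -(subrr (P%:R - Q%:R)) {2}e; apply/eqP; ring.
have QP : (Q < P)%N by rewrite -(ltr_nat K) -subr_gt0 -lE1.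
have {}Q0 : forall x, F_ (-1) id x = 0.
  apply: Q0; have [le|lt] := leqP p q.
    by have := leq_mul (leqnn (P + Q)) le; lia.
  by have := leq_mul (leqnn (P + Q)) lt; rewrite mulnS; lia.
have := Q0 y; rewrite /F_ scaleN1r => /eqP.
by rewrite scaler_eq0 invr_eq0 (negPf n2) subr_eq0 => /eqP.
Qed.

Lemma antipode_sq_trace1 : lam 1 = d%:R.
Proof.
rewrite -(trace_antipode2 ip) -trace_id; apply: eq_trace => y.
exact: antipode_sq_id.
Qed.

End LarsonRadford.

(** * Computations with the Haar integrals *)

Section HaarPair.
Context (K : fieldType) (H : hopfAlgebra K) (L : H) (lam : H -> K^o).
Implicit Types (U : lmodType K) (h y X Y : H).

Local Notation eps := (hcounit H).
Local Notation S := (antipode H).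
Local Notation d := (\dim {:H}).

(** Collects what the positivity arguments supply; the computations with [D(H)] use these identities
    over a field in which, where needed, [d] is invertible. *)
Record haar_pair : Prop := HaarPair {
  haar_integral :> integral_pair L lam;
  haar_involutive : forall h, S (S h) = h;
  haar_r : forall h, \sw_(a, b <- h) (lam b : K) *: a = (lam h : K) *: 1;
  haar_inv : forall h, lam (S h) = lam h;
  haar1 : lam 1 = d%:R }.

Context (hp : haar_pair).

Let L1 : eps L = 1. Proof. exact: (int_counit hp). Qed.
Let SL : S L = L. Proof. exact: (int_antipode hp). Qed.
Let lam_lin : linear lam. Proof. exact: (dint_linear hp). Qed.
Let S2 h : S (S h) = h. Proof. exact: haar_involutive. Qed.

Lemma haarC x y : lam (x * y) = lam (y * x).
Proof. by rewrite -(nakayama hp) S2. Qed.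

Lemma sw_opSl U (F : H -> U) h : linear F ->
  \sw_(a, b <- h) F (S b * a) = (eps h : K) *: F 1.
Proof.
move=> lF; rewrite -counit_antipode -(@sw_Sr _ _ _ F) // sw_antipode; last by lin.
by apply: eq_tlift => a b; rewrite S2.
Qed.

Lemma sw_opSr U (F : H -> U) h : linear F ->
  \sw_(a, b <- h) F (b * S a) = (eps h : K) *: F 1.
Proof.
move=> lF; rewrite -counit_antipode -(@sw_Sl _ _ _ F) // sw_antipode; last by lin.
by apply: eq_tlift => a b; rewrite S2.
Qed.

Lemma sw_opSr_mid U (F : H -> H -> U) h : bilinear_map F ->
  \sw_(b, c <- h) \sw_(u, v <- c) F (u * S b) v = F 1 h.
Proof.
move=> [F1 F2]; unassoc.
rewrite -[RHS](@sw_counitl _ _ _ (F 1)) //; apply: eq_tlift => w v.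
by rewrite (sw_opSr (F := F^~ v)).
Qed.

(** With a second copy [a' \otimes b'] of the coproduct, both orders expand to the sum of
    [lam (S b * b') a \otimes a']: one by expanding [b] over the second copy, the other by expanding
    [b'] over the first. *)
Lemma haar_cocomm U (F : H -> H -> U) : bilinear_map F ->
  \sw_(a, b <- L) F a b = \sw_(a, b <- L) F b a.
Proof.
move=> [F1 F2].
have frob y : \sw_(a, b <- L) (lam (y * b) : K) *: S a = y.
  transitivity (\sw_(a, b <- L) (lam (S b * S y) : K) *: S a).
    by apply: eq_tlift => a b; rewrite -antipodeM haar_inv.
  rewrite -[RHS]S2 -[in RHS](frobenius_r hp (S y)) (@lin_tlift_comm _ _ _ _ _ S); last by lin.
  by apply: eq_tlift => a b; rewrite linearZ.
transitivity (\sw_(a, b <- L) \sw_(a', b' <- L) (lam (S b * b') : K) *: F a a').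
  apply: eq_tlift => a b.
  rewrite -{1}[b]S2 -{1}[S b]frob.
  rewrite (@lin_tlift_comm _ _ _ _ _ (fun u => F a (S u))); last by lin.
  by apply: eq_tlift => a' b'; rewrite [S (_ *: _)]linearZ /= S2 (linZ (F2 a)).
rewrite tlift_exchange; apply: eq_tlift => a' b'.
rewrite -{2}[b'](frobenius_r hp).
rewrite [RHS](@lin_tlift_comm _ _ _ _ _ (fun u => F u a')); last by lin.
by apply: eq_tlift => a b; rewrite (linZ (F1 a')).
Qed.

Lemma haar_trace a : trace (fun y => a * y) = lam a.
Proof.
rewrite (trace_frobenius hp); last by lin.
under eq_tlift do rewrite -mulrA.
rewrite (sw_opSl (F := fun u => lam (a * u))); last by lin.
by rewrite L1 scale1r mulr1.
Qed.

Lemma haar_rot3 U (F : H -> H -> H -> U) :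
  (forall b c, linear (fun a => F a b c)) ->
  (forall a c, linear (fun b => F a b c)) -> (forall a b, linear (F a b)) ->
  \sw_(a, x <- L) \sw_(b, c <- x) F a b c =
  \sw_(a, x <- L) \sw_(b, c <- x) F c a b.
Proof.
move=> F1 F2 F3; rewrite haar_cocomm; last by lin.
by rewrite (sw_assoc (F := fun b c a => F a b c)) //; lin.
Qed.

(** The dual counterpart of [haar_trace], with [L] in the role of [lam]; the factor [d] is
    [lam 1]. *)
Lemma trace_coregular (f : H -> K^o) : linear f ->
  trace (fun y => \sw_(a, b <- y) (f b : K) *: a) = d%:R * f L.
Proof.
move=> lf; rewrite (trace_frobenius hp); last by lin.
transitivity (\sw_(c, a <- L) \sw_(p, q <- a) (f (S p) * lam (S q * c) : K^o)).
  apply: (@eq_tlift _ K^o) => c a; rewrite sw_antipode; last by lin.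
  rewrite (@lin_tlift_comm _ _ _ _ _ (fun u => lam (u * c))); last by lin.
  by apply: (@eq_tlift _ K^o) => p q; rewrite -scalerAl (linZ lam_lin).
rewrite (haar_rot3 (F := fun c p q => f (S p) * lam (S q * c) : K^o)); [|by lin ..].
transitivity (\sw_(p, x <- L) (eps x : K) *: (f (S p) * lam 1 : K^o)).
  apply: (@eq_tlift _ K^o) => p x.
  by rewrite (@sw_Sl _ _ _ (fun u => f (S p) * lam u : K^o)) //; lin.
rewrite (@sw_counitr _ _ _ (fun p => f (S p) * lam 1 : K^o)); last by lin.
by rewrite SL (haar1 hp) mulrC.
Qed.

(** * Reversed Sweedler powers and the trace of twisted conjugation *)

Fixpoint rev_power n y : H :=
  if n is n'.+1 then \sw_(a, b <- y) rev_power n' b * a else (eps y : K) *: 1.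

Lemma rev_power_linear n : linear (rev_power n).
Proof. by elim: n => [|n IH] /=; lin. Qed.

Lemma rev_power1 y : rev_power 1 y = y.
Proof.
rewrite /=; under eq_tlift do rewrite -scalerAl mul1r.
by rewrite (@sw_counitr _ _ _ id).
Qed.

Lemma rev_powerD n k y :
  rev_power (n + k) y = \sw_(a, b <- y) rev_power k b * rev_power n a.
Proof.
have lr i := rev_power_linear i.
elim: n y => [|n IH] y.
  under [RHS]eq_tlift do rewrite /= -scalerAr mulr1.
  by rewrite (@sw_counitl _ _ _ (rev_power k)).
rewrite addSn /=.
transitivity (\sw_(a, x <- y) \sw_(b, c <- x) rev_power k c * rev_power n b * a).
  apply: eq_tlift => a b; rewrite IH.
  by rewrite (@lin_tlift_comm _ _ _ _ _ (fun u => u * a)) //; lin.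
unassoc; apply: eq_tlift => w c.
rewrite (@lin_tlift_comm _ _ _ _ _ (fun u => rev_power k c * u)); last by lin.
by apply: eq_tlift => a b; rewrite mulrA.
Qed.

Lemma rev_powerSr n y : rev_power n.+1 y = \sw_(a, b <- y) b * rev_power n a.
Proof. by rewrite -addn1 rev_powerD; under eq_tlift do rewrite rev_power1. Qed.

(* [G (S(X_(2)) y_(n) ... y_(1)) (S(X_(1)) y_(n+1) X_(3))]: up to [theta], the  *)
(* effect on [y] of [n] successive factors of a Sweedler power in [D(H)].      *)
Definition conj_power n U X y (G : H -> H -> U) : U :=
  \sw_(a, x <- X) \sw_(b, c <- x) \sw_(p, q <- y)
    G (S b * rev_power n p) (S a * q * c).

Lemma conj_power_liny n U X (G : H -> H -> U) : bilinear_map G ->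
  linear (fun y => conj_power n X y G).
Proof.
by move=> [G1 G2]; have lr := rev_power_linear n; rewrite /conj_power; lin.
Qed.

Lemma eq_conj_power n U X y (G G' : H -> H -> U) :
  (forall q z, G q z = G' q z) -> conj_power n X y G = conj_power n X y G'.
Proof. by move=> e; do 3!apply: eq_tlift => ? ?; rewrite e. Qed.

Lemma sw_conj U a z c (F : H -> H -> U) : bilinear_map F ->
  \sw_(k, l <- S a * z * c) F k l = \sw_(p, r <- a) \sw_(s, t <- z)
    \sw_(u, v <- c) F (S r * s * u) (S p * t * v).
Proof.
move=> [F1 F2]; rewrite sw_mul; last by lin.
rewrite sw_mul; last by lin.
by rewrite (sw_antipode (F := fun a b => \sw_(s, t <- z) \sw_(u, v <- c)
  F (a * s * u) (b * t * v))) //; lin.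
Qed.

Lemma conj_power_comp0 n U X Y y (G : H -> H -> U) : bilinear_map G ->
  conj_power n X y (fun q z => conj_power 0 Y z (fun q' z' => G (q' * q) z')) =
  conj_power n (X * Y) y G.
Proof.
move=> [G1 G2]; have lr := rev_power_linear n; rewrite /conj_power.
transitivity (\sw_(a, x <- X) \sw_(b, c <- x) \sw_(p, q <- y)
   \sw_(a', x' <- Y) \sw_(b', c' <- x')
   G (S b' * (S b * rev_power n p)) (S a' * (S a * q * c) * c')).
  do 5!apply: eq_tlift => ? ?; rewrite /=.
  under eq_tlift do rewrite -scalerAr mulr1 -scalerAl (linZ (G1 _)).
  by rewrite (@sw_counitl _ _ _ (fun z => G (S _ * _) (S _ * z * _))) //; lin.
transitivity (\sw_(a, x <- X) \sw_(a', x' <- Y) \sw_(b, c <- x)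
   \sw_(b', c' <- x') \sw_(p, q <- y)
   G (S b' * (S b * rev_power n p)) (S a' * (S a * q * c) * c')).
  apply: eq_tlift => a x; rewrite [RHS]tlift_exchange; apply: eq_tlift => b c.
  rewrite tlift_exchange; apply: eq_tlift => a' x'.
  by rewrite tlift_exchange.
rewrite sw_mul; last by lin.
do 2!apply: eq_tlift => ? ?; rewrite sw_mul; last by lin.
by do 3!apply: eq_tlift => ? ?; rewrite !antipodeM !mulrA.
Qed.

(** The telescoping step: the coproduct of [S(X_(1)) y X_(3)] brings a leg of [X_(3)] next to
    [S(X_(2))], and the two cancel by the opposite antipode identity. *)
Lemma conj_power_comp1 n U X Y y (G : H -> H -> U) : bilinear_map G ->
  conj_power n X y (fun q z => conj_power 1 Y z (fun q' z' => G (q' * q) z')) =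
  conj_power n.+1 (X * Y) y G.
Proof.
move=> [G1 G2]; have lr := rev_power_linear n; have lr1 := rev_power_linear 1; rewrite /conj_power.
symmetry; transitivity (\sw_(a, x <- X) \sw_(a', x' <- Y) \sw_(b, c <- x)
   \sw_(b', c' <- x') \sw_(y1, z <- y) \sw_(s, t <- z)
   G (S b' * (S b * s * rev_power n y1)) (S a' * (S a * t * c) * c')).
  rewrite sw_mul; last by lin.
  do 2!apply: eq_tlift => ? ?; rewrite sw_mul; last by lin.
  do 2!apply: eq_tlift => ? ?; unassoc; apply: eq_tlift => w t.
  rewrite rev_powerSr.
  rewrite (@lin_tlift_comm _ _ _ _ _ (fun u => G (S _ * u) _)); last by lin.
  by apply: eq_tlift => y1 s; rewrite !antipodeM !mulrA.
pull_at 2%N 1%N.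
transitivity (\sw_(a, x <- X) \sw_(p, r <- a) \sw_(a', x' <- Y) \sw_(b', c' <- x')
  \sw_(y1, z <- y) \sw_(s, t <- z)
   G (S b' * (S r * s * rev_power n y1)) (S a' * (S p * t * x) * c')).
  by unassoc.
symmetry; transitivity (\sw_(a, x <- X) \sw_(b, c <- x) \sw_(y1, z <- y)
   \sw_(a', x' <- Y) \sw_(b', c' <- x') \sw_(p, r <- a) \sw_(s, t <- z)
   \sw_(u, v <- c) G (S b' * (S r * s * (u * S b) * rev_power n y1))
     (S a' * (S p * t * v) * c')).
  do 5!apply: eq_tlift => ? ?; rewrite sw_conj; last by lin.
  by do 3!apply: eq_tlift => ? ?; rewrite rev_power1 !mulrA.
pull_at 7%N 2%N; pull_at 6%N 3%N; pull_at 5%N 4%N; pull_at 6%N 5%N.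
apply: eq_tlift => a x.
rewrite (sw_opSr_mid (F := fun k v => \sw_(p, r <- a) \sw_(a', x' <- Y)
  \sw_(b', c' <- x') \sw_(y1, z <- y) \sw_(s, t <- z)
  G (S b' * (S r * s * k * rev_power n y1)) (S a' * (S p * t * v) * c'))); last by lin.
by do 5!apply: eq_tlift => ? ?; rewrite mulr1.
Qed.

Lemma conj_power_comp n k U X Y y (G : H -> H -> U) : bilinear_map G ->
  conj_power n X y (fun q z => conj_power k Y z (fun q' z' => G (q' * q) z')) =
  conj_power (n + k) (X * Y) y G.
Proof.
elim: k n X Y y G => [|k IH] n X Y y G bG; have [G1 G2] := bG.
  by rewrite addn0 conj_power_comp0.
(* One factor is split off with parameter 1, so that all of [Y] stays with the other [k] factors. *)
transitivity (conj_power n X y (fun q z => conj_power k Y z (fun q1 z1 =>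
    conj_power 1 1 z1 (fun q2 z2 => G (q2 * (q1 * q)) z2)))).
  apply: eq_conj_power => q z; rewrite -[Y in LHS]mulr1 -conj_power_comp1.
    by do 2!apply: eq_conj_power => ? ?; rewrite mulrA.
  by lin.
rewrite (IH _ _ _ _ (fun q1 z1 => conj_power 1 1 z1 (fun q2 z2 => G (q2 * q1) z2))).
  by rewrite conj_power_comp1 // mulr1 addnS.
have lr1 := rev_power_linear 1; rewrite /conj_power; lin.
Qed.

Definition conj_trace n X : K :=
  trace (fun y => conj_power n X y (fun q z => (lam q : K) *: z)).

Lemma conj_trace_comp n k X Y :
  trace (fun y => conj_power n X y (fun q z =>
    conj_power k Y z (fun q' z' => (lam (q' * q) : K) *: z'))) =
  conj_trace (n + k) (X * Y).
Proof.
by apply: eq_trace => y; rewrite -conj_power_comp //; lin.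
Qed.

Lemma conj_power_tens n U X y (G : H -> H -> U) : bilinear_map G ->
  conj_power n X y G = tlift G (conj_power n X y (@tens K H H)).
Proof.
move=> bG; have lG := tlift_linear bG; rewrite /conj_power.
rewrite (lin_tlift_comm _ _ lG); apply: eq_tlift => a x.
rewrite (lin_tlift_comm _ _ lG); apply: eq_tlift => b c.
rewrite (lin_tlift_comm _ _ lG); apply: eq_tlift => p q.
by rewrite tlift_tens.
Qed.

(** Two operators coupled through [B]: expanding its first argument in a basis decouples them into a
    sum of ordinary composites, to which cyclicity applies. *)
Lemma trace_twistC (N Z : H -> tensor H H) (B : H -> H -> K^o) :
  linear N -> linear Z -> bilinear_map B ->
  trace (fun y => tlift (fun q z =>
    tlift (fun q' z' => (B q' q : K) *: z') (Z z)) (N y)) =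
  trace (fun y => tlift (fun q' z' =>
    tlift (fun q z => (B q' q : K) *: z) (N z')) (Z y)).
Proof.
move=> lN lZ [B1 B2].
pose e i := (vbasis {:H})`_i; pose c i : H -> K^o := coord (vbasis {:H}) i.
have lc i : linear (c i) by exact: coord_linear.
pose N_ i y := tlift (fun q z => (B (e i) q : K) *: z) (N y).
pose Z_ i y := tlift (fun q z => (c i q : K) *: z) (Z y).
have lN_ i : linear (N_ i) by rewrite /N_; lin.
have lZ_ i : linear (Z_ i) by rewrite /Z_; lin.
have BE q' q : B q' q = \sum_i c i q' * B (e i) q.
  rewrite [q' in LHS]vbasis_frame (linS (B1 q)).
  by apply: eq_bigr => i _; rewrite (linZ (B1 q)).
transitivity (\sum_i trace (fun y => Z_ i (N_ i y))).
  rewrite -trace_sum; last by lin.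
  apply: eq_trace => y; under [RHS]eq_bigr do rewrite /N_ lin_tlift_comm //.
  rewrite tlift_sum; apply: eq_tlift => q z.
  under [RHS]eq_bigr => i _.
    rewrite (linZ (lZ_ _)) /Z_ (@lin_tlift_comm _ _ _ _ _ (fun u => _ *: u)); last by lin.
    over.
  rewrite tlift_sum; apply: eq_tlift => q' z'.
  by rewrite BE scaler_suml; apply: eq_bigr => i _; rewrite scalerA mulrC.
under eq_bigr do rewrite traceC //.
rewrite -trace_sum; last by lin.
apply: eq_trace => y; under eq_bigr do rewrite /Z_ lin_tlift_comm //.
rewrite tlift_sum; apply: eq_tlift => q' z'.
under eq_bigr => i _.
  rewrite (linZ (lN_ _)) /N_ (@lin_tlift_comm _ _ _ _ _ (fun u => _ *: u)); last by lin.
  over.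
rewrite tlift_sum; apply: eq_tlift => q z.
by rewrite BE scaler_suml; apply: eq_bigr => i _; rewrite scalerA.
Qed.

(** All [n] factors are kept with [X] and none with [Y]; cyclicity exchanges the two operators, and
    symmetry of [lam] restores the order of its arguments. *)
Lemma conj_traceC n X Y : conj_trace n (X * Y) = conj_trace n (Y * X).
Proof.
rewrite -[in LHS](addn0 n) -[in RHS](add0n n) -!conj_trace_comp.
have bt := @tens_bilinear K H H.
have lY : linear (fun z => conj_power 0 Y z (@tens K H H)) by exact: conj_power_liny.
have lX : linear (fun z => conj_power n X z (@tens K H H)) by exact: conj_power_liny.
rewrite [LHS](eq_trace (g := fun y => tlift (fun q z =>
    tlift (fun q' z' => (lam (q' * q) : K) *: z') (conj_power 0 Y z (@tens K H H)))
    (conj_power n X y (@tens K H H)))); last first.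
  move=> y; rewrite -conj_power_tens; last by lin.
  by apply: eq_conj_power => q z; rewrite -conj_power_tens //; lin.
rewrite (trace_twistC (B := fun q' q => lam (q' * q))) //; last by lin.
apply: eq_trace => y; rewrite -conj_power_tens; last by lin.
apply: eq_conj_power => q z; rewrite -conj_power_tens; last by lin.
by apply: eq_conj_power => q' z'; rewrite haarC.
Qed.

Lemma lam_int_r U (F : H -> U) h : linear F ->
  \sw_(a, b <- h) (lam b : K) *: F a = (lam h : K) *: F 1.
Proof.
move=> lF; rewrite -(linZ lF) -(haar_r hp) (lin_tlift_comm _ _ lF).
by apply: eq_tlift => a b; rewrite (linZ lF).
Qed.

(** Right invariance, read backwards on [S b * q], multiplies [c] by a leg of [S b] that cancels it;
    a leg of [X] is thereby traded for a leg of [q]. *)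
Lemma lam_shift_r U (F : H -> U) X q : linear F ->
  \sw_(b, c <- X) (lam (S b * q) : K) *: F c =
  \sw_(q1, q2 <- q) (lam (S X * q2) : K) *: F q1.
Proof.
move=> lF.
transitivity (\sw_(b, c <- X) \sw_(p, r <- b) \sw_(q1, q2 <- q)
    (lam (S p * q2) : K) *: F (c * S r * q1)).
  apply: eq_tlift => b c.
  rewrite -[X in _ *: F X]mulr1 -(lam_int_r (F := fun u => F (c * u))); last by lin.
  rewrite sw_mul; last by lin.
  rewrite (sw_antipode (F := fun s t => \sw_(q1, q2 <- q) (lam (t * q2) : K) *: F (c * (s * q1)))); last by lin.
  by do 2!apply: eq_tlift => ? ?; rewrite mulrA.
reassoc.
rewrite -[RHS](@sw_counitr _ _ _ (fun X => \sw_(q1, q2 <- q) (lam (S X * q2) : K) *: F q1)); last by lin.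
apply: eq_tlift => p w.
rewrite (sw_opSr (F := fun u => \sw_(q1, q2 <- q) (lam (S p * q2) : K) *: F (u * q1))); last by lin.
by congr (_ *: _); apply: eq_tlift => ? ?; rewrite mul1r.
Qed.

Lemma lam_shift_l U (F : H -> U) X q : linear F ->
  \sw_(a, b <- X) (lam (S b * q) : K) *: F (S a) =
  \sw_(q1, q2 <- q) (lam (S X * q1) : K) *: F (S q2).
Proof.
move=> lF; symmetry.
transitivity (\sw_(a, x <- X) \sw_(r, p <- x) \sw_(q1, q2 <- q)
    (lam (S p * q1) : K) *: F (S q2 * (r * S a))).
  unassoc.
  rewrite -[LHS](@sw_counitl _ _ _ (fun X => \sw_(q1, q2 <- q) (lam (S X * q1) : K) *: F (S q2))); last by lin.
  apply: eq_tlift => w p.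
  rewrite (sw_opSr (F := fun u => \sw_(q1, q2 <- q) (lam (S p * q1) : K) *: F (S q2 * u))); last by lin.
  by congr (_ *: _); apply: eq_tlift => ? ?; rewrite mulr1.
apply: eq_tlift => a x.
rewrite -[S a in RHS]mul1r -antipode1.
rewrite -(lam_int hp (F := fun u => F (S u * S a))); last by lin.
rewrite sw_mul; last by lin.
rewrite (sw_antipode (F := fun s t => \sw_(q1, q2 <- q) (lam (s * q1) : K) *: F (S (t * q2) * S a))); last by lin.
by do 2!apply: eq_tlift => ? ?; rewrite antipodeM S2 mulrA.
Qed.

Lemma lam_shift U (F : H -> H -> U) X q : bilinear_map F ->
  \sw_(a, x <- X) \sw_(b, c <- x) (lam (S b * q) : K) *: F (S a) c =
  \sw_(q1, w <- q) \sw_(q2, q3 <- w) (lam (S X * q2) : K) *: F (S q3) q1.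
Proof.
move=> [F1 F2].
transitivity (\sw_(a, x <- X) \sw_(q1, q2 <- q) (lam (S x * q2) : K) *: F (S a) q1).
  by apply: eq_tlift => a x; rewrite lam_shift_r.
rewrite tlift_exchange; apply: eq_tlift => q1 q2.
by rewrite (lam_shift_l (F := F^~ q1)).
Qed.

(** The last factor of [S q3] is the antipode of a leg of [y_(n)] and meets [y_(n+1)]. They cancel,
    and another leg of [y_(n)], the first factor of [q1], takes the place of [y_(n+1)] for the next
    round. *)
Lemma rev_power_telescope n U (G : H -> H -> U) y : bilinear_map G ->
  \sw_(y1, y2 <- y) \sw_(q1, w <- rev_power n y1) \sw_(q2, q3 <- w)
    G (S q3 * y2 * q1) q2 =
  \sw_(y1, y2 <- y) G y1 (rev_power n y2).
Proof.
elim: n U G y => [|n IH] U G y [G1 G2].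
  transitivity (G y 1).
    rewrite -[RHS](@sw_counitl _ _ _ (fun y => G y 1)) //; apply: eq_tlift => y1 y2.
    rewrite /= (linZ (f := fun u => \sw_(q1, w <- u) _)); last by lin.
    rewrite sw1; last by lin.
    by rewrite sw1 ?antipode1 ?mul1r ?mulr1 //; lin.
  rewrite -[LHS](@sw_counitr _ _ _ (fun y => G y 1)) //; apply: eq_tlift => y1 y2.
  by rewrite (linZ (G2 y1)).
have lr := rev_power_linear n.
transitivity (\sw_(y1, y2 <- y) \sw_(a, b <- y1) \sw_(b1, x <- b) \sw_(b2, b3 <- x)
  \sw_(m1, v <- rev_power n a) \sw_(m2, m3 <- v)
  G (S m3 * (S b3 * y2) * b1 * m1) (b2 * m2)).
  apply: eq_tlift => y1 y2; rewrite rev_powerSr.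
  rewrite (@lin_tlift_comm _ _ _ _ _ (fun u => \sw_(q1, w <- u) \sw_(q2, q3 <- w)
    G (S q3 * y2 * q1) q2)); last by lin.
  apply: eq_tlift => a b; rewrite sw_mul; last by lin.
  apply: eq_tlift => b1 x.
  under eq_tlift => ? ? do (rewrite sw_mul; last by lin).
  rewrite tlift_exchange.
  by do 3!apply: eq_tlift => ? ?; rewrite antipodeM !mulrA.
reassoc.
transitivity (\sw_(a, w <- y) \sw_(b1, b2 <- w) \sw_(m1, v <- rev_power n a)
  \sw_(m2, m3 <- v) G (S m3 * b1 * m1) (b2 * m2)).
  apply: eq_tlift => a w; reassoc; apply: eq_tlift => b1 z; reassoc.
  rewrite -[RHS](@sw_counitr _ _ _ (fun z => \sw_(m1, v <- rev_power n a)
    \sw_(m2, m3 <- v) G (S m3 * b1 * m1) (z * m2))); last by lin.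
  apply: eq_tlift => b2 t.
  rewrite (@sw_Sl _ _ _ (fun u => \sw_(m1, v <- rev_power n a)
    \sw_(m2, m3 <- v) G (S m3 * u * b1 * m1) (b2 * m2))); last by lin.
  by congr (_ *: _); do 2!apply: eq_tlift => ? ?; rewrite mulr1.
unassoc.
transitivity (\sw_(x, b2 <- y) \sw_(c, e <- x) G c (b2 * rev_power n e)).
  by apply: eq_tlift => x b2; rewrite (IH _ (fun u v => G u (b2 * v))) //; lin.
reassoc; apply: eq_tlift => c w; rewrite rev_powerSr.
by rewrite (lin_tlift_comm _ _ (G2 c)).
Qed.

Lemma conj_power_lam n X y :
  conj_power n X y (fun q z => (lam q : K) *: z) =
  \sw_(a, b <- y) (lam (S X * rev_power n b) : K) *: a.
Proof.
rewrite /conj_power; pull_at 2%N 0%N.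
transitivity (\sw_(y1, y2 <- y) \sw_(q1, w <- rev_power n y1) \sw_(q2, q3 <- w)
    (lam (S X * q2) : K) *: (S q3 * y2 * q1)).
  by apply: eq_tlift => y1 y2; rewrite (lam_shift (F := fun u v => u * y2 * v)) //; lin.
by rewrite (rev_power_telescope _ (G := fun u v => (lam (S X * v) : K) *: u)) //; lin.
Qed.

Lemma rev_power_antipode n y : rev_power n (S y) = S (rev_power n y).
Proof.
have lr i := rev_power_linear i.
elim: n y => [|n IH] y; first by rewrite /= counit_antipode linearZ /= antipode1.
rewrite [LHS]/= sw_antipode; last by lin.
rewrite rev_powerSr (@lin_tlift_comm _ _ _ _ _ S); last by lin.
by apply: eq_tlift => a b; rewrite IH antipodeM.
Qed.

Lemma conj_traceE n X : conj_trace n X = d%:R * lam (X * rev_power n L).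
Proof.
have lr := rev_power_linear n.
rewrite /conj_trace (eq_trace (conj_power_lam n X)) trace_coregular; last by lin.
by congr (_ * _); rewrite -(haar_inv hp) antipodeM S2 -rev_power_antipode SL haarC.
Qed.

Lemma rev_power_integral_central n h : d%:R != 0 :> K ->
  rev_power n L * h = h * rev_power n L.
Proof.
move=> d0; apply/eqP; rewrite -subr_eq0; apply/eqP.
apply: (lam_nondegenerate hp) => x; rewrite mulrBl (linD lam_lin) -scaleN1r (linZ lam_lin).
rewrite scaleN1r; apply/eqP; rewrite subr_eq0 -mulrA haarC -[X in _ == X]haarC mulrA.
by have /(mulfI d0) -> := etrans (esym (conj_traceE n (h * x))) (etrans (conj_traceC n h x) (conj_traceE n (x * h))).
Qed.

Lemma trace_rev_power n q : d%:R != 0 :> K ->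
  trace (fun x => q * x * rev_power n L) = lam (q * rev_power n L).
Proof.
move=> d0; rewrite -haar_trace; apply: eq_trace => x.
by rewrite -!mulrA rev_power_integral_central.
Qed.

End HaarPair.

Lemma haar_pair_exists (K : numClosedFieldType) (H : hopfAlgebra K) :
  semisimple H -> exists L lam, @haar_pair _ H L lam.
Proof.
move=> ss; have [L Ll L1] := semisimple_left_integral ss.
have [SL Lr] := integral_two_sided Ll L1.
have ip : integral_pair L (@antipode_sq_trace K H).
  split=> //; first exact: antipode_sq_trace_linear.
    exact: antipode_sq_trace_integral.
  exact: antipode_sq_trace_at_integral.
exists L, (@antipode_sq_trace K H); split=> //.
- exact: (antipode_sq_id ip ss).
- by move=> h; rewrite (lam_modular ip) (modular_trivial ip ss).
- by move=> h; rewrite (lam_antipode ip) (modular_trivial ip ss) mul1r.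
- exact: (antipode_sq_trace1 ip ss).
Qed.

(** * The Drinfeld double *)

Section Theta.
Context (K : fieldType) (H : vectType K).
Implicit Types (V : vectType K).

Local Notation Hd := 'Hom(H, K^o).

(* [theta] identifies [H^* \otimes V] with the space of linear maps [H -> V]. *)
Definition theta V (t : tensor Hd V) (y : H) : V :=
  t (linfun (fun f : Hd => f y : K^o)).

Lemma ev_linear (y : H) : linear (fun f : Hd => f y : K^o).
Proof. by lin. Qed.

Lemma theta_tens V (f : Hd) (v : V) y : theta (tens f v) y = (f y : K) *: v.
Proof. by rewrite /theta tensE linfunE //; exact: ev_linear. Qed.

Lemma theta_linear V y : linear (fun t : tensor Hd V => theta t y).
Proof. by rewrite /theta; lin. Qed.

Lemma theta_lin V (t : tensor Hd V) : linear (theta t).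
Proof.
move=> c x y; rewrite /theta -linearP; congr (t _); apply/lfunP => f.
rewrite add_lfunE scale_lfunE !linfunE; [|exact: ev_linear ..].
by rewrite linearP.
Qed.

Lemma theta_inj V (t t' : tensor Hd V) : theta t =1 theta t' -> t = t'.
Proof.
(* Reflexivity: every functional [xi] on the dual is evaluation at this [y]. *)
move=> e; apply/lfunP => xi; pose y := \sum_i (xi (dual_basis i) : K) *: (vbasis {:H})`_i.
have -> : xi = linfun (fun f : Hd => f y : K^o).
  apply/lfunP => f; rewrite linfunE; last exact: ev_linear.
  have -> : f = \sum_(i < \dim {:H}) (f (vbasis {:H})`_i : K) *: dual_basis i.
    apply/lfunP => x; rewrite sum_lfunE {1}[x]vbasis_frame linear_sum.
    by apply: eq_bigr => i _; rewrite linearZ scale_lfunE dual_basisE /GRing.scale /= mulrC.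
  rewrite linear_sum sum_lfunE; apply: eq_bigr => i _.
  rewrite linearZ scale_lfunE dual_basisE; congr (_ *: _).
  by rewrite /y coord_sum_free // (basis_free (vbasisP _)).
exact: e.
Qed.

End Theta.

Section Double.
Context (K : fieldType) (H : hopfAlgebra K) (L : H) (lam : H -> K^o).
Context (hp : haar_pair L lam).
Implicit Types (U : lmodType K) (h y : H) (V : lmodule H).

Local Notation eps := (hcounit H).
Local Notation S := (antipode H).
Local Notation d := (\dim {:H}).
Local Notation Hd := 'Hom(H, K^o).

Let S2 h : S (S h) = h. Proof. exact: (haar_involutive hp). Qed.

Lemma dual_antipode_inv (g : Hd) h : (dual_antipode H)^-1%VF g h = g (S h).
Proof.
have ld : linear (fun f : Hd => (f \o antipode H)%VF).
  by move=> c f f'; apply/lfunP => x; rewrite comp_lfunE !add_lfunE !scale_lfunE !comp_lfunE.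
have dE f x : dual_antipode H f x = f (S x).
  by rewrite /dual_antipode linfunE // comp_lfunE.
have dd f : dual_antipode H (dual_antipode H f) = f.
  by apply/lfunP => x; rewrite !dE S2.
have inj : lker (dual_antipode H) == 0%VS.
  by apply/lker0P; apply: can_inj dd.
by rewrite -{1}[g]dd lker0_lfunK // dE.
Qed.

Lemma dual_comul_eval U (f : Hd) a b (v : U) :
  tlift (fun f1 f2 : Hd => (f1 a * f2 b : K) *: v) (dual_comul (A := hbialg H) f) =
  (f (a * b) : K) *: v.
Proof.
rewrite -(dual_comulE (A := hbialg H)); last by rewrite /=; lin.
by rewrite (@lin_tlift_comm _ _ _ _ _ (fun u : K^o => (u : K) *: v)) //; lin.
Qed.

Lemma dual_comul3_eval U (f : Hd) a b c (v : U) :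
  sweedler3 (A := dual (hbialg H)) (fun f1 f2 f3 : Hd =>
    (f1 a * f2 b * f3 c : K) *: v) f = (f (a * b * c) : K) *: v.
Proof.
rewrite /sweedler3 /sweedler2 /= -dual_comul_eval; apply: eq_tlift => g f3.
under eq_tlift do rewrite mulrC -scalerA.
rewrite -[LHS](@lin_tlift_comm _ _ _ _ _ (fun u => (f3 c : K) *: u)); last by lin.
by rewrite dual_comul_eval scalerA mulrC.
Qed.

Lemma dual_mul_bilinear : bilinear_map (@dual_mul K (hbialg H)).
Proof.
split=> [g | f] c f1 f2; apply/lfunP => x;
  rewrite add_lfunE scale_lfunE !dual_mulE.
  have l : linear (fun f : Hd => \sw_(a, b <- x) (f a * g b : K^o)) by lin.
  exact: l.
have l : linear (fun g : Hd => \sw_(a, b <- x) (f a * g b : K^o)) by lin.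
exact: l.
Qed.

Lemma bowtie_act_linl V t : linear (fun x => bowtie_act (V := V) x t).
Proof.
have ml g := proj1 dual_mul_bilinear g.
have mr f := proj2 dual_mul_bilinear f.
have cl := @dual_comul_linear K (hbialg H).
have al := act_linl (V := V); have ar := act_linr (V := V).
by rewrite /bowtie_act /sweedler3 /sweedler2 /=; lin.
Qed.

Lemma bowtie_act_linr V x : linear (bowtie_act (V := V) x).
Proof.
have ml g := proj1 dual_mul_bilinear g.
have mr f := proj2 dual_mul_bilinear f.
have cl := @dual_comul_linear K (hbialg H).
have al := act_linl (V := V); have ar := act_linr (V := V).
by rewrite /bowtie_act /sweedler3 /sweedler2 /=; lin.
Qed.

(** Evaluation at [y] turns the product of the dual into the coproduct of [y] and the three legs of
    [g] into the three factors of [S c * y2 * a], so only Sweedler sums in [H] remain. *)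
Lemma theta_act V x (t : tensor Hd V) y :
  theta (bowtie_act (V := V) x t) y =
  \sw_(y1, y2 <- y) \sw_(a, w <- theta x y1) \sw_(b, c <- w)
    act b (theta t (S c * y2 * a)).
Proof.
have al := act_linl (V := V); have ar := act_linr (V := V).
have tl W u := @theta_linear K H W u; have tr W u := @theta_lin K H W u.
move: x; apply: (tensor_ext (f := fun x => theta (bowtie_act (V := V) x t) y)
  (g := fun x => \sw_(y1, y2 <- y) \sw_(a, w <- theta x y1)
    \sw_(b, c <- w) act b (theta t (S c * y2 * a)))).
- exact: lin_comp (tl V y) (bowtie_act_linl t).
- by lin.
move=> f h.
move: t; apply: (tensor_ext (f := fun t => theta (bowtie_act (V := V) (tens f h) t) y)
  (g := fun t => \sw_(y1, y2 <- y) \sw_(a, w <- theta (tens f h) y1)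
    \sw_(b, c <- w) act b (theta t (S c * y2 * a)))).
- exact: lin_comp (tl V y) (bowtie_act_linr (tens f h)).
- by lin.
move=> g v; rewrite bowtie_actE.
transitivity (\sw_(y1, y2 <- y) \sw_(a, w <- h) \sw_(b, c <- w)
  ((f y1 : K) *: ((g (S c * y2 * a) : K) *: act b v))); last first.
  apply: eq_tlift => y1 y2; rewrite theta_tens.
  rewrite (linZ (f := fun u => \sw_(a, w <- u) _)); last by lin.
  rewrite [RHS](@lin_tlift_comm _ _ _ _ _ (fun u => (f y1 : K) *: u)); last by lin.
  apply: eq_tlift => a w.
  rewrite [RHS](@lin_tlift_comm _ _ _ _ _ (fun u => (f y1 : K) *: u)); last by lin.
  by apply: eq_tlift => b c; rewrite theta_tens (linZ (ar b)).
transitivity (\sw_(y1, y2 <- y) \sw_(a, w <- h) \sw_(b, c <- w)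
  sweedler3 (A := dual (hbialg H)) (fun g1 g2 g3 : Hd =>
    ((g1 (S c) * g2 y2 * g3 a : K) *: ((f y1 : K) *: act b v))) g); last first.
  do 3!apply: eq_tlift => ? ?.
  by rewrite dual_comul3_eval !scalerA mulrC.
symmetry; rewrite /sweedler3 /sweedler2 /=.
pull_at 3%N 0%N; pull_at 4%N 1%N; swap_at 2%N; swap_at 3%N.
rewrite [RHS](lin_tlift_comm _ _ (tl V y)); apply: eq_tlift => x g3.
rewrite [RHS](lin_tlift_comm _ _ (tl V y)); apply: eq_tlift => g1 g2.
rewrite [RHS](lin_tlift_comm _ _ (tl V y)).
transitivity (\sw_(x, h3 <- h) theta (\sw_(h1, h2 <- x)
  (g3 h1 * g1 (S h3) : K) *: tens (dual_mul (A := hbialg H) f g2) (act h2 v)) y); last first.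
  apply: eq_tlift => ? ?; congr (theta _ y).
  by apply: eq_tlift => ? ?; rewrite dual_antipode_inv.
under [RHS]eq_tlift do rewrite (lin_tlift_comm _ _ (tl V y)).
rewrite sw_assoc; [|by lin ..].
do 2!apply: eq_tlift => ? ?; rewrite (linZ (tl V y)) theta_tens dual_mulE.
rewrite [X in _ = X](@lin_tlift_comm _ _ _ _ _ (fun u : K^o => _ *: ((u : K) *: _))); last by lin.
apply: eq_tlift => y1 y2; rewrite !scalerA; congr (_ *: _); ring.
Qed.

Lemma theta_act_pure V (f : Hd) h (t : tensor Hd V) y :
  theta (bowtie_act (V := V) (tens f h) t) y =
  \sw_(y1, y2 <- y) \sw_(a, w <- h) \sw_(b, c <- w)
    (f y1 : K) *: act b (theta t (S c * y2 * a)).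
Proof.
have al := act_linl (V := V); have ar := act_linr (V := V).
have tr W u := @theta_lin K H W u.
rewrite theta_act; apply: eq_tlift => y1 y2; rewrite theta_tens.
rewrite (linZ (f := fun u => \sw_(a, w <- u) _)); last by lin.
rewrite [LHS](@lin_tlift_comm _ _ _ _ _ (fun u => (f y1 : K) *: u)); last by lin.
apply: eq_tlift => a w.
by rewrite [LHS](@lin_tlift_comm _ _ _ _ _ (fun u => (f y1 : K) *: u)) //; lin.
Qed.

Lemma theta_act_pureC V (f : Hd) h (t : tensor Hd V) y :
  theta (bowtie_act (V := V) (tens f h) t) y =
  \sw_(a, w <- h) \sw_(b, c <- w) \sw_(y1, y2 <- y)
    (f y1 : K) *: act b (theta t (S c * y2 * a)).
Proof. by rewrite theta_act_pure; swap_at 0%N; swap_at 1%N. Qed.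

(** Lets the factors of a Sweedler power in [D(H)] act one at a time. Under [theta] both sides reach
    the same normal form. *)
Lemma bowtie_act_assoc V x x' (t : tensor Hd V) :
  bowtie_act (V := V) (bowtie_act (V := regular H) x x') t =
  bowtie_act (V := V) x (bowtie_act (V := V) x' t).
Proof.
have al := act_linl (V := V); have ar := act_linr (V := V).
have tl W u := @theta_linear K H W u; have tr W u := @theta_lin K H W u.
apply: theta_inj => y.
transitivity (\sw_(p, w <- y) \sw_(w1, w2 <- w) \sw_(a1, u <- theta x p)
  \sw_(a2, w' <- u) \sw_(b, c <- w') \sw_(c1, c2 <- c)
  \sw_(k1, k' <- theta x' (S c2 * w1 * a1)) \sw_(k2, k3 <- k')
    act (m := V) (b * k2) (theta t (S k3 * (S c1 * w2 * a2) * k1))).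
  transitivity (\sw_(y1, y2 <- y) \sw_(p, q <- y1) \sw_(a1, w <- theta x p)
    \sw_(b1, c1 <- w) \sw_(r1, r' <- b1)
    \sw_(k1, k' <- theta x' (S c1 * q * a1)) \sw_(r2, r3 <- r') \sw_(k2, k3 <- k')
    act (m := V) (r2 * k2) (theta t (S (r3 * k3) * y2 * (r1 * k1)))).
    rewrite theta_act; apply: eq_tlift => y1 y2.
    rewrite (theta_act (V := regular H)).
    have lG : linear (fun u => \sw_(a, w <- u) \sw_(b, c <- w)
      act (m := V) b (theta t (S c * y2 * a))) by lin.
    rewrite (lin_tlift_comm _ _ lG); apply: eq_tlift => p q.
    rewrite (lin_tlift_comm _ _ lG); apply: eq_tlift => a1 w.
    rewrite (lin_tlift_comm _ _ lG); apply: eq_tlift => b1 c1.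
    rewrite [act _ _]/= sw_mul; last by lin.
    by do 2!apply: eq_tlift => ? ?; rewrite sw_mul; last by lin.
  reassoc; do 3!apply: eq_tlift => ? ?.
  swap_at 2%N; reassoc; apply: eq_tlift => ? ?; reassoc.
  by do 4!apply: eq_tlift => ? ?; rewrite antipodeM !mulrA.
symmetry; transitivity (\sw_(p, w <- y) \sw_(a, w' <- theta x p) \sw_(b, c <- w')
  \sw_(c1, c2 <- c) \sw_(w1, w2 <- w) \sw_(a1, a2 <- a)
  \sw_(k1, k' <- theta x' (S c2 * w1 * a1)) \sw_(k2, k3 <- k')
    act (m := V) (b * k2) (theta t (S k3 * (S c1 * w2 * a2) * k1))).
  rewrite theta_act; do 2!apply: eq_tlift => ? ?; apply: eq_tlift => b c.
  rewrite theta_act lin_tlift_comm //.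
  rewrite -[RHS](@sw_conj _ _ _ _ _ _ (fun z1 z2 => \sw_(k1, k' <- theta x' z1)
    \sw_(k2, k3 <- k') act (m := V) (b * k2) (theta t (S k3 * z2 * k1)))); last by lin.
  apply: eq_tlift => ? ?; rewrite lin_tlift_comm //; apply: eq_tlift => ? ?.
  by rewrite lin_tlift_comm //; apply: eq_tlift => ? ?; rewrite actM.
pull_at 4%N 1%N; pull_at 5%N 3%N.
by do 2!apply: eq_tlift => ? ?; reassoc.
Qed.

End Double.

Lemma normalized_integral_unique (K : fieldType) (A : bialgData K) (L : A) :
  is_normalized_integral L -> normalized_integral A = L.
Proof.
move=> iL; have [iL' e'] : is_normalized_integral (normalized_integral A).
  by apply: (@xgetPex _ 0 [set L : A | is_normalized_integral L]); exists L.
have [iL1 e1] := iL; set L' := normalized_integral A in iL' e' *.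
have [h1 _] := iL1 L'; have [_ h2] := iL' L.
by rewrite h1 e' e1 !scale1r in h2.
Qed.

Section Double.
Context (K : fieldType) (H : hopfAlgebra K) (L : H) (lam : H -> K^o).
Context (hp : haar_pair L lam) (d0 : (\dim {:H})%:R != 0 :> K).
Implicit Types (U : lmodType K) (h y : H) (V : lmodule H).

Local Notation eps := (hcounit H).
Local Notation S := (antipode H).
Local Notation d := (\dim {:H}).
Local Notation Hd := 'Hom(H, K^o).
Local Notation D := (drinfeld_double H).

Let Ll h : h * L = (eps h : K) *: L. Proof. exact: (int_l hp). Qed.
Let Lr h : L * h = (eps h : K) *: L. Proof. exact: (int_r hp). Qed.
Let L1 : eps L = 1. Proof. exact: (int_counit hp). Qed.
Let lam_lin : linear lam. Proof. exact: (dint_linear hp). Qed.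

Lemma haar_normalized : normalized_integral (hbialg H) = L.
Proof. by apply: normalized_integral_unique; split=> [h|]; [split; [exact: Ll | exact: Lr] | exact: L1]. Qed.

Lemma haar_normalized_cop : normalized_integral (cop (hbialg H)) = L.
Proof. by apply: normalized_integral_unique; split=> [h|]; [split; [exact: Ll | exact: Lr] | exact: L1]. Qed.

(** The counit of the dual is evaluation at 1, and [lam 1 = d]; hence the scalar. *)
Definition dual_haar : Hd := linfun (fun y => d%:R^-1 * lam y : K^o).

Lemma dual_haarE y : dual_haar y = d%:R^-1 * lam y.
Proof. by rewrite linfunE //; lin. Qed.

Lemma theta_counit (x : tensor Hd H) :
  tensor_counit (A := cop (dual (hbialg H))) (B := hbialg H) x = eps (theta x 1).
Proof.
have tl u := @theta_linear K H H u.
apply: (tensor_ext (f := fun x => tensor_counit (A := cop (dual (hbialg H))) (B := hbialg H) x : K^o)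
  (g := fun x => eps (theta x 1))); [by rewrite /tensor_counit /=; lin|by lin|].
move=> f h; rewrite /tensor_counit tlift_tens; last by rewrite /=; lin.
by rewrite theta_tens linearZ.
Qed.

Lemma double_integral : normalized_integral D = tens dual_haar L.
Proof.
have tl W u := @theta_linear K H W u; have tr W u := @theta_lin K H W u.
apply: normalized_integral_unique; split=> [x|]; last first.
  rewrite /= theta_counit theta_tens linearZ /= L1 dual_haarE (haar1 hp).
  by rewrite mulVf // [_ *: _]mulr1.
rewrite [bcounit _]theta_counit; split; apply: theta_inj => y.
  rewrite [LHS](theta_act hp (V := regular H)).
  rewrite (linZ (tl H y)) theta_tens dual_haarE.
  transitivity (\sw_(y1, y2 <- y) (lam y2 : K) *:
    ((d%:R^-1 * eps (theta x y1)) *: L)).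
    apply: eq_tlift => y1 y2.
    transitivity (\sw_(a, w <- theta x y1)
      (dual_haar (S w * y2 * a) : K) *: L).
      apply: eq_tlift => a w.
      rewrite -[RHS](@sw_counitl _ _ _ (fun c => (dual_haar (S c * y2 * a) : K) *: L)); last by lin.
      apply: eq_tlift => b c; rewrite theta_tens /act /= -scalerAr Ll !scalerA.
      by rewrite mulrC.
    under eq_tlift do rewrite dual_haarE (haarC hp) mulrA.
    rewrite (@sw_Sr _ _ _ (fun u => (d%:R^-1 * lam (u * y2) : K) *: L)); last by lin.
    by rewrite mul1r !scalerA; congr (_ *: _); ring.
  rewrite (lam_int_r hp (F := fun y1 => (d%:R^-1 * eps (theta x y1)) *: L)); last by lin.
  by rewrite !scalerA; congr (_ *: _); ring.
rewrite [LHS](theta_act_pure hp (V := regular H)).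
rewrite (linZ (tl H y)) theta_tens dual_haarE.
transitivity (\sw_(y1, y2 <- y) (lam y1 : K) *:
    (d%:R^-1 *: \sw_(a, w <- L) \sw_(b, c <- w) b * theta x (S c * y2 * a))).
  apply: eq_tlift => y1 y2; rewrite scalerA.
  rewrite [RHS](@lin_tlift_comm _ _ _ _ _ (fun u => _ *: u)); last by lin.
  apply: eq_tlift => a w.
  rewrite [RHS](@lin_tlift_comm _ _ _ _ _ (fun u => _ *: u)); last by lin.
  by apply: eq_tlift => b c; rewrite dual_haarE mulrC.
rewrite (lam_int hp (F := fun y2 => d%:R^-1 *: \sw_(a, w <- L) \sw_(b, c <- w)
  b * theta x (S c * y2 * a))); last by lin.
have -> : \sw_(a, w <- L) \sw_(b, c <- w) b * theta x (S c * 1 * a) =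
    (eps (theta x 1) : K) *: L.
  (* The rotation makes the two factors around 1 into [S(L_(2))] and [L_(3)], which cancel. *)
  rewrite (haar_rot3 hp (F := fun a b c => b * theta x (S c * 1 * a))); [|by lin ..].
  rewrite -Lr -[RHS](@sw_counitr _ _ _ (fun u => u * theta x 1)); last by lin.
  apply: eq_tlift => a w; under eq_tlift do rewrite mulr1.
  by rewrite (@sw_Sl _ _ _ (fun u => a * theta x u)) //; lin.
by rewrite !scalerA; congr (_ *: _); ring.
Qed.

Lemma sweedler_power_hbialgS n h :
  sweedler_power (A := hbialg H) n.+1 h =
  \sw_(a, b <- h) sweedler_power (A := hbialg H) n a * b.
Proof.
case: n => [|n] //=; under eq_tlift do rewrite -scalerAl mul1r.
by rewrite (@sw_counitl _ _ _ id).
Qed.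

Lemma sweedler_power_hbialg_linear n : linear (@sweedler_power K (hbialg H) n).
Proof.
elim: n => [|n IH]; first by rewrite /=; lin.
apply: (eq_lin (f := fun h => \sw_(a, b <- h) sweedler_power (A := hbialg H) n a * b)).
  by move=> h; rewrite sweedler_power_hbialgS.
by lin.
Qed.

Lemma sweedler_power_cop n h :
  sweedler_power (A := cop (hbialg H)) n.+1 h = rev_power n.+1 h.
Proof.
have lr := @rev_power_linear K H.
elim: n h => [|n IH] h; first by rewrite rev_power1.
rewrite [LHS]/= /sweedler2.
transitivity (tlift (fun a b => rev_power n.+1 a * b)
  (sweedler2 (A := hbialg H) (fun a1 a2 => tens a2 a1) h)).
  by apply: eq_tlift => a b; rewrite -IH.
rewrite /sweedler2 /=.
rewrite (@lin_tlift_comm _ _ _ _ _ (tlift (fun a b => rev_power n.+1 a * b))); last by lin.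
by apply: eq_tlift => a b; rewrite tlift_tens //; lin.
Qed.

(** The dual factor carries the opposite coproduct, whence [f2] before [f1]. *)
Lemma sweedler2_double U (F : D -> D -> U) f h : bilinear_map F ->
  sweedler2 (A := D) F (tens f h : tensor Hd H) =
  tlift (fun f1 f2 : Hd => \sw_(a, b <- h)
    F (tens f2 a : tensor Hd H) (tens f1 b : tensor Hd H))
    (dual_comul (A := hbialg H) f).
Proof.
move=> bF; have [F1 F2] := bF; have cl := @dual_comul_linear K (hbialg H).
rewrite /sweedler2 /= /tensor_comul tlift_tens; last first.
  by rewrite /sweedler2 /= /sweedler2 /=; lin.
rewrite /sweedler2 /= /sweedler2 /=; have lF := tlift_linear bF.
rewrite (@lin_tlift_comm _ _ _ _ _ (fun u => tlift F (tlift (fun a1 a2 : Hd =>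
  \sw_(b1, b2 <- h) tens (tens a1 b1) (tens a2 b2)) u))); last by lin.
apply: eq_tlift => f1 f2; rewrite tlift_tens; last by lin.
by rewrite (lin_tlift_comm _ _ lF); apply: eq_tlift => a b; rewrite tlift_tens.
Qed.

Lemma bowtie_bilinear V : bilinear_map (@bowtie_act K H V).
Proof. by split=> ?; [exact: bowtie_act_linl | exact: bowtie_act_linr]. Qed.

Lemma double_comul_linear : linear (@bcomul K D).
Proof.
have cl := @dual_comul_linear K (hbialg H).
by rewrite /= /tensor_comul /sweedler2 /= /sweedler2; lin.
Qed.

Lemma sweedler_power_double_linear n : linear (@sweedler_power K D n.+1).
Proof.
have [ml mr] := bowtie_bilinear (regular H).
have cl := double_comul_linear.
elim: n => [|n IH] //; apply: sweedler2_linear => //.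
by split=> [y | x]; [apply: lin_comp (ml y) IH | exact: mr].
Qed.

Lemma conj_power_comm n U U' (F : U -> U') X y (G : H -> H -> U) : linear F ->
  F (conj_power n X y G) = conj_power n X y (fun q z => F (G q z)).
Proof.
move=> lF; rewrite /conj_power lin_tlift_comm //; apply: eq_tlift => ? ?.
by rewrite lin_tlift_comm //; apply: eq_tlift => ? ?; rewrite lin_tlift_comm.
Qed.

Lemma conj_power_exchange n U (V W : vectType K) X y (G : V -> W -> H -> H -> U)
    (t : tensor V W) :
  tlift (fun v w => conj_power n X y (G v w)) t =
  conj_power n X y (fun q z => tlift (fun v w => G v w q z) t).
Proof.
rewrite /conj_power tlift_exchange; apply: eq_tlift => ? ?.
by rewrite tlift_exchange; apply: eq_tlift => ? ?; rewrite tlift_exchange.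
Qed.

Lemma conj_power01 U y (G : H -> H -> U) : bilinear_map G ->
  conj_power 0 1 y G = G 1 y.
Proof.
move=> [G1 G2]; rewrite /conj_power sw1; last by rewrite /=; lin.
rewrite sw1; last by rewrite /=; lin.
rewrite -[RHS](@sw_counitl _ _ _ (G 1)) //; apply: eq_tlift => p q.
by rewrite antipode1 mulr1 !mul1r (linZ (G1 q)).
Qed.

Lemma conj_power1_split U X z (G : H -> H -> U) : bilinear_map G ->
  conj_power 1 X z G =
  \sw_(c, a <- X) \sw_(u1, u2 <- S c * z) G u1 (u2 * a).
Proof.
move=> [G1 G2]; rewrite /conj_power; have lr := @rev_power_linear K H 1.
symmetry; transitivity (\sw_(x, c <- X) \sw_(a, b <- x) \sw_(p, q <- z)
  G (S b * p) (S a * q * c)).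
  apply: eq_tlift => x c; rewrite sw_mul; last by lin.
  by rewrite sw_antipode //; lin.
reassoc; do 3!apply: eq_tlift => ? ?; by rewrite rev_power1.
Qed.

(* The middle factors have been merged into [conj_power]; the outer legs [a]    *)
(* and [c] are merged as well once the trace is taken.                         *)
Definition kappa k (f : Hd) a p c y : H :=
  \sw_(y1, y2 <- y) conj_power k p (y2 * a)
    (fun q z => (f (q * y1) : K) *: (S c * z)).

(** Adjacent outer legs of neighbouring factors merge, so [k.+1] factors give only a [conj_power k];
    the two legs at the ends, [h1] and [h4], stay free until the trace closes the cycle. *)
Lemma act_sweedler_power_double V k (f : Hd) h (t : tensor Hd V) y :
  theta (bowtie_act (V := V) (sweedler_power (A := D) k.+1 (tens f h)) t) y =
  \sw_(h1, w <- h) \sw_(h2, w' <- w) \sw_(h3, h4 <- w')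
    \sw_(p1, p2 <- sweedler_power (A := hbialg H) k h2)
      act (p1 * h3) (theta t (kappa k f h1 p2 h4 y)).
Proof.
have al := act_linl (V := V); have ar := act_linr (V := V).
have tl W u := @theta_linear K H W u; have tr W u := @theta_lin K H W u.
have cl := @dual_comul_linear K (hbialg H).
have lr k' := @rev_power_linear K H k'.
have lP k' := sweedler_power_hbialg_linear k'.
elim: k f h t y => [|k IH] f h t y.
  rewrite [LHS](theta_act_pure hp).
  transitivity (\sw_(h1, w <- h) \sw_(h3, h4 <- w)
    act h3 (theta t (kappa 0 f h1 1 h4 y))).
    swap_at 0%N; apply: eq_tlift => a w; swap_at 0%N; apply: eq_tlift => b c.
    have lF : linear (fun u => act b (theta t u)) by lin.
    rewrite /kappa [RHS](lin_tlift_comm _ _ lF); apply: eq_tlift => y1 y2.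
    rewrite conj_power01; last by lin.
    by rewrite (linZ lF) mul1r mulrA.
  apply: eq_tlift => h1 w.
  rewrite -[LHS](@sw_counitl _ _ _ (fun w => \sw_(h3, h4 <- w)
    act h3 (theta t (kappa 0 f h1 1 h4 y)))); last by rewrite /kappa /conj_power; lin.
  apply: eq_tlift => h2 w'.
  rewrite [LHS](@lin_tlift_comm _ _ _ _ _ (fun u => (eps h2 : K) *: u)); last by lin.
  apply: eq_tlift => h3 h4.
  rewrite [sweedler_power _ _]/=.
  rewrite (linZ (f := fun u => \sw_(p1, p2 <- u) act (p1 * h3) (theta t (kappa 0 f h1 p2 h4 y)))); last by rewrite /kappa /conj_power; lin.
  by rewrite sw1 ?mul1r //; rewrite /kappa /conj_power; lin.
have bP : bilinear_map (fun a1 a2 : D => bowtie_act (V := regular H) (sweedler_power (A := D) k.+1 a1) a2).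
  split=> [w|v]; last exact: (bowtie_act_linr (V := regular H)).
  exact: lin_comp (bowtie_act_linl (V := regular H) w) (sweedler_power_double_linear k).
rewrite [sweedler_power _ _]/= [sweedler2 _ _](sweedler2_double f h bP).
have lF : linear (fun x => theta (bowtie_act (V := V) x t) y).
  exact: lin_comp (tl V y) (bowtie_act_linl t).
rewrite (lin_tlift_comm _ _ lF).
transitivity (\sw_(h', h'' <- h) \sw_(h1, w <- h') \sw_(h2, w' <- w)
  \sw_(h3, h4 <- w') \sw_(a, x <- h'') \sw_(b, c <- x)
  \sw_(p1, p2 <- sweedler_power (A := hbialg H) k h2)
  \sw_(y1, y2 <- y) conj_power k p2 (y2 * h1) (fun q z =>
    \sw_(u1, u2 <- S h4 * z)
      (f (u1 * (q * y1)) : K) *: act (p1 * h3 * b) (theta t (S c * u2 * a)))).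
  transitivity (tlift (fun f1 f2 : Hd => \sw_(h', h'' <- h) \sw_(h1, w <- h')
    \sw_(h2, w' <- w) \sw_(h3, h4 <- w')
    \sw_(a, x <- h'') \sw_(b, c <- x)
    \sw_(p1, p2 <- sweedler_power (A := hbialg H) k h2)
    \sw_(y1, y2 <- y) conj_power k p2 (y2 * h1) (fun q z =>
    \sw_(u1, u2 <- S h4 * z)
      (f1 u1 * f2 (q * y1) : K) *: act (p1 * h3 * b) (theta t (S c * u2 * a))))
    (dual_comul (A := hbialg H) f)).
    apply: eq_tlift => f1 f2.
    rewrite (lin_tlift_comm _ _ lF); apply: eq_tlift => h' h''.
    rewrite (bowtie_act_assoc hp) IH.
    apply: eq_tlift => h1 w; apply: eq_tlift => h2 w'; apply: eq_tlift => h3 h4.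
    symmetry; pull_at 2%N 0%N; symmetry; apply: eq_tlift => p1 p2.
    rewrite (theta_act_pureC hp) lin_tlift_comm //; apply: eq_tlift => a x.
    rewrite lin_tlift_comm //; apply: eq_tlift => b c.
    pose Phi u := act (m := V) (p1 * h3) (\sw_(u1, u2 <- u)
      (f1 u1 : K) *: act b (theta t (S c * u2 * a))).
    have lPhi : linear Phi by rewrite /Phi; lin.
    rewrite -[LHS]/(Phi _) /kappa (lin_tlift_comm _ _ lPhi); apply: eq_tlift => y1 y2.
    rewrite conj_power_comm //; apply: eq_conj_power => q z.
    rewrite (linZ lPhi) /Phi lin_tlift_comm //.
    rewrite [LHS](@lin_tlift_comm _ _ _ _ _ (fun u => _ *: u)); last by lin.
    by apply: eq_tlift => u1 u2; rewrite (linZ (ar _)) -actM scalerA [f1 _ * _]mulrC.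
  do 8!(rewrite tlift_exchange; apply: eq_tlift => ? ?).
  rewrite conj_power_exchange; apply: eq_conj_power => q z.
  rewrite tlift_exchange; apply: eq_tlift => u1 u2.
  by rewrite dual_comul_eval.
symmetry; transitivity (\sw_(h1, w <- h) \sw_(g2, v <- w) \sw_(b, c <- v)
  \sw_(h2, e <- g2) \sw_(p1, p2 <- sweedler_power (A := hbialg H) k h2)
  \sw_(h3, X <- e) \sw_(h4, a <- X) \sw_(y1, y2 <- y)
  conj_power k p2 (y2 * h1) (fun q z => \sw_(u1, u2 <- S h4 * z)
      (f (u1 * (q * y1)) : K) *: act (p1 * h3 * b) (theta t (S c * u2 * a)))).
  apply: eq_tlift => h1 w; apply: eq_tlift => g2 v; apply: eq_tlift => b c.
  rewrite sweedler_power_hbialgS.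
  rewrite (@lin_tlift_comm _ _ _ _ _ (fun u => \sw_(p1, p2 <- u)
    act (m := V) (p1 * b) (theta t (kappa k.+1 f h1 p2 c y)))); last first.
    by rewrite /kappa /conj_power; lin.
  apply: eq_tlift => h2 e; rewrite sw_mul; last by rewrite /kappa /conj_power; lin.
  apply: eq_tlift => p1 p2; apply: eq_tlift => h3 X.
  rewrite [RHS]tlift_exchange.
  pose Phi u := act (m := V) (p1 * h3 * b) (theta t u).
  have lPhi : linear Phi by rewrite /Phi; lin.
  rewrite -[LHS]/(Phi _) /kappa (lin_tlift_comm _ _ lPhi); apply: eq_tlift => y1 y2.
  rewrite -(conj_power_comp1 hp); last by lin.
  rewrite conj_power_exchange conj_power_comm //; apply: eq_conj_power => q z.
  rewrite conj_power_comm // conj_power1_split; last by lin.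
  apply: eq_tlift => h4 a; apply: eq_tlift => u1 u2.
  by rewrite (linZ lPhi) !mulrA.
rewrite /conj_power.
pull_at 3%N 2%N; pull_at 5%N 3%N; pull_at 6%N 4%N.
reassoc_at 1%N; reassoc_at 2%N; reassoc_at 3%N.
symmetry; reassoc_at 0%N; reassoc_at 1%N; reassoc_at 2%N.
by [].
Qed.

End Double.

(** * Frobenius-Schur indicators *)

Section Indicator.
Context (K : fieldType) (H : hopfAlgebra K) (L : H) (lam : H -> K^o).
Context (hp : haar_pair L lam) (d0 : (\dim {:H})%:R != 0 :> K).
Implicit Types (U : lmodType K) (h y : H) (V : lmodule H).

Local Notation S := (antipode H).
Local Notation d := (\dim {:H}).
Local Notation Hd := 'Hom(H, K^o).
Local Notation D := (drinfeld_double H).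

Let lam_lin : linear lam. Proof. exact: (dint_linear hp). Qed.

Lemma trace_tlift (V W X : vectType K) (F : V -> W -> X -> X) (t : tensor V W) :
  (forall v w, linear (F v w)) ->
  trace (fun x => tlift (fun v w => F v w x) t) =
  tlift (fun v w => trace (F v w) : K^o) t.
Proof. by move=> lF; exact: trace_sum. Qed.

Lemma mchar_tensor V (W : lmodule H) h :
  mchar (tensor_module V W) h = \sw_(a, b <- h) (mchar V a * mchar W b : K^o).
Proof.
have al := act_linl (V := V); have ar := act_linr (V := V).
have bl := act_linl (V := W); have br := act_linr (V := W).
rewrite /mchar -/(trace _) (eq_trace (g := fun t => \sw_(a, b <- h)
  tlift (fun (v : V) (w : W) => tens (act a v) (act b w)) t)); last first.
  by move=> t; rewrite /= /sweedler2 tlift_exchange.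
rewrite trace_tlift; last by lin.
by apply: (@eq_tlift _ K^o) => a b; rewrite trace_tensor.
Qed.

Lemma mchar_linear V : linear (mchar V : H -> K^o).
Proof.
have al := act_linl (V := V); have ar := act_linr (V := V).
exact: (trace_linear (F := fun (a : H) (v : V) => act a v)).
Qed.

(** The trace on the tensor product, depending on the operator only through its evaluations;
    Sweedler sums of evaluations can be pulled out of it term by term. *)
Definition theta_trace V (G : tensor Hd V -> H -> V) : K :=
  \sum_(i < d) \sum_(j < \dim {:V}) coord (vbasis {:V}) j
    (G (tens (dual_basis i) (vbasis {:V})`_j) (vbasis {:H})`_i).

Lemma trace_theta V (F : tensor Hd V -> tensor Hd V) : linear F ->
  trace F = theta_trace (fun t y => theta (F t) y).
Proof.
move=> lF; have tl y := @theta_linear K H V y; have tr t := @theta_lin K H V t.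
pose c (s : 'I_d * 'I_(\dim {:V})) (t : tensor Hd V) : K^o :=
  coord (vbasis {:V}) s.2 (theta t (vbasis {:H})`_s.1).
pose e (s : 'I_d * 'I_(\dim {:V})) : tensor Hd V :=
  tens (dual_basis s.1) (vbasis {:V})`_s.2.
have lc s : linear (c s) by move=> a x y; rewrite /c tl linearP.
have dec t : t = \sum_s c s t *: e s.
  apply: theta_inj => y; rewrite (linS (tl y)) {1}[y]vbasis_frame (linS (tr t)).
  rewrite -(pair_bigA _ (fun i j => theta (c (i, j) t *: e (i, j)) y)) /=.
  apply: eq_bigr => i _; rewrite (linZ (tr t)) [theta t _ in LHS]vbasis_frame scaler_sumr.
  apply: eq_bigr => j _; rewrite [RHS](linZ (tl y)) theta_tens dual_basisE !scalerA.
  by rewrite mulrC.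
by rewrite /trace (lftrace_sum_frame lF lc dec) /theta_trace pair_bigA.
Qed.

Lemma theta_trace_tlift V (X Y : vectType K) (G : X -> Y -> tensor Hd V -> H -> V)
    (u : tensor X Y) :
  theta_trace (fun t y => tlift (fun a b => G a b t y) u) =
  tlift (fun a b => theta_trace (G a b) : K^o) u.
Proof.
rewrite /theta_trace -tlift_sum; apply: eq_bigr => i _.
rewrite -tlift_sum; apply: eq_bigr => j _.
by rewrite (lin_tlift_comm _ _ (@coord_linear _ V j)).
Qed.

Lemma theta_trace_act V (a : H) (k : H -> H) : linear k ->
  theta_trace (fun t y => act (m := V) a (theta t (k y))) = mchar V a * trace k.
Proof.
move=> lk; have ar := act_linr (V := V).
rewrite /theta_trace mulrC traceE // mulr_suml; apply: eq_bigr => i _.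
rewrite /mchar -/(trace _) traceE // mulr_sumr; apply: eq_bigr => j _.
by rewrite theta_tens (linZ (ar a)) linearZ dual_basisE.
Qed.

Local Notation P n := (sweedler_power (A := hbialg H) n).
Local Notation f0 := (dual_haar lam).

Lemma kappa_linear k a p c : linear (kappa k f0 a p c).
Proof. by have lr := @rev_power_linear K H k; rewrite /kappa /conj_power; lin. Qed.

Lemma trace_kappa_linear k :
  [/\ forall p c, linear (fun a => trace (kappa k f0 a p c) : K^o),
      forall a c, linear (fun p => trace (kappa k f0 a p c) : K^o)
    & forall a p, linear (fun c => trace (kappa k f0 a p c) : K^o)].
Proof.
have lr := @rev_power_linear K H k.
by split=> ? ?; apply: trace_linear => *; rewrite /kappa /conj_power; lin.
Qed.

(** Cyclicity moves [S c] to the other end, where it joins [a] to form one more factor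
    [conj_power 1 x]; the [d^-1] of [dual_haar] cancels the [d] of [conj_traceE]. *)
Lemma trace_kappa k p x :
  \sw_(c, a <- x) (trace (kappa k f0 a p c) : K^o) =
  lam (p * x * rev_power k.+1 L).
Proof.
have lr := @rev_power_linear K H k.
pose k0 a y := \sw_(y1, y2 <- y) conj_power k p (y2 * a)
  (fun q z => (f0 (q * y1) : K) *: z).
have lk0 a : linear (k0 a) by rewrite /k0 /conj_power; lin.
have lkS c : linear (fun y : H => S c * y) by lin.
transitivity (\sw_(c, a <- x) (trace (fun y => k0 a (S c * y)) : K^o)).
  apply: (@eq_tlift _ K^o) => c a; rewrite -(traceC (lkS c) (lk0 a)).
  apply: (@eq_trace K H) => y; rewrite /k0 /kappa lin_tlift_comm //; apply: eq_tlift => y1 y2.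
  by rewrite conj_power_comm //; apply: eq_conj_power => q z; rewrite (linZ (lkS c)).
rewrite -(trace_tlift (F := fun c a y => k0 a (S c * y))); last first.
  by move=> c a; exact: lin_comp (lk0 a) (lkS c).
transitivity (d%:R^-1 * conj_trace lam (1 + k)%N (x * p)).
  rewrite -(conj_trace_comp hp) -trace_scale; last first.
    by have lr1 := @rev_power_linear K H 1; rewrite /conj_power; lin.
  apply: (@eq_trace K H) => y.
  rewrite conj_power1_split; last first.
    by rewrite /conj_power; lin.
  rewrite [RHS](@lin_tlift_comm _ _ _ _ _ (fun u => d%:R^-1 *: u)); last by lin.
  apply: eq_tlift => c a; rewrite /k0.
  rewrite [RHS](@lin_tlift_comm _ _ _ _ _ (fun u => d%:R^-1 *: u)); last by lin.
  apply: eq_tlift => y1 y2.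
  rewrite [RHS](@conj_power_comm _ _ _ _ _ (fun u => d%:R^-1 *: u)); last by lin.
  by apply: eq_conj_power => q z; rewrite (dual_haarE hp) scalerA.
rewrite (conj_traceC hp) add1n (conj_traceE hp) mulrA mulVf // mul1r.
by [].
Qed.

(** Cocommutativity of [L] carries the first leg behind the last, so that the two free outer legs
    become the coproduct of a single [x]. *)
Lemma haar_rot_power (P : H -> H) (chi : H -> K^o) (T : H -> H -> H -> K^o) :
  linear P -> linear chi -> (forall p c, linear (fun a => T a p c)) ->
  (forall a c, linear (fun p => T a p c)) -> (forall a p, linear (T a p)) ->
  \sw_(h1, w <- L) \sw_(h2, w' <- w) \sw_(h3, h4 <- w')
    \sw_(p1, p2 <- P h2) (chi (p1 * h3) * T h1 p2 h4 : K^o) =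
  \sw_(h2, r <- L) \sw_(p1, p2 <- P h2) \sw_(h3, x <- r)
    (chi (p1 * h3) * \sw_(c, a <- x) T a p2 c : K^o).
Proof.
move=> lP lchi T1 T2 T3.
transitivity (\sw_(h2, r <- L) \sw_(p1, p2 <- P h2) \sw_(h3, x <- r)
    \sw_(c, a <- x) (chi (p1 * h3) * T a p2 c : K^o)); last first.
  do 3!apply: (@eq_tlift _ K^o) => ? ?.
  by rewrite [RHS](@lin_tlift_comm _ K^o _ _ _ (fun u : K^o => _ * u)) //; lin.
rewrite (haar_cocomm hp); last by lin.
reassoc_at 0%N; reassoc_at 1%N.
by pull_at 3%N 1%N.
Qed.

Lemma indicator_double V n :
  FSindicator D (bowtie_module V) n.+1 =
  \sw_(a, b <- P n.+1 L) (mchar V a * lam (b * rev_power n.+1 L) : K^o).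
Proof.
have lV := mchar_linear V; have [lka lkp lkc] := trace_kappa_linear n.
have lP := @sweedler_power_hbialg_linear K H.
rewrite /FSindicator (double_integral hp d0) /mchar -/(trace _).
rewrite (trace_theta (bowtie_act_linr _)).
transitivity (theta_trace (fun (t : tensor Hd V) y =>
  \sw_(h1, w <- L) \sw_(h2, w' <- w) \sw_(h3, h4 <- w')
    \sw_(p1, p2 <- P n h2)
      act (p1 * h3) (theta t (kappa n f0 h1 p2 h4 y)))).
  congr theta_trace; apply: funext => t; apply: funext => y.
  exact: (act_sweedler_power_double hp).
transitivity (\sw_(h1, w <- L) \sw_(h2, w' <- w) \sw_(h3, h4 <- w')
    \sw_(p1, p2 <- P n h2) (mchar V (p1 * h3) * trace (kappa n f0 h1 p2 h4) : K^o)).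
  rewrite theta_trace_tlift; apply: (@eq_tlift _ K^o) => h1 w.
  rewrite theta_trace_tlift; apply: (@eq_tlift _ K^o) => h2 w'.
  rewrite theta_trace_tlift; apply: (@eq_tlift _ K^o) => h3 h4.
  rewrite theta_trace_tlift; apply: (@eq_tlift _ K^o) => p1 p2.
  by rewrite theta_trace_act //; exact: kappa_linear.
rewrite (haar_rot_power (T := fun a p c => trace (kappa n f0 a p c) : K^o) (lP n)) //.
rewrite sweedler_power_hbialgS.
pose F u := \sw_(a, b <- u) (mchar V a * lam (b * rev_power n.+1 L) : K^o).
have bF : bilinear_map (fun a b => mchar V a * lam (b * rev_power n.+1 L) : K^o).
  by move: (mchar V) lV => chi lchi; lin.
have lF : linear F by exact: lin_tlift bF (lin_fun (hcomul H) (@lin_id _ H)).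
rewrite -[RHS]/(F _) [RHS](lin_tlift_comm _ _ lF).
apply: (@eq_tlift _ K^o) => h2 r; rewrite /F [RHS](sw_mul _ _ bF).
apply: (@eq_tlift _ K^o) => p1 p2; apply: (@eq_tlift _ K^o) => h3 x.
by rewrite trace_kappa.
Qed.

End Indicator.

Theorem corollary5p27 (R : realType) (H : hopfAlgebra R[i])
    (Hss : semisimple H) (V : lmodule H) (n : nat) (Hn : (1 <= n)%N) :
  FSindicator (drinfeld_double H) (bowtie_module V) n =
  \sum_(W \in Irr H)
    FSindicator (hbialg H) (tensor_module V (repr_module W)) n *
    FSindicator (cop (hbialg H)) (repr_module W) n.
Proof.
have [L [lam hp]] := haar_pair_exists Hss.
have d0 : (\dim {:H})%:R != 0 :> R[i].
  rewrite pnatr_eq0 dimv_eq0; apply/eqP => V0.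
  have : (1 : H) \in {:H}%VS by rewrite memvf.
  by rewrite V0 memv0 oner_eq0.
case: n Hn => // n _.
rewrite (indicator_double hp d0).
have [r sum1] := regular_sum_simple 1 Hss.
have irrE : Irr H = [set` simple_classes r]%classic.
  by apply/seteqP; split=> c /=; rewrite (simple_classesP sum1).
rewrite irrE -fsbig_seq; last exact: undup_uniq.
rewrite /FSindicator (haar_normalized hp) (haar_normalized_cop hp).
rewrite sweedler_power_cop.
symmetry; transitivity (\sum_(c <- simple_classes r)
  \sw_(a, b <- sweedler_power (A := hbialg H) n.+1 L) (mchar V a *
    (mchar (repr_module c) b * mchar (repr_module c) (rev_power n.+1 L)) : R[i]^o)).
  apply: eq_bigr => c _; rewrite mchar_tensor /tlift mulr_suml.
  by apply: eq_bigr => i _; rewrite mulrA.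
rewrite tlift_sum; apply: (@eq_tlift _ R[i]^o) => a b.
rewrite -mulr_sumr -(trace_bimult sum1).
by rewrite (trace_rev_power hp).
Qed.
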